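(* Let $M$ be a compact Riemannian manifold, $N$ a compact metric space, $\mathcal F$ a family of $C^1$ local diffeomorphisms of $M$, $\mathcal S$ the associated family of skew products on $M\times N$ (defined in the context), $\alpha>0$ and $c>0$. Let $$\mathcal G_c=\{(F,\phi)\in\mathcal S\times C^\alpha(M\times N):\ \phi\text{ is a }c\text{-hyperbolic potential for }F,\text{ and } \{b_F^{-n}(x)\}_{n\ge0}\text{ is dense in }M\text{ for all }x\in M\},$$ where $b_F$ denotes the base dynamics of $F$, with the topology induced by the product topology. Then the function $\mathcal G_c\to\mathbb R$, $(F,\phi)\mapsto P_F(\phi)$, is continuous.
   Context: The family $\mathcal S$: it consists of the maps $F:M\times N\to M\times N$, $F(x,y)=(f(x),g(x,y))$, where the base dynamics $b_F=f:M\to M$ belongs to $\mathcal F$ and $g:M\times N\to N$ is a continuous map such that there is $0<\lambda<1$ with $d_N(g(x,y_1),g(x,y_2))\le\lambda\,d_N(y_1,y_2)$ for all $x\in M$, $y_1,y_2\in N$, and there is $y_0\in N$ with $g(x,y_0)=y_0$ for every $x\in M$. The topology on $\mathcal S$ is the one given by the $C^1$ topology on the base maps $f$ and the $C^0$ (uniform) topology on the fiber maps $g$. $M\times N$ carries the product distance (e.g. the maximum of the two distances). $C^\alpha(M\times N)$ is the space of functions $\varphi:M\times N\to\mathbb R$ with $\|\varphi\|_\alpha=\|\varphi\|_0+|\varphi|_\alpha<\infty$, where $\|\cdot\|_0$ is the sup norm and $|\varphi|_\alpha=\sup_{p\ne q}|\varphi(p)-\varphi(q)|/d(p,q)^\alpha$;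 it carries the norm $\|\cdot\|_\alpha$. The set $\{f^{-n}(x)\}_{n\ge0}$ is $\bigcup_{n\ge0}f^{-n}(x)$. Relative pressure: let $X$ be a compact metric space, $T:X\to X$ and $\phi:X\to\mathbb R$ continuous. For $\delta>0$, $n\in\mathbb N$, $x\in X$ let $B_\delta(x,n)=\{y\in X: d(T^j(x),T^j(y))<\delta \text{ for } 0\le j\le n\}$, $S_n\phi=\sum_{j=0}^{n-1}\phi\circ T^j$ and $R_{n,\delta}\phi(x)=\sup_{y\in B_\delta(x,n)}S_n\phi(y)$. For $\Lambda\subset X$, $L\in\mathbb N$ and $\gamma\in\mathbb R$ let $m_T(\phi,\Lambda,\delta,L,\gamma)=\inf_{\mathcal U}\sum_{B_\delta(x,n)\in\mathcal U}e^{-\gamma n+R_{n,\delta}\phi(x)}$, the infimum over all finite or countable families $\mathcal U$ of dynamic balls $B_\delta(x,n)$ with $x\in X$, $n\ge L$, covering $\Lambda$. Put $m_T(\phi,\Lambda,\delta,\gamma)=\lim_{L\to\infty}m_T(\phi,\Lambda,\delta,L,\gamma)$, $P_T(\phi,\Lambda,\delta)=\inf\{\gamma: m_T(\phi,\Lambda,\delta,\gamma)=0\}$, and $P_T(\phi,\Lambda)=\lim_{\delta\to0}P_T(\phi,\Lambda,\delta)$. The topological pressure is $P_T(\phi)=P_T(\phi,X)$; by the variational principle it equals $\sup_\eta\{h_\eta(T)+\int\phi\,d\eta\}$ over $T$-invariant Borel probabilities $\eta$. Hyperbolic potentials: for $f\in\mathcal F$, $\Sigma_c(f)$ is the set of $x\in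 M$ with $\limsup_{n\to\infty}\frac1n\sum_{j=0}^{n-1}\log\|Df(f^j(x))^{-1}\|\le -c$. A continuous $\phi:M\times N\to\mathbb R$ is a $c$-hyperbolic potential for $F\in\mathcal S$ with base $f$ if $P_F(\phi,(M\setminus\Sigma_c(f))\times N)<P_F(\phi,\Sigma_c(f)\times N)=P_F(\phi)$. *)

(* Defs.v *)
From HB Require Import structures.
From mathcomp Require Import all_boot all_order all_algebra.
From mathcomp Require Import all_classical all_reals all_analysis.

Set Implicit Arguments.
Unset Strict Implicit.
Unset Printing Implicit Defensive.

Import Order.TTheory GRing.Theory Num.Theory.
Import numFieldNormedType.Exports.

Local Open Scope classical_set_scope.
Local Open Scope ring_scope.

Section prod_metric.
Context {R : realType} {X Y : metricType R}.

Definition max_dist (p q : X * Y) : R :=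
  Num.max (mdist p.1 q.1) (mdist p.2 q.2).

Lemma max_dist_ge0 p q : 0 <= max_dist p q.
Proof. by rewrite /max_dist le_max mdist_ge0. Qed.

Lemma max_dist_positivity p q : max_dist p q = 0 -> p = q.
Proof.
move=> pq0; have : max_dist p q <= 0 by rewrite pq0.
rewrite /max_dist ge_max => /andP[p1 p2].
case: p q p1 p2 {pq0} => [x y] [x' y'] /= p1 p2.
by congr pair; apply: mdist_positivity; apply/eqP; rewrite eq_le mdist_ge0 andbT.
Qed.

Lemma ballE_max_dist p d : ball p d = [set q | max_dist p q < d].
Proof.
apply/seteqP; split => q; rewrite /ball /= /prod_ball !ballEmdist /max_dist gt_max /=.
  by move=> [-> ->].
by move=> /andP[].
Qed.

HB.instance Definition _ := @PseudoMetric_isMetric.Build R (X * Y)%type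
  max_dist max_dist_ge0 max_dist_positivity ballE_max_dist.

End prod_metric.

(* [U] is meant to be open, so that continuity and differentiability at the
   points of [U] only depend on the restriction of [h] to [U]. *)
Fixpoint Ck {R : realType} {V W : normedModType R} (k : nat)
    (U : set V) (h : V -> W) : Prop :=
  if k is k'.+1 then
    (forall x, U x -> differentiable h x) /\
    (forall v, Ck k' U (fun x => 'D_v h x))
  else forall x, U x -> {for x, continuous h}.

Definition smooth {R : realType} {V W : normedModType R}
    (U : set V) (h : V -> W) : Prop := forall k, Ck k U h.

(* A C^oo atlas on the space [M], with values in row vectors, together with a
   C^oo Riemannian metric.  Tangent vectors at [x] are coordinate vectors in
   one of the charts around [x]; linear maps act on the right of row vectors,
   which is also the convention of ['J].  In the chart [c], the scalar product
   of [v] and [w] at [x] is [v *m gram c x *m w^T].  Charts and their inverses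
   are total functions, of which only the values on [dom c] and
   [crd c @` dom c] matter. *)
Record riemannian (R : realType) (m : nat) (M : metricType R) := Riemannian {
  chart : Type ;
  dom : chart -> set M ;
  crd : chart -> M -> 'rV[R]_m ;
  par : chart -> 'rV[R]_m -> M ;
  chart_at : M -> chart ;
  dom_chart_at : forall x, dom (chart_at x) x ;
  dom_open : forall c, open (dom c) ;
  img_open : forall c, open (crd c @` dom c) ;
  crdK : forall c x, dom c x -> par c (crd c x) = x ;
  crd_continuous : forall c x, dom c x -> {for x, continuous (crd c)} ;
  par_continuous : forall c u, (crd c @` dom c) u -> {for u, continuous (par c)} ;
  transition_smooth : forall c d,
    smooth (crd c @` (dom c `&` dom d)) (crd d \o par c) ;
  gram : chart -> M -> 'M[R]_m ;
  gram_sym : forall c x, dom c x -> (gram c x)^T = gram c x ;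
  gram_posdef : forall c x (v : 'rV[R]_m), dom c x -> v != 0 ->
    0 < (v *m gram c x *m v^T) 0 0 ;
  gram_transition : forall c d x, dom c x -> dom d x ->
    let J := 'J (crd d \o par c) (crd c x) in
    gram c x = J *m gram d x *m J^T ;
  gram_smooth : forall c, smooth (crd c @` dom c) (gram c \o par c)
}.

Section riemannian_theory.
Context {R : realType} {m : nat} {M : metricType R} (A : riemannian m M).

Definition tangent_norm (x : M) (v : 'rV[R]_m) : R :=
  Num.sqrt ((v *m gram (chart_at A x) x *m v^T) 0 0).

Definition C1_curve (gamma : R -> M) : Prop :=
  exists I : set R, [/\ open I, `[0, 1] `<=` I,
    forall t, I t -> {for t, continuous gamma} &
    forall c : chart A, Ck 1 (I `&` gamma @^-1` dom c) (crd c \o gamma)].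

Definition speed (gamma : R -> M) (t : R) : R :=
  tangent_norm (gamma t) ('D_1 (crd (chart_at A (gamma t)) \o gamma) t).

Definition curve_length (gamma : R -> M) : \bar R :=
  (\int[@lebesgue_measure R]_(t in `[0%R, 1%R]) (speed gamma t)%:E)%E.

(* Piecewise C^1 curves: finite concatenations of C^1 curves parametrized by
   the unit interval. *)
Inductive piecewise_C1_length : M -> M -> \bar R -> Prop :=
| PiecewiseNil x : piecewise_C1_length x x 0%E
| PiecewiseCons gamma y l : C1_curve gamma ->
    piecewise_C1_length (gamma 1) y l ->
    piecewise_C1_length (gamma 0) y (curve_length gamma + l)%E.

Definition riemannian_dist (x y : M) : \bar R :=
  ereal_inf [set l | piecewise_C1_length x y l].

(* The Riemannian distance is +oo between distinct connected components, so
   that the distance of [M] is left free there (if [M] is connected, there is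
   no freedom). *)
Definition riemannian_mdist : Prop :=
  forall x y, (riemannian_dist x y < +oo)%E ->
    (mdist x y)%:E = riemannian_dist x y.

Definition C1_on (V : set M) (f : M -> M) : Prop :=
  (forall x, V x -> {for x, continuous f}) /\
  (forall c d : chart A,
    Ck 1 (crd c @` (dom c `&` V `&` f @^-1` dom d)) (crd d \o f \o par c)).

Definition local_diffeo (f : M -> M) : Prop :=
  forall x, exists (U : set M) (g : M -> M),
    [/\ open U /\ U x, open (f @` U), C1_on U f,
        (forall y, U y -> g (f y) = y) & C1_on (f @` U) g].

Definition tangent_map (f : M -> M) (x : M) : 'M[R]_m :=
  'J (crd (chart_at A (f x)) \o f \o par (chart_at A x))
     (crd (chart_at A x) x).

(* The operator norm of [Df(x)^-1 : T_(f x) M -> T_x M]. *)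
Definition tangent_inv_norm (f : M -> M) (x : M) : R :=
  sup [set tangent_norm x (w *m invmx (tangent_map f x))
      | w in [set w | tangent_norm (f x) w <= 1]].

(* [lne] is used rather than [ln] because the norm vanishes if [m = 0]. *)
Definition Sigma (c : R) (f : M -> M) : set M :=
  [set x | (limn_esup (fun n : nat =>
      (n%:R^-1)%:E *
      \sum_(j < n) lne (tangent_inv_norm f (iter j f x))%:E) <= (- c)%:E)%E].

End riemannian_theory.

Record C1map {R : realType} {m : nat} {M : metricType R}
    (A : riemannian m M) := MkC1map {
  C1fun :> M -> M ;
  C1funP : C1_on A [set: M] C1fun
}.

Section C1_topology.
Context {R : realType} {m : nat} {M : metricType R} (A : riemannian m M).

HB.instance Definition _ := gen_eqMixin (C1map A).
HB.instance Definition _ := gen_choiceMixin (C1map A).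

(* The subbase of the (weak) C^1 topology, as in Hirsch's Differential
   Topology, section 2.1; it is the usual C^1 topology when [M] is compact. *)
Definition C1_nbhd (f : C1map A) (c d : chart A) (K : set M) (e : R) :
    set (C1map A) :=
  [set g : C1map A | g @` K `<=` dom d /\ forall x, K x ->
    let u := crd c x in
    `|crd d (g x) - crd d (f x)| < e /\
    `|'J (crd d \o g \o par c) u - 'J (crd d \o f \o par c) u| < e].

Definition C1_subbase : set (set (C1map A)) :=
  [set B | exists (f : C1map A) (c d : chart A) (K : set M) (e : R),
    [/\ compact K, K `<=` dom c, f @` K `<=` dom d, 0 < e &
        B = C1_nbhd f c d K e]].

HB.instance Definition _ := isSubBaseTopological.Build (C1map A) C1_subbase id.

End C1_topology.

Section holder_def.
Context {R : realType} {X : metricType R} (a : R).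

Definition abs_values (phi : X -> R) : set R :=
  [set r | exists p, r = `|phi p|].

Definition holder_quotients (phi : X -> R) : set R :=
  [set r | exists p q, p != q /\ r = `|phi p - phi q| / (mdist p q `^ a)].

(* These are genuine suprema for the functions of [holder X a]; the supremum of
   the empty set is 0. *)
Definition sup_norm (phi : X -> R) : R := sup (abs_values phi).
Definition holder_seminorm (phi : X -> R) : R := sup (holder_quotients phi).
Definition holder_norm (phi : X -> R) : R := sup_norm phi + holder_seminorm phi.

End holder_def.

Record holder {R : realType} (X : metricType R) (a : R) := Holder {
  holder_fun :> X -> R ;
  holder_bounded : has_ubound (abs_values holder_fun) ;
  holder_quotients_bounded : has_ubound (holder_quotients a holder_fun)
}.

Section holder_topology.
Context {R : realType} (X : metricType R) (a : R).

HB.instance Definition _ := gen_eqMixin (holder X a).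
HB.instance Definition _ := gen_choiceMixin (holder X a).

Definition holder_balls : set (set (holder X a)) :=
  [set B | exists (phi : holder X a) (e : R), 0 < e /\
    B = [set psi : holder X a | holder_norm a (psi \- phi) < e]].

HB.instance Definition _ :=
  isSubBaseTopological.Build (holder X a) holder_balls id.

End holder_topology.

Section pressure.
Context {R : realType} {X : metricType R} (T : X -> X) (phi : X -> R).

Definition dyn_ball (delta : R) (x : X) (n : nat) : set X :=
  [set y | forall j, (j <= n)%N -> mdist (iter j T x) (iter j T y) < delta].

Definition birkhoff_sum (n : nat) (x : X) : R := \sum_(j < n) phi (iter j T x).

(* The supremum is taken in [R]: [phi] is bounded when it is used. *)
Definition sup_birkhoff (n : nat) (delta : R) (x : X) : R :=
  sup [set birkhoff_sum n y | y in dyn_ball delta x n].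

(* A family of dynamic balls is given by the set of its centers and lengths. *)
Definition dyn_covers (Lambda : set X) (delta : R) (L : nat) :
    set (set (X * nat)) :=
  [set U | [/\ countable U, forall p, U p -> (L <= p.2)%N &
     Lambda `<=` \bigcup_(p in U) dyn_ball delta p.1 p.2]].

Definition pressure_mL (Lambda : set X) (delta : R) (L : nat) (gamma : R) :
    \bar R :=
  ereal_inf
    [set (\esum_(p in U)
            (expR (- gamma * p.2%:R + sup_birkhoff p.2 delta p.1))%:E)%E
    | U in dyn_covers Lambda delta L].

Definition pressure_m (Lambda : set X) (delta gamma : R) : \bar R :=
  limn (fun L => pressure_mL Lambda delta L gamma).

Definition pressure_delta (Lambda : set X) (delta : R) : \bar R :=
  ereal_inf [set gamma%:E | gamma in [set gamma |
    pressure_m Lambda delta gamma = 0%E]].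

Definition rel_pressure (Lambda : set X) : \bar R :=
  lim (pressure_delta Lambda delta @[delta --> (0 : R)^'+]).

Definition pressure : \bar R := rel_pressure [set: X].

End pressure.

Section skew.
Context {R : realType} {m : nat} {M : metricType R} (A : riemannian m M).
Context (N : metricType R).

(* A skew product is given by its base map [f] and its fiber maps [g]; the
   topology is the product of the C^1 and the uniform topologies. *)
Definition skew_data : Type := (C1map A * {uniform (M * N)%type -> N})%type.

Definition base (F : skew_data) : C1map A := F.1.

Definition skew_map (F : skew_data) (p : M * N) : M * N :=
  (base F p.1, (F.2 : M * N -> N) p).

Definition skew_family (Fam : set (C1map A)) : set skew_data :=
  [set F | let g := F.2 : M * N -> N in
    [/\ Fam (base F), continuous g,
        exists lambda : R, 0 < lambda < 1 /\ forall x y1 y2,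
          mdist (g (x, y1)) (g (x, y2)) <= lambda * mdist y1 y2 &
        exists y0 : N, forall x, g (x, y0) = y0]].

Definition hyperbolic_potential (c : R) (F : skew_data) (phi : M * N -> R) :
    Prop :=
  let S := Sigma A c (base F) in
  [/\ continuous phi,
      (rel_pressure (skew_map F) phi (~` S `*` [set: N]) <
       rel_pressure (skew_map F) phi (S `*` [set: N]))%E &
      rel_pressure (skew_map F) phi (S `*` [set: N]) =
      pressure (skew_map F) phi].

Definition Gc (Fam : set (C1map A)) (a c : R) :
    set (skew_data * holder (M * N)%type a) :=
  [set Fphi : skew_data * holder (M * N)%type a | [/\ skew_family Fam Fphi.1,
     hyperbolic_potential c Fphi.1 Fphi.2 &
     forall x, dense (\bigcup_(n in [set: nat])
                        (iter n (base Fphi.1) @^-1` [set x]))]].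

End skew.

(* Main.v *)
(* The fibers contract to the invariant section [M x {y0}], so that everything is
   governed by [psi x = phi (x, y0)] and by the sums [W_n x] of [exp (S_n psi y)]
   over [f^n y = x].

   If [P_F phi < gamma], a finite cover by dynamic balls at a small scale gives a
   recursive inequality for [W_n], whence [W_n <= D exp (gamma n)] everywhere.
   Conversely, if [gamma < P_F phi = P_F (phi, Sigma_c x N)], then
   [W_n >= exp (gamma n)] everywhere for some [n]: along the hyperbolic times of a
   point of [Sigma_c], the inverse branches of [f^n] are defined on balls of a
   fixed radius, so that [Sigma_c x N] is covered by dynamic balls centered at
   preimages of a finite net; hence [W_n] is large on one of these balls, and by
   density of the backward orbits every point reaches that ball backwards within
   a bounded time.

   For a fixed [n], nearby local diffeomorphisms have matching preimages, so that
   [W_n] is continuous in [(F, phi)], and by sub- and supermultiplicativity the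
   two bounds pass to nearby elements of [G_c]. *)
Require Import Defs.
From HB Require Import structures.
From mathcomp Require Import all_boot all_order all_algebra.
From mathcomp Require Import finmap.
From mathcomp Require Import all_classical all_reals all_analysis.
From mathcomp Require Import ring lra.

Set Implicit Arguments.
Unset Strict Implicit.
Unset Printing Implicit Defensive.

Import Order.TTheory GRing.Theory Num.Theory.
Import numFieldNormedType.Exports.

Local Open Scope classical_set_scope.
Local Open Scope ring_scope.

(** * Sums over preimages *)

(** The pressure is an infimum over covers of all lengths followed by two limits, so that it cannot
    be compared directly for two nearby maps. A bound on [W_n] at one fixed time can be compared;
    and if it holds at every point of [M], it multiplies along orbits and controls all later times.
    This is why the lower bound is made uniform in the end point, with a bounded number of backward
    steps.

    The set [Sigma_c] may vary wildly with the map. It is only used for one element of [G_c] at a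
    time, to produce the lower bound, and is never compared between two elements.

    Preimages are lifted by a connectedness argument for open maps close to a map that is injective
    at a fixed scale; this treats a map and its perturbations alike. The contraction of inverse
    branches is measured by squared lengths in finitely many charts. Passing from derivatives to
    increments costs a factor [exp c] at each step, which is affordable because squared lengths
    shrink on average by almost [exp (-2c)] per step along orbits of [Sigma_c]. *)

Section preimage_sums.
Context {R : realType} {M : metricType R}.
Implicit Types (f : M -> M) (psi : M -> R) (s : seq M).

(* Lists of distinct points of [f^-n(x)] replace the sum over [f^-n(x)], so that
   bounds can be stated without the finiteness of [f^-n(x)]. *)
Definition preim_sums f psi n (x : M) : set R :=
  [set r | exists2 s, uniq s /\ {in s, forall y, iter n f y = x} &
           r = \sum_(y <- s) expR (birkhoff_sum f psi n y)].

Definition preim_sums_le f psi n (B : R) :=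
  forall x r, preim_sums f psi n x r -> r <= B.

Definition preim_sums_ge f psi n (A : R) :=
  forall x, exists2 r, preim_sums f psi n x r & A <= r.

Lemma birkhoff_sumD f psi n m y :
  birkhoff_sum f psi (n + m) y =
  birkhoff_sum f psi n y + birkhoff_sum f psi m (iter n f y).
Proof.
rewrite /birkhoff_sum big_split_ord/=; congr (_ + _).
by apply: eq_bigr => j _; rewrite addnC iterD.
Qed.

Lemma birkhoff_sum0 f psi y : birkhoff_sum f psi 0 y = 0.
Proof. by rewrite /birkhoff_sum big_ord0. Qed.

Lemma birkhoff_sum1 f psi y : birkhoff_sum f psi 1 y = psi y.
Proof. by rewrite /birkhoff_sum big_ord_recl big_ord0 addr0. Qed.

Lemma birkhoff_sum_le f f' psi psi' e n y y' :
  (forall j, (j < n)%N -> psi (iter j f y) <= psi' (iter j f' y') + e) ->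
  birkhoff_sum f psi n y <= birkhoff_sum f' psi' n y' + n%:R * e.
Proof.
move=> h; rewrite /birkhoff_sum.
have -> : n%:R * e = \sum_(j < n) e.
  by rewrite sumr_const card_ord mulr_natl.
by rewrite -big_split/=; apply: ler_sum => j _; apply: h.
Qed.

Lemma ler_psum (I : eqType) (s : seq I) (F G : I -> R) :
  {in s, forall i, F i <= G i} -> \sum_(i <- s) F i <= \sum_(i <- s) G i.
Proof.
by move=> h; rewrite big_seq [leRHS]big_seq; apply: ler_sum => i /h.
Qed.

Lemma big_classify (I J : eqType) (s : seq I) (t : seq J) (h : I -> J)
    (F : I -> R) : uniq t -> {in s, forall y, h y \in t} ->
  \sum_(y <- s) F y = \sum_(z <- t) \sum_(y <- [seq y <- s | h y == z]) F y.
Proof.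
move=> ut ht; under [RHS]eq_bigr do rewrite big_filter.
rewrite (exchange_big_dep xpredT)//= big_seq [RHS]big_seq.
apply: eq_bigr => y /ht hy.
rewrite big_mkcond (bigD1_seq (h y))//= eqxx big1 ?addr0// => z /negPf zy.
by rewrite eq_sym zy.
Qed.

Lemma preim_sums_le0 f psi : preim_sums_le f psi 0 1.
Proof.
move=> x _ [s [us sx] ->].
have -> : \sum_(y <- s) expR (birkhoff_sum f psi 0 y) = (size s)%:R.
  by under eq_bigr do rewrite birkhoff_sum0 expR0; rewrite big_const_seq
    count_predT iter_addr addr0.
rewrite (_ : 1 = 1%:R)// ler_nat -[1%N]/(size [:: x]).
by apply: uniq_leq_size => // y /sx /= <-; rewrite inE.
Qed.

(** Group the points of a list by their image under [f^n]: each group consists of [n]-th preimages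
    of one point, and these images are [m]-th preimages of [x]. *)
Lemma preim_sums_leM f psi n m A B : 0 <= A ->
  preim_sums_le f psi n A -> preim_sums_le f psi m B ->
  preim_sums_le f psi (n + m) (A * B).
Proof.
move=> A0 nA mB x _ [s [us sx] ->].
set t := undup (map (iter n f) s).
rewrite (@big_classify _ _ s t (iter n f))/=; last 2 first.
- exact: undup_uniq.
- by move=> y ys; rewrite mem_undup map_f.
apply: (@le_trans _ _ (\sum_(z <- t) A * expR (birkhoff_sum f psi m z))).
  apply: ler_psum => z zt.
  rewrite big_filter; under eq_bigr => y /eqP yz.
    rewrite birkhoff_sumD expRD yz; over.
  rewrite -big_distrl/= ler_wpM2r ?expR_ge0// -big_filter.
  apply: (nA z); eexists; last reflexivity.
  by split; [exact: filter_uniq|move=> y; rewrite mem_filter => /andP[/eqP]].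
rewrite -big_distrr/= ler_wpM2l//; apply: (mB x); exists t => //; split.
  exact: undup_uniq.
move=> z; rewrite mem_undup => /mapP[y ys ->].
by rewrite -iterD addnC sx.
Qed.

(** Lists of [n]-th preimages of distinct points are disjoint, so that their concatenation has no
    repetition. *)
Lemma preim_sums_extend f psi n m A x r : 0 <= A -> preim_sums_ge f psi n A ->
  preim_sums f psi m x r -> exists2 r', preim_sums f psi (n + m) x r' & A * r <= r'.
Proof.
move=> A0 nA [t [ut tx] ->].
suff [s [us st sA]] : exists s, [/\ uniq s, {in s, forall y, iter n f y \in t} &
    A * \sum_(z <- t) expR (birkhoff_sum f psi m z) <=
    \sum_(y <- s) expR (birkhoff_sum f psi (n + m) y)].
  eexists; last exact: sA.
  by exists s => //; split=> // y /st /tx; rewrite addnC iterD.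
elim: t ut {tx} => [_|z t IH /= /andP[zt /IH[s [us st sA]]]].
  by exists [::]; rewrite !big_nil mulr0.
have [_ [q [uq qz] ->] Aq] := nA z; exists (q ++ s); split.
- rewrite cat_uniq uq us andbT /=; apply/hasPn => y /st yt.
  by apply: contra zt => /qz <-.
- move=> y; rewrite mem_cat inE => /orP[/qz ->|/st ->]; first by rewrite eqxx.
  by rewrite orbT.
rewrite big_cat big_cons mulrDr lerD//= (le_trans (ler_wpM2r (expR_ge0 _) Aq))//.
rewrite big_distrl/=; apply: ler_psum => y /qz yz.
by rewrite birkhoff_sumD yz expRD.
Qed.

Lemma preim_sums_geM f psi n m A B : 0 <= A ->
  preim_sums_ge f psi n A -> preim_sums_ge f psi m B ->
  preim_sums_ge f psi (n + m) (A * B).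
Proof.
move=> A0 nA mB x; have [r xr Br] := mB x.
have [r' xr' Ar] := preim_sums_extend A0 nA xr; exists r' => //.
by apply: le_trans Ar; rewrite ler_wpM2l.
Qed.

Lemma preim_sums_leX f psi n A k : 0 <= A -> preim_sums_le f psi n A ->
  preim_sums_le f psi (k * n) (A ^+ k).
Proof.
move=> A0 nA; elim: k => [|k IH]; first exact: preim_sums_le0.
by rewrite mulSn exprS; apply: preim_sums_leM.
Qed.

Lemma preim_sums_geX f psi n A k : 0 <= A -> preim_sums_ge f psi n A ->
  preim_sums_ge f psi (k * n) (A ^+ k).
Proof.
move=> A0 nA; elim: k => [|k IH].
  move=> x; exists 1 => //; exists [:: x]; first by split=> // y; rewrite inE => /eqP.
  by rewrite big_seq1 birkhoff_sum0 expR0.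
by rewrite mulSn exprS; apply: preim_sums_geM.
Qed.

Lemma preim_sums_ge_le f psi n A B (x : M) :
  preim_sums_ge f psi n A -> preim_sums_le f psi n B -> A <= B.
Proof. by move=> /(_ x)[r xr Ar] /(_ x r xr); exact: le_trans. Qed.

Definition inj_scale (d : R) f :=
  forall y1 y2, mdist y1 y2 < d -> f y1 = f y2 -> y1 = y2.

Lemma inj_scale_iter d f n y1 y2 : inj_scale d f ->
  (forall j, (j < n)%N -> mdist (iter j f y1) (iter j f y2) < d) ->
  iter n f y1 = iter n f y2 -> y1 = y2.
Proof.
move=> fd; elim: n => [//|n IH] h e.
by apply: IH => [j jn|]; [exact/h/ltnW|apply: fd e; exact: h].
Qed.

Definition shadows (d : R) f f' n y y' :=
  forall j, (j <= n)%N -> mdist (iter j f y) (iter j f' y') < d.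

(** The choice of a shadow is injective: two points with the same shadow have orbits within [d + d]
    of each other and the same image under [f^n]. Used with [f' = f] to move the end point, and with
    [x' = x] to perturb the map. *)
Lemma shadow_sums f f' psi psi' d e n x x' s :
  inj_scale (d + d) f ->
  (forall y y', mdist y y' < d -> psi y <= psi' y' + e) ->
  uniq s -> {in s, forall y, iter n f y = x} ->
  {in s, forall y, exists2 y', iter n f' y' = x' & shadows d f f' n y y'} ->
  exists2 r, preim_sums f' psi' n x' r &
    \sum_(y <- s) expR (birkhoff_sum f psi n y) <= expR (n%:R * e) * r.
Proof.
move=> fd psie us sx sh.
have /choice[tau htau] : forall y, exists y', y \in s ->
    iter n f' y' = x' /\ shadows d f f' n y y'.
  move=> y; have [/sh[y' y'x yy']|ys] := boolP (y \in s); first by exists y'.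
  by exists y.
exists (\sum_(y <- map tau s) expR (birkhoff_sum f' psi' n y)).
  exists (map tau s) => //; split.
    rewrite map_inj_in_uniq// => y1 y2 /[dup] s1 /htau[_ t1] /[dup] s2 /htau[_ t2] t12.
    apply: (@inj_scale_iter _ f n _ _ fd); last by rewrite !sx.
    move=> j /ltnW jn; rewrite (le_lt_trans (metric_triangle _ (iter j f' (tau y1)) _))//.
    by rewrite ltrD// ?t1// t12 metric_sym t2.
  by move=> _ /mapP[y /htau[] + _ ->].
rewrite big_map big_distrr/=; apply: ler_psum => y /htau[_ yy'].
by rewrite -expRD ler_expR addrC birkhoff_sum_le// => j /ltnW/yy'/psie.
Qed.

(* Cut off the first [l i] steps of the orbits starting in [C i]. *)
Lemma preim_sums_cover f psi (I : eqType) (t : seq I) (l : I -> nat)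
    (C : I -> set M) (c B : I -> R) n : uniq t ->
  (forall y, exists2 i, i \in t & C i y) ->
  {in t, forall i, [/\ (l i <= n)%N, 0 <= c i & 0 <= B i]} ->
  {in t, forall i y, C i y -> expR (birkhoff_sum f psi (l i) y) <= c i} ->
  {in t, forall i y1 y2, C i y1 -> C i y2 -> iter (l i) f y1 = iter (l i) f y2 ->
    y1 = y2} ->
  {in t, forall i, preim_sums_le f psi (n - l i) (B i)} ->
  preim_sums_le f psi n (\sum_(i <- t) c i * B i).
Proof.
move=> ut cov pos cc inj Ble x _ [s [us sx] ->].
have /choice[k hk] : forall y, exists i, i \in t /\ C i y.
  by move=> y; have [i ti Ci] := cov y; exists i.
have {}cov y : k y \in t := (hk y).1.
have {hk}Ck y : C (k y) y := (hk y).2.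
rewrite (@big_classify _ _ s t k)//; apply: ler_psum => i ti.
have [li ci Bi] := pos i ti.
set si := [seq y <- s | k y == i].
have siE y : y \in si -> C i y /\ y \in s.
  by rewrite mem_filter => /andP[/eqP <-].
have nE : n = (l i + (n - l i))%N by rewrite subnKC.
apply: (@le_trans _ _ (\sum_(y <- si) c i *
    expR (birkhoff_sum f psi (n - l i) (iter (l i) f y)))).
  apply: ler_psum => y /siE[Ciy ys].
  by rewrite {1}nE birkhoff_sumD expRD ler_wpM2r ?expR_ge0// cc.
rewrite -big_distrr/= ler_wpM2l//; apply: (Ble i ti x).
exists (map (iter (l i) f) si); last by rewrite big_map.
split.
  rewrite map_inj_in_uniq ?filter_uniq// => y1 y2 /siE[C1 _] /siE[C2 _].
  exact: (inj i ti).
by move=> _ /mapP[y /siE[_ ys] ->]; rewrite -iterD addnC -nE sx.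
Qed.

(** Strong induction on the recursive inequality given by [preim_sums_cover]: as the weights
    [c i * expR (- gamma * l i)] add up to at most 1, a bound [D * expR (gamma * n)] at the earlier
    times reproduces itself with the same [D]. *)
Lemma preim_sums_cover_growth f psi (I : eqType) (t : seq I) (l : I -> nat)
    (C : I -> set M) (c : I -> R) (K gamma : R) : uniq t -> 0 <= K ->
  preim_sums_le f psi 1 K ->
  (forall y, exists2 i, i \in t & C i y) ->
  {in t, forall i, (0 < l i)%N /\ 0 <= c i} ->
  {in t, forall i y, C i y -> expR (birkhoff_sum f psi (l i) y) <= c i} ->
  {in t, forall i y1 y2, C i y1 -> C i y2 -> iter (l i) f y1 = iter (l i) f y2 ->
    y1 = y2} ->
  \sum_(i <- t) c i * expR (- gamma * (l i)%:R) <= 1 ->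
  exists2 D, 0 <= D & forall n, preim_sums_le f psi n (D * expR (gamma * n%:R)).
Proof.
move=> ut K0 K1 cov pos cc inj sum1.
pose L := (\max_(i <- t) l i)%N.
have lL i : i \in t -> (l i <= L)%N by move=> ti; exact: leq_bigmax_seq.
(* [D] serves the times [n < L], at which some piece may be longer than [n] and only the crude bound
   [K ^+ n] is available; each of these bounds is one term of [D]. *)
pose D := \sum_(n < L) K ^+ n * expR (- gamma * n%:R).
have D0 : 0 <= D by apply: sumr_ge0 => n _; rewrite mulr_ge0 ?exprn_ge0 ?expR_ge0.
exists D => // n; elim/ltn_ind: n => n IH.
have [nL|Ln] := ltnP n L.
  move=> x r xr; have := @preim_sums_leX f psi 1 K n K0 K1.
  rewrite muln1 => /(_ x r xr)/le_trans; apply.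
  have -> : K ^+ n = K ^+ n * expR (- gamma * n%:R) * expR (gamma * n%:R).
    by rewrite -mulrA -expRD mulNr addNr expR0 mulr1.
  rewrite ler_wpM2r ?expR_ge0// /D (bigD1 (Ordinal nL))//= lerDl sumr_ge0// => m _.
  by rewrite mulr_ge0 ?exprn_ge0 ?expR_ge0.
have E : \sum_(i <- t) c i * (D * expR (gamma * (n - l i)%:R)) <=
    D * expR (gamma * n%:R).
  rewrite -[leRHS]mul1r; apply: le_trans (ler_wpM2r _ sum1); last first.
    by rewrite mulr_ge0 ?expR_ge0.
  rewrite big_distrl/=; apply: ler_psum => i ti.
  have lin : (l i <= n)%N by rewrite (leq_trans (lL i ti)).
  rewrite natrB// mulrBr expRD [X in X <= _](_ : _ = c i * expR (- (gamma * (l i)%:R))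
    * (D * expR (gamma * n%:R))); last by ring.
  by rewrite mulNr.
move=> x r xr; apply: le_trans E; move: x r xr.
apply: (@preim_sums_cover f psi I t l C) => // i ti.
  have [l0 c0] := pos i ti; split=> //; first by rewrite (leq_trans (lL i ti)).
  by rewrite mulr_ge0 ?expR_ge0.
have [l0 c0] := pos i ti.
by apply: IH; rewrite -subn_gt0 subKn// (leq_trans (lL i ti)).
Qed.

End preimage_sums.

(** * Lifting points and orbits *)

Section metric_facts.
Context {R : realType} {M : metricType R}.
Implicit Types (x y : M).

Lemma nbhs_mdistP x (U : set M) :
  nbhs x U <-> exists2 r : R, 0 < r & forall y, mdist x y < r -> U y.
Proof.
split.
  by move=> /nbhs_ballP[r /= r0 rU]; exists r => // y xy; apply: rU; rewrite ballEmdist.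
by move=> [r r0 rU]; apply/nbhs_ballP; exists r => // y; rewrite ballEmdist => /rU.
Qed.

Lemma near_mdist_lt x (r : R) : 0 < r -> \forall y \near x, mdist x y < r.
Proof. by move=> r0; apply/nbhs_mdistP; exists r. Qed.

Lemma open_mdist_lt x r : open [set y | mdist x y < r].
Proof.
rewrite openE => y /= xy; apply/nbhs_mdistP; exists (r - mdist x y); rewrite ?subr_gt0//.
by move=> z yz /=; have := metric_triangle x y z; lra.
Qed.

Lemma closed_mdist_le x r : closed [set y | mdist x y <= r].
Proof.
rewrite -openC openE => y /= /negP; rewrite -ltNge => xy.
apply/nbhs_mdistP; exists (mdist x y - r); rewrite ?subr_gt0//.
move=> z yz /=; apply/negP; rewrite -ltNge.
by have := metric_triangle x z y; rewrite (metric_sym z); lra.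
Qed.

Lemma closed_mdist_ge x r : closed [set y | r <= mdist x y].
Proof.
have -> : [set y | r <= mdist x y] = ~` [set y | mdist x y < r].
  by apply/seteqP; split=> y /=; rewrite leNgt => /negP.
by rewrite closedC; exact: open_mdist_lt.
Qed.

End metric_facts.

Section topological_dynamics.
Context {R : realType} {M : metricType R}.
Hypothesis cM : compact [set: M].
Implicit Types (f g : M -> M).

Definition open_map f := forall U, open U -> open (f @` U).

Definition loc_connected :=
  forall (x : M) V, nbhs x V -> exists W, [/\ nbhs x W, connected W & W `<=` V].

(** The filter allows one scale for a whole neighborhood of maps; a principal filter gives the case
    of a single map. *)
Lemma near_inj_scale (T : Type) (F : set_system T) (G : T -> M -> M) : Filter F ->
  (forall x : M, exists2 U, nbhs x U & \forall i \near F,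
    forall y1 y2, U y1 -> U y2 -> G i y1 = G i y2 -> y1 = y2) ->
  exists2 d : R, 0 < d & \forall i \near F, inj_scale d (G i).
Proof.
move=> FF locinj.
have := proj1 (compact_near_coveringP _) cM (R * T)%type (filter_prod (0 : R)^'+ F)
  (fun i y => forall y2, mdist y y2 < i.1 -> G i.2 y = G i.2 y2 -> y = y2) _.
case.
  move=> x _; have [U /nbhs_mdistP[r r0 rU] UF] := locinj x.
  exists ([set y | mdist x y < r / 2],
    [set i : R * T | i.1 < r / 2 /\
      forall y1 y2, U y1 -> U y2 -> G i.2 y1 = G i.2 y2 -> y1 = y2]) => /=.
    split; first by apply: near_mdist_lt; lra.
    exists ([set d : R | d < r / 2], [set i | forall y1 y2, U y1 -> U y2 -> G i y1 = G i y2 -> y1 = y2]).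
      by split=> //=; apply: nbhs_right_lt; lra.
    by move=> [d i] /=.
  move=> [y [d i]] /= [xy [dr inj]] y2 yy2; apply: inj; apply: rU; first lra.
  by have := metric_triangle x y y2; lra.
move=> [A B] /= [A0 FB] AB.
have [d [Ad d0]] : exists d : R, A d /\ 0 < d.
  near (0 : R)^'+ => d; exists d; split; first by near: d.
  by near: d; exact: nbhs_right_gt.
by exists d => //; apply: filterS FB => i Bi y1 y2; apply: (AB (d, i)).
Unshelve. all: by end_near. Qed.

(* Let [W] be a connected neighborhood of [f y0] that avoids the images by [g] of
   the points at distance [r] of [y0].  Then [g @` ball y0 r] is open and closed
   in [W], and therefore contains [W]. *)
Lemma preimage_lift f : loc_connected -> continuous f ->
  (exists2 d : R, 0 < d & inj_scale d f) ->
  forall d : R, 0 < d -> exists2 e : R, 0 < e & forall g, open_map g -> continuous g ->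
    (forall x, mdist (f x) (g x) < e) ->
    forall y x', mdist (f y) x' < e -> exists2 y', mdist y y' < d & g y' = x'.
Proof.
move=> locon cf [d0 d00 injf] d dgt0.
have := proj1 (compact_near_coveringP _) cM R (0 : R)^'+
  (fun e y => forall g, open_map g -> continuous g ->
    (forall x, mdist (f x) (g x) < e) ->
    forall x', mdist (f y) x' < e -> exists2 y', mdist y y' < d & g y' = x') _.
case; last first.
  move=> r /= r0 rP; exists (r / 2); first lra.
  move=> g og cg fg y x'; apply: (rP (r / 2)) => //=; last lra.
  by rewrite sub0r normrN gtr0_norm; lra.
move=> y0 _.
(* [d / 2] keeps two points of the ball within [d] of each other; [d0 / 2] makes [y0] the only point
   of the closed ball with image [f y0]. *)
pose r := Num.min (d / 2) (d0 / 2).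
have r0 : 0 < r by rewrite lt_min; lra.
have rd : r <= d / 2 by rewrite ge_min lexx.
have rd0 : r <= d0 / 2 by rewrite ge_min lexx orbT.
pose S := [set y | mdist y0 y <= r] `&` [set y | r <= mdist y0 y].
have cS : compact S.
  apply: subclosed_compact cM _ => //.
  by apply: closedI; [exact: closed_mdist_le|exact: closed_mdist_ge].
(* The image of the compact sphere [S] misses [f y0]. With [W] in the ball of radius [e2 / 2], the
   image of [S] by any [g] within [e2 / 2] of [f] still misses [W]. *)
have [e2 e20 e2S] : exists2 e2 : R, 0 < e2 & forall y, S y -> e2 <= mdist (f y0) (f y).
  have : nbhs (f y0) (~` (f @` S)).
    apply: open_nbhs_nbhs; split.
      rewrite openC; apply: compact_closed; first exact: metric_hausdorff.
      apply: continuous_compact => //; exact: continuous_subspaceT.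
    move=> [y [/= yr ry] fy].
    have : y0 = y by apply: injf => //; lra.
    by move=> y0y; move: ry; rewrite y0y mdistxx; lra.
  move=> /nbhs_mdistP[e e0 eS]; exists e => // y Sy.
  by rewrite leNgt; apply/negP => /eS; apply; exists y.
have [W [/nbhs_mdistP[e1 e10 e1W] conW We2]] := locon (f y0) _ (near_mdist_lt (f y0) (divr_gt0 e20 (ltr0Sn _ 1))).
near=> y e => /= g og cg fg x' yx'.
have e1e : e < e1 / 2 by near: e; apply: nbhs_right_lt; lra.
have e2e : e < e2 / 2 by near: e; apply: nbhs_right_lt; lra.
have ye1 : mdist (f y0) (f y) < e1 / 2.
  near: y; apply: (cf y0 _ (near_mdist_lt (f y0) _)); lra.
have yr : mdist y0 y < r by near: y; exact: near_mdist_lt.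
have Wx' : W x' by apply: e1W; have := metric_triangle (f y0) (f y) x'; lra.
have notS z : S z -> ~ W (g z).
  move=> /e2S fz /We2 /= gz.
  have := metric_triangle (f y0) (g z) (f z); rewrite (metric_sym (g z)).
  by have := fg z; lra.
have WB : W `&` g @` [set z | mdist y0 z < r] = W.
  refine (conW _ _ _ _).
  - exists (g y0); split; last by exists y0 => //=; rewrite mdistxx.
    by apply: e1W; rewrite (lt_trans (fg y0))//; lra.
  - by exists (g @` [set z | mdist y0 z < r]) => //; apply/og/open_mdist_lt.
  - exists (g @` [set z | mdist y0 z <= r]).
      apply: compact_closed; first exact: metric_hausdorff.
      apply: continuous_compact; first exact: continuous_subspaceT.
      by apply: subclosed_compact cM _ => //; exact: closed_mdist_le.
    apply/seteqP; split=> [w [Ww [z /= zr zw]]|w [Ww [z /= zr zw]]]; split=> //.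
      by exists z => //=; exact: ltW.
    exists z => //=; rewrite lt_neqAle zr andbT; apply/negP => /eqP zE.
    by apply: (notS z); rewrite ?zw//; split=> /=; rewrite zE.
have [_ [y' /= y0y' gy']] : (W `&` g @` [set z | mdist y0 z < r]) x' by rewrite WB.
exists y' => //; have := metric_triangle y y0 y'; rewrite (metric_sym y y0); lra.
Unshelve. all: by end_near. Qed.

(* The class [C e] of pairs of maps shrinks with [e]. *)
Lemma lift_iter (C : R -> (M -> M) -> (M -> M) -> Prop) :
  (forall e e' f g, e <= e' -> C e f g -> C e' f g) ->
  (forall d : R, 0 < d -> exists2 e : R, 0 < e & forall f g, C e f g ->
    forall y x', mdist (f y) x' < e -> exists2 y', mdist y y' < d & g y' = x') ->
  forall n (d : R), 0 < d -> exists2 e : R, 0 < e & forall f g, C e f g ->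
    forall y x', mdist (iter n f y) x' < e ->
      exists2 y', iter n g y' = x' & shadows d f g n y y'.
Proof.
move=> Cle H; elim=> [|n IH] d d0.
  exists d => // f g _ y x' yx'; exists x' => // j.
  by rewrite leqn0 => /eqP ->.
have [e1 e10 P1] := H d d0.
(* The shadow of the orbit of [f y] has to start within [e1] of [f y] to be lifted once more, and to
   stay within [d]. *)
pose e2 := Num.min e1 d.
have e20 : 0 < e2 by rewrite lt_min e10.
have [e3 e30 P3] := IH e2 e20.
have le1 : e2 <= e1 by rewrite ge_min lexx.
have le2 : e2 <= d by rewrite ge_min lexx orbT.
exists (Num.min e1 e3); first by rewrite lt_min e10.
move=> f g Cfg y x'; rewrite lt_min iterSr => /andP[_ yx'].
have [|z zx' sh] := P3 f g _ (f y) x' yx'.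
  by apply: Cle Cfg; rewrite ge_min lexx orbT.
have [||y' yy' gy'] := P1 f g _ y z.
- by apply: Cle Cfg; rewrite ge_min lexx.
- by rewrite (lt_le_trans _ le1)//; exact: (sh 0).
exists y'; first by rewrite iterSr gy'.
move=> [//|j jn]; rewrite !iterSr gy' (lt_le_trans _ le2)//; exact: sh.
Qed.

(** A point without preimages is its whole backward orbit. By density it is then the only point of
    the space, hence fixed and its own preimage. *)
Lemma dense_preimages_surj f :
  (forall x, dense (\bigcup_(n in [set: nat]) (iter n f @^-1` [set x]))) ->
  forall x, exists y, f y = x.
Proof.
move=> df x; apply: contrapT => nx.
have preE z n : iter n f z = x -> z = x.
  by case: n => [//|n] /= fz; exfalso; apply: nx; exists (iter n f z).
apply: nx; exists x; apply: contrapT => fx.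
have fxO : (~` [set y | mdist x y <= 0]) (f x).
  move=> /= le0; apply: fx; apply/esym/mdist_positivity.
  by apply/eqP; rewrite eq_le le0 mdist_ge0.
have oO : open (~` [set y | mdist x y <= 0]) := closed_openC (@closed_mdist_le _ _ x 0).
have [z [/= zx [n _ /= /preE zE]]] := df x _ (ex_intro _ (f x) fxO) oO.
by apply: zx; rewrite zE mdistxx.
Qed.

(** Compactness of the set of pairs [(z, x)]: if [iter j f] sends a point near [z] to [x], openness
    makes the same [j] work for all nearby pairs. *)
Lemma dense_preimages_uniform f (r : R) : open_map f -> 0 < r ->
  (forall x, dense (\bigcup_(n in [set: nat]) (iter n f @^-1` [set x]))) ->
  exists J, forall z x, exists j w, [/\ (j <= J)%N, mdist z w < r & iter j f w = x].
Proof.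
move=> of_ r0 df.
have on n : open_map (iter n f).
  elim: n => [U oU|n IH U oU]; first by rewrite /= image_id.
  have -> : iter n.+1 f @` U = f @` (iter n f @` U) by rewrite image_comp.
  exact/of_/IH.
have := proj1 (compact_near_coveringP _) (compact_setX cM cM) nat \oo
  (fun J p => exists j w, [/\ (j <= J)%N, mdist p.1 w < r & iter j f w = p.2]) _.
rewrite setXTT; case; last by move=> J _ JP; exists J => z x; apply: (JP J _ (z, x)) => /=.
move=> [z x] _.
have zz : [set w | mdist z w < r / 2] z by rewrite /= mdistxx; lra.
have [w [/= zw [j _ /= jw]]] := df x _ (ex_intro _ z zz) (@open_mdist_lt _ _ z (r / 2)).
have nx : nbhs x (iter j f @` [set w | mdist z w < r / 2]).
  by apply: open_nbhs_nbhs; split; [exact/on/open_mdist_lt|exists w].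
have nz : nbhs z [set p | mdist z p < r / 2] by apply: near_mdist_lt; lra.
exists ([set p | mdist z p < r / 2] `*` (iter j f @` [set w | mdist z w < r / 2]),
  [set J | (j <= J)%N]).
  by split; [exists ([set p | mdist z p < r / 2], iter j f @` [set w | mdist z w < r / 2])|
    exact: nbhs_infty_ge].
move=> [[z' x'] J] /= [[zz' [w' zw' w'x']] jJ]; exists j, w'; split=> //.
by have := metric_triangle z' z w'; rewrite (metric_sym z' z); lra.
Qed.

(** The point [p] is pulled back one step at a time. The bound on the products of [t] keeps [Q]
    below [theta], hence the pulled back point within [d1] of the orbit, which is the condition for
    the next lift. The induction therefore carries both the bound on [Q] and the distance to [y]. *)
Lemma expanding_lift f (Q : M -> M -> R) (t : M -> R) (d d1 theta : R) :
  d1 <= d -> (forall x p, 0 <= Q x p) -> (forall x, 0 <= t x) ->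
  (forall x p, mdist (f x) p < d1 -> exists2 p', mdist x p' < d & f p' = p) ->
  (forall x p, mdist x p < d -> Q x p <= t x * Q (f x) (f p)) ->
  (forall x p, mdist x p < d -> Q x p < theta -> mdist x p < d1) ->
  forall n y p, (forall k, (k <= n)%N -> \prod_(k <= j < n) t (iter j f y) <= 1) ->
    mdist (iter n f y) p < d1 -> Q (iter n f y) p < theta ->
    exists2 y', iter n f y' = p & shadows d f f n y y'.
Proof.
move=> d1d Q0 t0 lift QtQ Qd n y p prod1 yp Qyp.
suff [y' [y'p yy' _ _]] : exists y', [/\ iter n f y' = p, shadows d f f n y y',
    mdist y y' < d1 & Q y y' <= (\prod_(0 <= j < n) t (iter j f y)) * Q (iter n f y) p].
  by exists y'.
elim: n y prod1 yp Qyp => [|n IH] y prod1 yp Qyp.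
  exists p; split=> //; last by rewrite big_geq// mul1r.
  by move=> j; rewrite leqn0 => /eqP -> /=; exact: lt_le_trans d1d.
have [|||z [zp sh yz Qz]] := IH (f y).
- move=> k kn; have := prod1 k.+1 kn; rewrite big_add1/=; apply: le_trans.
  by under eq_bigr do rewrite -iterSr.
- by rewrite -iterSr.
- by rewrite -iterSr.
have [y' yy' fy'] := lift _ _ yz.
have Qy' : Q y y' <= \prod_(0 <= j < n.+1) t (iter j f y) * Q (iter n.+1 f y) p.
  apply: le_trans (QtQ _ _ yy') _; rewrite fy' big_nat_recl//= -mulrA ler_wpM2l//.
  apply: le_trans Qz _; by rewrite -iterSr; under eq_bigr do rewrite -iterSr.
exists y'; split=> //.
- by rewrite iterSr fy'.
- by move=> [//|j jn]; rewrite !iterSr fy'; exact: sh.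
apply: Qd => //; apply: le_lt_trans Qyp; apply: le_trans Qy' _.
by rewrite ler_piMl// prod1.
Qed.

(* The times at which the partial products are minimal are hyperbolic times. *)
Lemma record_minima (t : nat -> R) : (forall j, 0 < t j) \/ (forall j, t j = 0) ->
  (forall e, 0 < e -> exists n, \prod_(0 <= j < n) t j < e) ->
  forall L, exists2 n, (L <= n)%N & forall k, (k <= n)%N -> \prod_(k <= j < n) t j <= 1.
Proof.
(* The case [t j = 0] is that of a manifold of dimension 0, where the norm of the inverse derivative
   is 0. *)
move=> [t0|t0] small L; last first.
  exists L.+1 => // k; rewrite leq_eqVlt => /orP[/eqP ->|kL]; first by rewrite big_geq.
  by rewrite big_nat_recr//= t0 mulr0.
have q0 k n : 0 < \prod_(k <= j < n) t j by apply: prodr_gt0.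
pose q n := \prod_(0 <= j < n) t j.
(* As [e] bounds the products up to time [L] from below, the first time at which [q] drops below [e]
   comes after [L], and it is a record. *)
have [e e0 eq_] : exists2 e : R, 0 < e & forall k, (k <= L)%N -> e <= q k.
  elim: L => [|L [e e0 eq_]].
    by exists 1 => // k; rewrite leqn0 => /eqP ->; rewrite /q big_geq.
  exists (Num.min e (q L.+1)); first by rewrite lt_min e0 q0.
  move=> k; rewrite leq_eqVlt => /orP[/eqP ->|/eq_ ek]; rewrite ge_min ?lexx ?orbT//.
  by rewrite ek.
have [N qN nmin] : exists2 n, q n < e & forall k, (k < n)%N -> e <= q k.
  have ex : exists n, q n < e by exact: small.
  have [n qn nmin] := ex_minnP ex; exists n => // k kn; rewrite leNgt; apply/negP.
  by move=> /nmin; rewrite leqNgt kn.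
exists N; first by rewrite leqNgt; apply/negP => /ltnW/eq_; rewrite leNgt qN.
move=> k; rewrite leq_eqVlt => /orP[/eqP ->|kN]; first by rewrite big_geq.
have : q N <= q k by apply: le_trans (nmin k kN); exact: ltW.
rewrite {1}/q (@big_cat_nat _ _ _ k)//= ?(ltnW kN)// -/(q k) -[leRHS]mulr1.
by rewrite ler_pM2l// q0.
Qed.

End topological_dynamics.

(** * Covers and pressure *)

(** The pressure at scale [d] need not be monotone in [d]: larger balls make covering easier but
    increase the suprema of the Birkhoff sums. The infimum [a d] of [h] on []0, d]] is monotone,
    hence converges, and [h] stays within [e] of it near 0. *)
Lemma cvg_at_right0_almost_monotone {R : realType} (h : R -> \bar R) :
  (forall e : R, 0 < e -> exists2 d0 : R, 0 < d0 & forall d d' : R, 0 < d' -> d' <= d ->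
    d < d0 -> (h d <= h d' + e%:E)%E) ->
  cvg (h d @[d --> (0 : R)^'+]).
Proof.
move=> H; pose a (d : R) := ereal_inf [set h d' | d' in [set d' : R | 0 < d' <= d]].
have a_cvg : cvg (a d @[d --> (0 : R)^'+]).
  apply: nonincreasing_at_right_is_cvge; near=> b => x y xb yb xy.
  apply: ereal_inf_le_tmp => _ [d /= /andP[d0 dx] <-]; exists d => //=.
  by rewrite d0 (le_trans dx).
have ah (d : R) : 0 < d -> (a d <= h d)%E.
  by move=> d0; apply: ereal_inf_lbound; exists d => //=; rewrite d0 lexx.
have ha (e : R) : 0 < e -> \forall d \near (0 : R)^'+, (h d <= a d + e%:E)%E.
  move=> e0; have [d0 d00 hd] := H e e0; near=> d.
  have dpos : 0 < d by near: d; exact: nbhs_right_gt.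
  have dd0 : d < d0 by near: d; exact: nbhs_right_lt.
  rewrite -leeBlDr//; apply/ereal_infP => _ [d' /andP[d'0 d'd] <-].
  by rewrite leeBlDr//; exact: hd.
move: a_cvg => /cvg_ex[l al]; apply/cvg_ex; exists l.
case: l al => [l al| al|al].
- have /fine_cvgP[afin /cvgrPdist_lt al'] := al.
  have hfin : \forall d \near (0 : R)^'+, h d \is a fin_num.
    near=> d; have dpos : 0 < d by near: d; exact: nbhs_right_gt.
    have ad : a d \is a fin_num by near: d.
    rewrite fin_real// (lt_le_trans _ (ah d dpos)) ?ltNye_eq ?ad//.
    have : (h d <= a d + 1%:E)%E by near: d; exact: ha.
    move=> /le_lt_trans; apply; rewrite ltey_eq fin_numD ad//.
  apply/fine_cvgP; split=> //; apply/cvgrPdist_lt => e e0; near=> d => /=.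
  have dpos : 0 < d by near: d; exact: nbhs_right_gt.
  have ad : a d \is a fin_num by near: d.
  have hd : h d \is a fin_num by near: d.
  have : `|l - fine (a d)| < e / 2 by near: d; apply: al'; lra.
  have : fine (a d) <= fine (h d) by rewrite fine_le//; exact: ah.
  have : fine (h d) <= fine (a d) + e / 2.
    have : (h d <= a d + (e / 2)%:E)%E by near: d; apply: ha; lra.
    by rewrite -(fineK ad) -(fineK hd) -EFinD lee_fin.
  rewrite !ltr_norml => h1 h2 /andP[h3 h4]; apply/andP; split; lra.
- apply/cvgeyPge => A; near=> d.
  have dpos : 0 < d by near: d; exact: nbhs_right_gt.
  apply: le_trans (ah d dpos); near: d; move: A; exact/cvgeyPge.
- apply/cvgeNyPle => A; near=> d.
  have hd : (h d <= a d + 1%:E)%E by near: d; exact: ha.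
  have ad : (a d <= (A - 1)%:E)%E by near: d; move: (A - 1); exact/cvgeNyPle.
  by apply: le_trans hd _; rewrite -(subrK 1 A) EFinD leeD2r.
Unshelve. all: by end_near. Qed.

Lemma unif_continuous_compact {R : realType} {X : metricType R} (phi : X -> R) :
  compact [set: X] -> continuous phi ->
  forall e : R, 0 < e -> exists2 d : R, 0 < d &
    forall x y, mdist x y < d -> `|phi x - phi y| < e.
Proof.
move=> cX cphi e e0.
have := proj1 (compact_near_coveringP _) cX R (0 : R)^'+
  (fun d x => forall y, mdist x y < d -> `|phi x - phi y| < e) _.
case; last first.
  move=> r /= r0 rP; exists (r / 2); first lra.
  move=> x y xy; apply: (rP (r / 2)) xy => //=; last lra.
  by rewrite sub0r normrN gtr0_norm; lra.
move=> x0 _.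
have /nbhs_mdistP[r r0 rP] : \forall x \near x0, `|phi x0 - phi x| < e / 2.
  by move: (cphi x0) => /cvgrPdist_lt; apply; lra.
near=> x d => /= y xy.
have dr : d < r / 2 by near: d; apply: nbhs_right_lt; lra.
have xr : mdist x0 x < r / 2 by near: x; apply: near_mdist_lt; lra.
have tri := metric_triangle x0 x y.
have -> : phi x - phi y = (phi x0 - phi y) - (phi x0 - phi x) by ring.
apply: le_lt_trans (ler_normB _ _) _.
have h1 : `|phi x0 - phi y| < e / 2 by apply: rP; lra.
have h2 : `|phi x0 - phi x| < e / 2 by apply: rP; lra.
by lra.
Unshelve. all: by end_near. Qed.

Lemma bounded_compact {R : realType} {X : metricType R} (phi : X -> R) :
  compact [set: X] -> continuous phi ->
  exists2 B : R, 0 <= B & forall x, `|phi x| <= B.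
Proof.
move=> cX cphi.
have cI : compact (phi @` [set: X]).
  by apply: continuous_compact => //; exact: continuous_subspaceT.
have [B [Breal Bb]] := compact_bounded cI.
exists (Num.max 0 (B + 1)); first by rewrite le_max lexx.
move=> x; have : B < Num.max 0 (B + 1) by rewrite lt_max ltrDl ltr01 orbT.
by move=> /Bb; apply; exists x.
Qed.

Lemma compact_finite_subcover {X : topologicalType} (I : choiceType) (D : set I)
    (f : I -> set X) : compact [set: X] -> (forall i, D i -> open (f i)) ->
  (forall x, exists2 i, D i & f i x) ->
  exists s : seq I, [/\ uniq s, {in s, forall i, D i} &
    forall x, exists2 i, i \in s & f i x].
Proof.
move=> cX fo cov.
(* In the filter of finite subfamilies directed by inclusion, an open cover is a near covering, so
   that the filter form of compactness applies. *)
pose F := filter_from [set s : seq I | {in s, forall i, D i}]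
  (fun s0 => [set s : seq I | {subset s0 <= s} /\ {in s, forall i, D i}]).
have FF : ProperFilter F.
  apply: filter_from_proper; last by move=> s Ds; exists s; split.
  apply: filter_from_filter; first by exists [::].
  move=> s1 s2 D1 D2; exists (s1 ++ s2) => /=.
    by move=> i; rewrite mem_cat => /orP[/D1|/D2].
  move=> s /= [s12 Ds]; split; split=> // i si; apply: s12; rewrite mem_cat si//.
  by rewrite orbT.
have [x _|s0 /= D0 s0P] := proj1 (compact_near_coveringP _) cX _ F
    (fun s x => exists2 i, i \in s & f i x) _.
  have [i Di fix_] := cov x.
  exists (f i, [set s : seq I | i \in s]) => /=; last first.
    by move=> [y s] /= [fiy si]; exists i.
  split; first by apply: open_nbhs_nbhs; split=> //; exact: fo.
  exists [:: i] => /=; first by move=> j; rewrite inE => /eqP ->.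
  by move=> s /= [+ _]; apply; rewrite inE.
exists (undup s0); split; first exact: undup_uniq.
  by move=> i; rewrite mem_undup => /D0.
move=> x; have [i i0 fx] := s0P s0 (conj (fun i si => si) D0) x Logic.I.
by exists i; rewrite ?mem_undup.
Qed.

Lemma compact_finite_net {X : topologicalType} (U : X -> set X) :
  compact [set: X] -> (forall x, nbhs x (U x)) ->
  exists s : seq X, forall x, exists2 c, c \in s & U c x.
Proof.
move=> cX nU.
have [x _|x|s [_ _ sU]] := @compact_finite_subcover X X setT (fun x => (U x)^°) cX.
- exact: open_interior.
- by exists x => //; exact: nU.
exists s => x; have [c cs Ucx] := sU x; exists c => //.
exact: interior_subset.
Qed.

Section pressure_facts.
Context {R : realType} {X : metricType R} (T : X -> X) (phi : X -> R).
Hypothesis cX : compact [set: X].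
Hypothesis cT : continuous T.
Hypothesis cphi : continuous phi.
Implicit Types (Lambda : set X) (d gamma : R) (n : nat).

Lemma birkhoff_sum_norm_le (B : R) n x : (forall x, `|phi x| <= B) ->
  `|birkhoff_sum T phi n x| <= n%:R * B.
Proof.
move=> phiB; apply: le_trans (ler_norm_sum _ _ _) _.
have -> : n%:R * B = \sum_(j < n) B by rewrite sumr_const card_ord mulr_natl.
by apply: ler_sum.
Qed.

Lemma sup_birkhoff_ge n d x y : dyn_ball T d x n y ->
  birkhoff_sum T phi n y <= sup_birkhoff T phi n d x.
Proof.
move=> xy; have [B _ phiB] := bounded_compact cX cphi.
apply: ub_le_sup; last by exists y.
exists (n%:R * B) => _ [z _ <-]; apply: le_trans (birkhoff_sum_norm_le n z phiB).
exact: ler_norm.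
Qed.

Lemma dyn_ball_center d n x : 0 < d -> dyn_ball T d x n x.
Proof. by move=> d0 j _; rewrite mdistxx. Qed.

Lemma sup_birkhoff_le n d x (B : R) : 0 < d ->
  (forall y, dyn_ball T d x n y -> birkhoff_sum T phi n y <= B) ->
  sup_birkhoff T phi n d x <= B.
Proof.
move=> d0 h; apply: ge_sup.
  by exists (birkhoff_sum T phi n x), x => //; exact: dyn_ball_center.
by move=> _ [y xy <-]; exact: h.
Qed.

Lemma sup_birkhoff_le_center n d x (e : R) : 0 < d ->
  (forall y z, mdist y z < d -> `|phi y - phi z| < e) ->
  sup_birkhoff T phi n d x <= birkhoff_sum T phi n x + n%:R * e.
Proof.
move=> d0 phie; apply: sup_birkhoff_le => // y xy; apply: birkhoff_sum_le => j jn.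
by have /phie := xy j (ltnW jn); rewrite ltr_norml => /andP[]; lra.
Qed.

Lemma pressure_mL_ge0 Lambda d L gamma : (0 <= pressure_mL T phi Lambda d L gamma)%E.
Proof.
apply/ereal_infP => _ [U _ <-]; apply: esum_ge0 => p _.
by rewrite lee_fin expR_ge0.
Qed.

Lemma pressure_mL_ndecr Lambda d gamma :
  nondecreasing_seq (fun L => pressure_mL T phi Lambda d L gamma).
Proof.
move=> L L' LL'; apply: ereal_inf_le_tmp => _ [U [cU UL Ucov] <-].
by exists U => //; split=> // p /UL; exact: leq_trans.
Qed.

(** There are fewer covers when [L] grows, so that the limit is a supremum of nonnegative terms. *)
Lemma pressure_m_eq0P Lambda d gamma : pressure_m T phi Lambda d gamma = 0%E <->
  forall L, pressure_mL T phi Lambda d L gamma = 0%E.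
Proof.
have -> : pressure_m T phi Lambda d gamma =
    ereal_sup (range (fun L => pressure_mL T phi Lambda d L gamma)).
  by apply/cvg_lim => //; apply: ereal_nondecreasing_cvgn; exact: pressure_mL_ndecr.
split=> [h L|h].
  apply/eqP; rewrite eq_le pressure_mL_ge0 andbT -h.
  by apply: ereal_sup_ubound; exists L.
apply/eqP; rewrite eq_le; apply/andP; split.
  by apply: ge_ereal_sup => _ [L _ <-]; rewrite h.
by apply: ereal_sup_ubound; exists 0%N.
Qed.

(** The centers and lengths of a cover at scale [d'] still give a cover at scale [d]. The suprema
    grow by at most [e] per unit of time, which is paid by the increase of [gamma]. *)
Lemma pressure_mL_scale Lambda d d' L gamma (e : R) : 0 < d' -> d' <= d ->
  (forall y z, mdist y z < d -> `|phi y - phi z| < e) ->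
  (pressure_mL T phi Lambda d L (gamma + e) <= pressure_mL T phi Lambda d' L gamma)%E.
Proof.
move=> d'0 d'd phie; apply/ereal_infP => _ [U [cU UL Ucov] <-].
apply: (@le_trans _ _ (\esum_(p in U) (expR (- (gamma + e) * p.2%:R +
    sup_birkhoff T phi p.2 d p.1))%:E)%E).
  apply: ereal_inf_lbound; exists U => //; split=> // x /Ucov[p Up xp].
  by exists p => // j /xp xj; exact: lt_le_trans d'd.
apply: le_esum => p _; rewrite lee_fin ler_expR.
have -> : - (gamma + e) * p.2%:R = - gamma * p.2%:R - p.2%:R * e by ring.
have d0 := lt_le_trans d'0 d'd.
have := @sup_birkhoff_le_center p.2 d p.1 e d0 phie.
have := @sup_birkhoff_ge p.2 d' p.1 p.1 (@dyn_ball_center d' p.2 p.1 d'0).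
by lra.
Qed.

Lemma pressure_delta_cvg Lambda :
  cvg (pressure_delta T phi Lambda d @[d --> (0 : R)^'+]).
Proof.
apply: cvg_at_right0_almost_monotone => e e0.
have [d0 d00 phie] := unif_continuous_compact cX cphi e0.
exists d0 => // d d' d'0 d'd dd0; rewrite -leeBlDr//.
apply/ereal_infP => _ [gamma gamma0 <-]; rewrite leeBlDr//.
apply: ereal_inf_lbound; exists (gamma + e); last by rewrite EFinD.
move: gamma0 => /pressure_m_eq0P gamma0; apply/pressure_m_eq0P => L /=.
apply/eqP; rewrite eq_le pressure_mL_ge0 andbT -(gamma0 L).
apply: pressure_mL_scale => // y z yz; apply: phie; exact: lt_trans dd0.
Qed.

Lemma open_dyn_ball d x n : open (dyn_ball T d x n).
Proof.
have cTn k : continuous (iter k T).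
  elim: k => [|k IH] y; first exact: cvg_id.
  by apply: continuous_comp; [exact: IH|exact: cT].
have ballE k : open (iter k T @^-1` [set y | mdist (iter k T x) y < d]).
  by apply: open_comp => [y _|]; [exact: cTn|exact: open_mdist_lt].
elim: n => [|n IH].
  rewrite (_ : dyn_ball _ _ _ _ = iter 0 T @^-1` [set y | mdist (iter 0 T x) y < d])//.
  apply/seteqP; split=> y /=; first by move=> /(_ 0%N (leqnn 0)).
  by move=> xy j; rewrite leqn0 => /eqP ->.
rewrite (_ : dyn_ball _ _ _ _ = dyn_ball T d x n `&`
    iter n.+1 T @^-1` [set y | mdist (iter n.+1 T x) y < d]); first exact: openI.
apply/seteqP; split=> [y xy|y [xy xyn] j].
  by split=> [j jn|]; apply: xy => //; exact: leqW.
by rewrite leq_eqVlt => /orP[/eqP ->//|]; rewrite ltnS => /xy.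
Qed.

Lemma pressure_lt_cover gamma (d0 : R) : 0 < d0 -> (pressure T phi < gamma%:E)%E ->
  exists (d : R) (t : seq (X * nat)), [/\ 0 < d < d0, uniq t,
    {in t, forall p, 0 < p.2}%N,
    (forall x, exists2 p, p \in t & dyn_ball T d p.1 p.2 x) &
    \sum_(p <- t) expR (sup_birkhoff T phi p.2 d p.1) * expR (- gamma * p.2%:R) <= 1].
Proof.
move=> d00 Pgamma.
have : \forall d \near (0 : R)^'+, (pressure_delta T phi [set: X] d < gamma%:E)%E.
  exact: (@pressure_delta_cvg [set: X] _ (open_ereal_lt' Pgamma)).
move=> near_d.
have [d [d0d dd0 Pd]] : exists d : R, [/\ 0 < d, d < d0 &
    (pressure_delta T phi [set: X] d < gamma%:E)%E].
  near (0 : R)^'+ => d; exists d; split; near: d => //.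
  - exact: nbhs_right_gt.
  - exact: nbhs_right_lt.
have /ereal_inf_ltP[_ [g g0 <-]] := Pd.
rewrite lte_fin => ggamma.
(* [L = 1] makes all lengths positive, so that the recursion based on this cover goes back in
   time. *)
have /ereal_inf_ltP[_ [U [cU U1 Ucov] <-] esum1] :
    (pressure_mL T phi [set: X] d 1 g < 1)%E.
  by have /pressure_m_eq0P -> := g0; exact: lte01.
have [p _|x|t [ut tU tcov]] := @compact_finite_subcover X _ U
    (fun p => dyn_ball T d p.1 p.2) cX.
- exact: open_dyn_ball.
- by have [p] := Ucov x I; exists p.
exists d, t; split=> //.
- by rewrite d0d dd0.
- by move=> p /tU/U1.
apply: (@le_trans _ _ (\sum_(p <- t) expR (- g * p.2%:R + sup_birkhoff T phi p.2 d p.1))).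
  apply: ler_sum => p _; rewrite -expRD ler_expR [leLHS]addrC lerD2r.
  by rewrite !mulNr lerN2 ler_wpM2r// ltW.
rewrite -lee_fin; apply: le_trans (ltW esum1); apply: esum_ge.
exists [set` t]; first by split; [exact: finite_seq|move=> p /= /tU].
by rewrite -(fsbig_seq _ _ ut) sumEFin.
Unshelve. all: by end_near. Qed.

Lemma lt_pressure_cover Lambda gamma (d0 : R) : 0 < d0 ->
  (gamma%:E < rel_pressure T phi Lambda)%E ->
  exists (d e : R) (L0 : nat), [/\ 0 < d < d0, 0 < e & forall L U, (L0 <= L)%N ->
    dyn_covers T Lambda d L U ->
    (e%:E <= \esum_(p in U) (expR (- gamma * p.2%:R + sup_birkhoff T phi p.2 d p.1))%:E)%E].
Proof.
move=> d00 Pgamma.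
have near_d : \forall d \near (0 : R)^'+, (gamma%:E < pressure_delta T phi Lambda d)%E.
  exact: (@pressure_delta_cvg Lambda _ (open_ereal_gt' Pgamma)).
have [d [d0d dd0 Pd]] : exists d : R, [/\ 0 < d, d < d0 &
    (gamma%:E < pressure_delta T phi Lambda d)%E].
  near (0 : R)^'+ => d; exists d; split; near: d => //.
  - exact: nbhs_right_gt.
  - exact: nbhs_right_lt.
have [L0 mL0] : exists L0, pressure_mL T phi Lambda d L0 gamma <> 0%E.
  apply: contrapT => h; move: Pd; apply/negP; rewrite -leNgt.
  apply: ereal_inf_lbound; exists gamma => //; apply/pressure_m_eq0P => L.
  by apply: contrapT => hL; apply: h; exists L.
have [e e0 em] : exists2 e : R, 0 < e & (e%:E <= pressure_mL T phi Lambda d L0 gamma)%E.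
  have := pressure_mL_ge0 Lambda d L0 gamma; case: pressure_mL mL0 => [r| |]//= r0 rge0.
    by exists r => //; rewrite lt_neqAle eq_sym; apply/andP; split=> //; apply/eqP => r0E; apply: r0; rewrite r0E.
  by exists 1 => //; rewrite leey.
exists d, e, L0; split=> //; first by rewrite d0d dd0.
move=> L U L0L UL; apply: le_trans em _.
apply: le_trans (pressure_mL_ndecr Lambda d gamma L0L) _.
by apply: ereal_inf_lbound; exists U.
Unshelve. all: by end_near. Qed.

End pressure_facts.

Lemma mdist_prod_lt {R : realType} {X Y : metricType R} (p q : X * Y) (d : R) :
  (mdist p q < d) = (mdist p.1 q.1 < d) && (mdist p.2 q.2 < d).
Proof. exact: gt_max. Qed.

Lemma unif_continuous_map {R : realType} {X Y : metricType R} (h : X -> Y) :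
  compact [set: X] -> continuous h ->
  forall e : R, 0 < e -> exists2 d : R, 0 < d &
    forall x y, mdist x y < d -> mdist (h x) (h y) < e.
Proof.
move=> cX ch e e0.
have := proj1 (compact_near_coveringP _) cX R (0 : R)^'+
  (fun d x => forall y, mdist x y < d -> mdist (h x) (h y) < e) _.
case; last first.
  move=> r /= r0 rP; exists (r / 2); first lra.
  move=> x y xy; apply: (rP (r / 2)) xy => //=; last lra.
  by rewrite sub0r normrN gtr0_norm; lra.
move=> x0 _.
have e20 : 0 < e / 2 by lra.
have /nbhs_mdistP[r r0 rP] := ch x0 _ (near_mdist_lt (h x0) e20).
near=> x d => /= y xy.
have dr : d < r / 2 by near: d; apply: nbhs_right_lt; lra.
have xr : mdist x0 x < r / 2 by near: x; apply: near_mdist_lt; lra.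
have tri := metric_triangle x0 x y.
have h1 : mdist (h x0) (h y) < e / 2 by apply: rP; lra.
have h2 : mdist (h x0) (h x) < e / 2 by apply: rP; lra.
by have := metric_triangle (h x) (h x0) (h y); rewrite (metric_sym (h x) (h x0)); lra.
Unshelve. all: by end_near. Qed.

Lemma unif_continuous_iter {R : realType} {X : metricType R} (h : X -> X) :
  compact [set: X] -> continuous h ->
  forall J (e : R), 0 < e -> exists2 d : R, 0 < d &
    forall x y, mdist x y < d -> forall j, (j <= J)%N ->
      mdist (iter j h x) (iter j h y) < e.
Proof.
move=> cX ch; elim=> [|J IH] e e0.
  by exists e => // x y xy j; rewrite leqn0 => /eqP ->.
have [d d0 dP] := IH e e0; have [d' d'0 d'P] := unif_continuous_map cX ch d0.
exists (Num.min d' e); first by rewrite lt_min d'0.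
move=> x y; rewrite lt_min => /andP[xy xye] [//|j jJ].
by rewrite !iterSr; apply: dP => //; exact: d'P.
Qed.

(** Used for covers by dynamic balls, whose sums are estimated one length at a time. *)
Lemma esum_le_levels {R : realType} (T : choiceType) (U : set (T * nat))
    (a : T * nat -> R) (b : nat -> R) (L : nat) (C : R) :
  (forall p, U p -> (L <= p.2)%N) -> (forall n, 0 <= b n) ->
  (forall n s, uniq s -> {in s, forall x, U (x, n)} -> \sum_(x <- s) a (x, n) <= b n) ->
  (forall n, \sum_(L <= j < n) b j <= C) ->
  (\esum_(p in U) (a p)%:E <= C%:E)%E.
Proof.
move=> UL b0 ab bC; apply: ge_ereal_sup => _ [A [finA AU] <-].
rewrite fsbig_finite//= sumEFin lee_fin.
set s : seq (T * nat) := enum_fset (fset_set A).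
have us : uniq s by exact: fset_uniq.
have sU p : p \in s -> U p by rewrite in_fset_set// inE => /AU.
pose N := (\max_(p <- s) p.2).+1.
have pN p : p \in s -> p.2 \in index_iota L N.
  move=> ps; rewrite mem_index_iota; apply/andP; split; first exact/UL/sU.
  by apply: (@leq_bigmax_seq _ s xpredT snd).
rewrite (@big_classify _ _ _ s (index_iota L N) snd)//; last exact: iota_uniq.
apply: le_trans (bC N); apply: ler_sum => n _.
have -> : \sum_(y <- [seq y <- s | y.2 == n]) a y =
    \sum_(x <- map fst [seq y <- s | y.2 == n]) a (x, n).
  rewrite big_map big_seq [RHS]big_seq; apply: eq_bigr => -[x k].
  by rewrite mem_filter /= => /andP[/eqP ->].
apply: ab.
  rewrite map_inj_in_uniq ?filter_uniq// => -[x k] [y l].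
  by rewrite !mem_filter /= => /andP[/eqP -> _] /andP[/eqP -> _] ->.
by move=> x /mapP[[y k]]; rewrite mem_filter /= => /andP[/eqP -> ys] ->; exact: sU.
Qed.

Lemma geometric_tail {R : realType} (K e : R) : 0 <= K -> 0 < e ->
  exists C : R, forall L n, \sum_(L <= j < n) K * expR (- e * j%:R) <=
    C * expR (- e * L%:R).
Proof.
move=> K0 e0; pose q := expR (- e).
have q1 : 1 - q > 0 by rewrite subr_gt0 /q expR_lt1; lra.
have qS n : expR (- e * n.+1%:R) = expR (- e * n%:R) * q.
  by rewrite -natr1 mulrDr expRD mulr1.
exists (K / (1 - q)) => L n.
(* The closed form telescopes; [maxn] makes it vanish, like the sum, when [n <= L]. *)
suff H : \sum_(L <= j < n) K * expR (- e * j%:R) <=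
    K / (1 - q) * (expR (- e * L%:R) - expR (- e * (maxn L n)%:R)).
  have K1 : 0 <= K / (1 - q) by rewrite divr_ge0// ltW.
  by apply: le_trans H _; rewrite ler_wpM2l// gerBl expR_ge0.
have [nL|] := leqP n L; first by rewrite big_geq// subrr mulr0.
elim: n => // n IH; rewrite ltnS leq_eqVlt => /orP[/eqP ->|Ln].
  rewrite big_nat1 qS.
  by rewrite [leRHS](_ : _ = K * expR (- e * n%:R))//; field; rewrite gt_eqF.
rewrite big_nat_recr/=; last exact: ltnW.
apply: le_trans (lerD (IH Ln) (lexx _)) _.
rewrite qS -lerBrDl -mulrBr.
by rewrite [leRHS](_ : _ = K * expR (- e * n%:R))//; field; rewrite gt_eqF.
Qed.

(** * Crude bounds on sums over preimages *)

Section preimages_bounded.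
Context {R : realType} {M : metricType R} (f : M -> M) (psi : M -> R).
Hypothesis cM : compact [set: M].
Hypothesis cpsi : continuous psi.

(** A ball of radius [d / 2] contains at most one preimage of a given point, and finitely many such
    balls cover [M]. *)
Lemma preim_sums1_bounded (d : R) : 0 < d -> inj_scale d f ->
  exists2 K, 0 <= K & preim_sums_le f psi 1 K.
Proof.
move=> d0 fd; have [B B0 psiB] := bounded_compact cM cpsi.
have [s0 s0P] := compact_finite_net cM (fun x => near_mdist_lt x (divr_gt0 d0 (ltr0Sn R 1))).
pose s := undup s0.
have sP x : exists2 c, c \in s & mdist c x < d / 2.
  by have [c cs cx] := s0P x; exists c => //; rewrite mem_undup.
exists (\sum_(c <- s) expR B * 1); first by apply: sumr_ge0 => c _; rewrite mulr_ge0 ?expR_ge0.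
apply: (@preim_sums_cover _ _ f psi M s (fun=> 1%N) (fun c => [set x | mdist c x < d / 2])
  (fun=> expR B) (fun=> 1) 1) => //.
- exact: undup_uniq.
- move=> c cs y _; rewrite birkhoff_sum1 ler_expR.
  exact: le_trans (ler_norm _) (psiB y).
- move=> c cs y1 y2 /= cy1 cy2; apply: fd.
  have := metric_triangle y1 c y2; rewrite (metric_sym y1 c); lra.
- by move=> c cs; rewrite subnn; exact: preim_sums_le0.
Qed.

Lemma preim_sums_ge_surj (B : R) k : (forall x, `|psi x| <= B) ->
  (forall x, exists y, f y = x) ->
  preim_sums_ge f psi k (expR (- (k%:R * B))).
Proof.
move=> psiB surj x.
have [y yx] : exists y, iter k f y = x.
  elim: k => [|k [y IH]]; first by exists x.
  by have [z zy] := surj y; exists z; rewrite iterSr zy.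
exists (expR (birkhoff_sum f psi k y)).
  exists [:: y]; last by rewrite big_seq1.
  by split=> // z; rewrite inE => /eqP ->.
have := @birkhoff_sum_norm_le _ _ f psi B k y psiB.
by rewrite ler_norml ler_expR => /andP[].
Qed.

(** Every weight is at least [expR (- n B)], so that the bound on the weighted sums bounds the
    number of preimages. *)
Lemma finite_preimages (d : R) n x : 0 < d -> inj_scale d f ->
  finite_set (iter n f @^-1` [set x]).
Proof.
move=> d0 fd; have [K K0 K1] := preim_sums1_bounded d0 fd.
have [B B0 psiB] := bounded_compact cM cpsi.
have := @preim_sums_leX _ _ f psi 1 K n K0 K1; rewrite muln1 => Kn.
apply: contrapT => inf.
pose k := Num.truncn (K ^+ n * expR (n%:R * B)).
have [A Af kA] := infinite_set_fset k.+1 inf.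
have := Kn x _ (ex_intro2 _ _ (enum_fset A) (conj (fset_uniq A) Af) erefl).
apply/negP; rewrite -ltNge.
have sizeA : (k.+1)%:R <= (size (enum_fset A))%:R :> R by rewrite ler_nat.
have : K ^+ n * expR (n%:R * B) < (k.+1)%:R by exact: truncnS_gt.
move=> /lt_le_trans/(_ sizeA).
rewrite -ltr_pdivlMr ?expR_gt0// -expRN => /lt_le_trans; apply.
have -> : (size (enum_fset A))%:R = \sum_(y <- enum_fset A) (1 : R).
  by rewrite big_const_seq count_predT iter_addr addr0.
rewrite big_distrl/=; apply: ler_sum => y _; rewrite mul1r ler_expR.
have := @birkhoff_sum_norm_le _ _ f psi B n y psiB.
by rewrite ler_norml => /andP[].
Qed.

Lemma preim_sums_shift (B : R) m j w x r : (forall x, `|psi x| <= B) ->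
  iter j f w = x -> preim_sums f psi m w r ->
  exists2 r', preim_sums f psi (m + j) x r' & expR (- (j%:R * B)) * r <= r'.
Proof.
move=> psiB wx [s [us sw] ->]; eexists.
  exists s; last reflexivity.
  by split=> // y /sw yw; rewrite addnC iterD yw.
rewrite big_distrr/=; apply: ler_psum => y /sw yw.
rewrite birkhoff_sumD expRD yw mulrC ler_wpM2l ?expR_ge0// ler_expR.
have := @birkhoff_sum_norm_le _ _ f psi B j w psiB.
by rewrite ler_norml => /andP[].
Qed.

End preimages_bounded.

(** * Skew products *)

Lemma ereal_gap {R : realType} (gamma : R) (x : \bar R) : (gamma%:E < x)%E ->
  exists2 e : R, 0 < e & ((gamma + e)%:E < x)%E.
Proof.
case: x => [x| |]; rewrite ?lte_fin// => gx; last by exists 1; rewrite ?ltry.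
by exists ((x - gamma) / 2); rewrite ?lte_fin; lra.
Qed.

Section skew_dynamics.
Context {R : realType} {M N : metricType R}.
Variables (f : M -> M) (g : M * N -> N) (y0 : N) (lam : R) (phi : M * N -> R).
Hypothesis cM : compact [set: M].
Hypothesis cN : compact [set: N].
Hypothesis cf : continuous f.
Hypothesis cg : continuous g.
Hypothesis lam01 : 0 < lam < 1.
Hypothesis glam : forall x w1 w2, mdist (g (x, w1)) (g (x, w2)) <= lam * mdist w1 w2.
Hypothesis gy0 : forall x, g (x, y0) = y0.
Hypothesis cphi : continuous phi.

Let F (p : M * N) : M * N := (f p.1, g p).
Let psi (x : M) : R := phi (x, y0).

Let cMN : compact [set: M * N].
Proof. by rewrite -setXTT; exact: compact_setX. Qed.

Let cF : continuous F.
Proof.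
move=> p; apply: cvg_pair; last exact: cg.
by apply: (continuous_comp (f := fst)); [exact: cvg_fst|exact: cf].
Qed.

Lemma continuous_slice : continuous psi.
Proof.
move=> x; apply: (continuous_comp (f := fun x : M => (x, y0))); last exact: cphi.
by apply: cvg_pair; [exact: cvg_id|exact: cvg_cst].
Qed.

Let cpsi := continuous_slice.

Let iterF n x w : (iter n F (x, w)).1 = iter n f x.
Proof. by elim: n => //= n ->. Qed.

Let iterFy0 n x : iter n F (x, y0) = (iter n f x, y0).
Proof. by elim: n => //= n ->; rewrite /F /= gy0. Qed.

Let iterF_fiber n x w : mdist (iter n F (x, w)).2 y0 <= lam ^+ n * mdist w y0.
Proof.
elim: n => [|n IH] /=; first by rewrite mul1r.
have [lam0 _] := andP lam01.
rewrite -[X in mdist _ X](gy0 (iter n F (x, w)).1) {1}[iter n F (x, w)]surjective_pairing.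
apply: le_trans (glam _ _ _) _; rewrite exprS -mulrA.
by rewrite ler_wpM2l// ltW.
Qed.

Let birkhoff_slice n x : birkhoff_sum f psi n x = birkhoff_sum F phi n (x, y0).
Proof. by apply: eq_bigr => j _; rewrite iterFy0. Qed.

(** Only the traces of the dynamic balls on the invariant section are used. A scale below [d0 / 2]
    keeps the orbits of two points of a trace within [d0], so that the iterate of [f] is injective
    on it. *)
Lemma pressure_lt_growth (d0 gamma : R) : 0 < d0 -> inj_scale d0 f ->
  (pressure F phi < gamma%:E)%E ->
  exists2 D, 0 <= D & forall n, preim_sums_le f psi n (D * expR (gamma * n%:R)).
Proof.
move=> d00 fd Pgamma; have d20 : 0 < d0 / 2 by lra.
have [d [t [/andP[dgt0 dd0] ut t0 tcov tsum]]] := pressure_lt_cover cMN cF cphi d20 Pgamma.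
have [K K0 K1] := preim_sums1_bounded cM cpsi d00 fd.
apply: (@preim_sums_cover_growth _ _ f psi (M * N * nat)%type t snd
  (fun p => [set x | dyn_ball F d p.1 p.2 (x, y0)])
  (fun p => expR (sup_birkhoff F phi p.2 d p.1)) K gamma ut K0 K1) => //.
- by move=> x; have [p pt px] := tcov (x, y0); exists p.
- by move=> p pt; split; [exact: t0|exact: expR_ge0].
- move=> p pt x /= px; rewrite ler_expR birkhoff_slice.
  exact: sup_birkhoff_ge.
- move=> p pt x1 x2 /= px1 px2; apply: (@inj_scale_iter _ _ d0) => // j jp.
  have := px1 j (ltnW jp); have := px2 j (ltnW jp).
  rewrite !mdist_prod_lt !iterF => /andP[h2 _] /andP[h1 _].
  have := metric_triangle (iter j f x1) (iter j F p.1).1 (iter j f x2).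
  by rewrite (metric_sym (iter j f x1) (iter j F p.1).1); lra.
Qed.

Lemma fibers_contracted (d : R) : 0 < d ->
  exists J, forall j x w, (J <= j)%N -> mdist (iter j F (x, w)).2 y0 < d.
Proof.
move=> d0; have [Dm Dm0 DmP] : exists2 Dm : R, 0 < Dm & forall w, mdist w y0 < Dm.
  have [s sP] := compact_finite_net cN (fun w => near_mdist_lt w (@ltr01 R)).
  exists (1 + \sum_(c <- s) mdist c y0).
    by rewrite ltr_wpDr// sumr_ge0// => c _; exact: mdist_ge0.
  move=> w; have [c cs cw] := sP w.
  apply: le_lt_trans (metric_triangle w c y0) _; rewrite metric_sym ltr_leD//.
  by rewrite (big_rem c)//= lerDl sumr_ge0// => ? _; exact: mdist_ge0.
have [lam0 lam1] := andP lam01.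
have [J JP] : exists J, lam ^+ J * Dm < d.
  have : (lam ^+ n) @[n --> \oo] --> (0 : R) by apply: cvg_expr; rewrite gtr0_norm.
  move=> /cvgrPdist_lt/(_ (d / Dm)); case; first by rewrite divr_gt0.
  move=> J _ /(_ J (leqnn J)) /=; rewrite sub0r normrN gtr0_norm ?exprn_gt0//.
  by rewrite ltr_pdivlMr// => ?; exists J.
exists J => j z v Jj; apply: le_lt_trans (iterF_fiber _ _ _) _; apply: le_lt_trans JP.
apply: ler_pM; rewrite ?exprn_ge0 ?mdist_ge0//; [exact: ltW| |exact: ltW].
by rewrite ler_wiXn2l//; apply: ltW.
Qed.

(* The fibers are contracted after a bounded time, up to which uniform
   continuity suffices. *)
Lemma skew_shadow (d : R) : 0 < d -> exists2 d' : R, 0 < d' &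
  forall n x x' w w', shadows d' f f n x x' -> mdist w w' < d' ->
    dyn_ball F d (x', w') n (x, w).
Proof.
move=> d0; have d20 : 0 < d / 2 by lra.
have [J JP] := fibers_contracted d20.
have [d' d'0 d'P] := unif_continuous_iter cMN cF J d0.
exists (Num.min d' d); first by rewrite lt_min d'0.
move=> n x x' w w' xx' ww' j jn.
have [jJ|Jj] := leqP j J.
  apply: d'P => //; rewrite mdist_prod_lt /=; apply/andP; split.
    by have := xx' 0%N (leq0n _); rewrite lt_min metric_sym => /andP[].
  by move: ww'; rewrite lt_min metric_sym => /andP[].
rewrite mdist_prod_lt !iterF; apply/andP; split.
  by have := xx' j jn; rewrite lt_min metric_sym => /andP[].
have := JP j x w (ltnW Jj); have := JP j x' w' (ltnW Jj).
have := metric_triangle (iter j F (x', w')).2 y0 (iter j F (x, w)).2.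
by rewrite (metric_sym y0 (iter j F (x, w)).2); lra.
Qed.

(** After [J] steps the orbit is so close to the section that [phi] differs by less than [e]; each
    of the first [J] steps costs at most [2 * B], whatever [n]. *)
Lemma birkhoff_slice_le (e : R) : 0 < e -> exists C : R, forall n x w,
  birkhoff_sum F phi n (x, w) <= birkhoff_sum f psi n x + n%:R * e + C.
Proof.
move=> e0; have [d d0 phie] := unif_continuous_compact cMN cphi e0.
have [J JP] := fibers_contracted d0.
have [B B0 phiB] := bounded_compact cMN cphi.
exists (J%:R * (2 * B)) => n x w; rewrite birkhoff_slice.
have -> : n%:R * e = \sum_(j < n) e by rewrite sumr_const card_ord mulr_natl.
apply: (@le_trans _ _ (\sum_(j < n) (phi (iter j F (x, y0)) + e +
    (if (j < J)%N then 2 * B else 0)))).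
  apply: ler_sum => j _; case: ifPn => [_|].
    have := phiB (iter j F (x, w)); have := phiB (iter j F (x, y0)).
    by rewrite !ler_norml => /andP[? ?] /andP[? ?]; lra.
  rewrite -leqNgt addr0 => Jj.
  have /phie : mdist (iter j F (x, w)) (iter j F (x, y0)) < d.
    by rewrite mdist_prod_lt !iterF mdistxx d0/= iterFy0/=; exact: JP.
  by rewrite ltr_norml => /andP[? ?]; lra.
rewrite big_split/= big_split/= lerD2l {w}.
suff H : \sum_(j < n) (if (j < J)%N then 2 * B else 0) = (minn n J)%:R * (2 * B).
  by rewrite H ler_wpM2r ?mulr_ge0// ler_nat geq_minr.
elim: n => [|n IH]; first by rewrite big_ord0 min0n mul0r.
rewrite big_ord_recr/= IH; case: ltnP => nJ.
  by rewrite (minn_idPl nJ) -natr1; ring.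
by rewrite addr0 (minn_idPr (leqW nJ)).
Qed.

(* If [n] is a hyperbolic time of [x], then [x'] is the image of [z] by the inverse
   branch of [f^n] that maps [f^n x] to [x]. *)
Definition liftable (d r : R) n (z x' : M) := exists x,
  [/\ iter n f x' = z, shadows d f f n x x', mdist (iter n f x) z < r / 2 &
    forall p, mdist (iter n f x) p < r ->
      exists2 x'', iter n f x'' = p & shadows d f f n x x''].

(** The only consequence of hyperbolicity used for the lower bound. The radius [r] depends neither
    on the point nor on the time, so that one finite net of end points serves all hyperbolic
    times. *)
Definition liftable_often (S : set M) := forall d : R, 0 < d -> exists2 r : R, 0 < r &
  forall x, S x -> forall L, exists2 n, (L <= n)%N & forall p,
    mdist (iter n f x) p < r -> exists2 x', iter n f x' = p & shadows d f f n x x'.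

(** If [v] witnesses that [y] is liftable, then [x] lies within [r] of [iter n f v] and lifts along
    the orbit of [v]. Both [y] and the lift follow [v] within [d], hence each other within [d + d];
    [shadow_sums] doubles this scale. *)
Lemma liftable_sums (d r e : R) n z s x : inj_scale ((d + d) + (d + d)) f ->
  (forall y y', mdist y y' < d + d -> `|psi y - psi y'| < e) ->
  uniq s -> {in s, forall y, liftable d r n z y} -> mdist z x < r / 2 ->
  exists2 q, preim_sums f psi n x q &
    \sum_(y <- s) expR (birkhoff_sum f psi n y) <= expR (n%:R * e) * q.
Proof.
move=> fd psie us sz zx.
apply: (@shadow_sums _ _ f f psi psi (d + d) e n z x s fd) => //.
- by move=> y y' /psie; rewrite ltr_norml => /andP[_]; lra.
- by move=> y /sz[? []].
- move=> y /sz[v [_ vy vz vlift]]; have [|y' y'x vy'] := vlift x.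
    by have := metric_triangle (iter n f v) z x; lra.
  exists y' => // j jn; have := vy j jn; have := vy' j jn.
  have := metric_triangle (iter j f y) (iter j f v) (iter j f y').
  by rewrite (metric_sym (iter j f y) (iter j f v)); lra.
Qed.

Section lower_growth.
Variables (S : set M) (d0 : R).
Hypothesis d00 : 0 < d0.
Hypothesis fd0 : inj_scale d0 f.
Hypothesis Slift : liftable_often S.

(** By contradiction: if all liftable sums are small from time [n0] on, the covers of [S] by dynamic
    balls centered at liftable preimages of a finite net have arbitrarily small sums, against the
    definition of the relative pressure. *)
Lemma liftable_sums_large (gamma : R) d1 : 0 < d1 ->
  (gamma%:E < rel_pressure F phi (S `*` [set: N]))%E ->
  exists (d r : R), [/\ 0 < d < d1, 0 < r & forall n0, exists n z s,
    [/\ (n0 <= n)%N, uniq s, {in s, forall y, liftable d r n z y} &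
      expR (gamma * n%:R) <= \sum_(y <- s) expR (birkhoff_sum f psi n y)]].
Proof.
move=> d10 /ereal_gap[e' e'0 gPe].
(* One [e] pays for the oscillation of [phi] in a dynamic ball, one for the distance to the section,
   and the last one makes the sum over lengths geometric. *)
have [e e0 e'E] : exists2 e, 0 < e & e' = 3 * e by exists (e' / 3); lra.
have gP : ((gamma + 3 * e)%:E < rel_pressure F phi (S `*` [set: N]))%E.
  by rewrite -e'E.
have [du du0 phie] := unif_continuous_compact cMN cphi e0.
have [db [eps [L0 [/andP[db0 dbdu] eps0 covP]]]] := lt_pressure_cover cMN cphi du0 gP.
have [d2 d20 d2P] := skew_shadow db0.
pose d := Num.min d2 (d1 / 2).
have dpos : 0 < d by rewrite lt_min d20; lra.
have dd1 : d < d1 by rewrite gt_min; apply/orP; right; lra.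
have dd2 : d <= d2 by rewrite ge_min lexx.
have [r r0 rP] := Slift dpos.
exists d, r; split=> //; first by rewrite dpos.
move=> n0; apply: contrapT => no.
have {}no n z s : (n0 <= n)%N -> uniq s -> {in s, forall y, liftable d r n z y} ->
    \sum_(y <- s) expR (birkhoff_sum f psi n y) <= expR (gamma * n%:R).
  by move=> n0n us sl; rewrite leNgt; apply/negP => /ltW lt; apply: no; exists n, z, s.
have [C CP] := birkhoff_slice_le e0.
have r20 : 0 < r / 2 by lra.
have [Z0 Z0P] := compact_finite_net cM (fun x => near_mdist_lt x r20).
have [W0 W0P] := compact_finite_net cN (fun x => near_mdist_lt x d20).
pose Z := undup Z0; pose W := undup W0.
(* At each length, the centers split according to their fiber point in [W] and their end point in
   [Z] into finitely many lists, to each of which the assumption [no] applies; this is the origin of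
   the constant [K] below. *)
pose U L : set (M * N * nat) := [set p | [/\ (L <= p.2)%N, p.1.2 \in W &
  exists2 z, z \in Z & liftable d r p.2 z p.1.1]].
have Ucov L : dyn_covers F (S `*` [set: N]) db L (U L).
  split.
  - apply: (@sub_countable _ _ _ (\bigcup_n ((fun q => (q, n)) @`
      ((\bigcup_(z in [set` Z]) (iter n f @^-1` [set z])) `*` [set` W])))).
      apply: subset_card_le => -[[x w] n] [/= Ln wW [z zZ [v [xz _ _ _]]]].
      by exists n => //; exists (x, w) => //; split=> //; exists z.
    apply: bigcup_countable => // n _; apply/finite_set_countable/finite_image.
    apply: finite_setX; last exact: finite_seq.
    apply: bigcup_finite => [|z _]; first exact: finite_seq.
    exact: (@finite_preimages _ _ f psi cM cpsi d0 n z d00 fd0).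
  - by move=> p [].
  - move=> [x w] [/= Sx _]; have [n Ln xlift] := rP x Sx L.
    have [z zZ zx] := Z0P (iter n f x); have [v vW vw] := W0P w.
    have [|x' x'z xx'] := xlift z; first by rewrite metric_sym; lra.
    exists (x', v, n) => /=.
      split=> //=; rewrite ?mem_undup//; exists z; rewrite ?mem_undup//.
      by exists x; split=> //; rewrite metric_sym.
    apply: d2P; last by rewrite metric_sym.
    by move=> j jn; exact: lt_le_trans (xx' j jn) dd2.
pose K := (size W)%:R * (size Z)%:R * expR C.
have K0 : 0 <= K by rewrite !mulr_ge0// expR_ge0.
have [C' C'P] := geometric_tail K0 e0.
have level_le L n s : (n0 <= n)%N -> uniq s -> {in s, forall x, U L (x, n)} ->
    \sum_(x <- s) expR (- (gamma + 3 * e) * n%:R + sup_birkhoff F phi n db x) <=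
    if (n0 <= n)%N then K * expR (- e * n%:R) else 0.
  move=> n0n us sU; rewrite n0n.
  apply: (@le_trans _ _ (\sum_(x <- s) expR (C - (gamma + e) * n%:R) *
      expR (birkhoff_sum f psi n x.1))).
    apply: ler_psum => -[x w] _; rewrite -expRD ler_expR.
    have := CP n x w.
    have : sup_birkhoff F phi n db (x, w) <= birkhoff_sum F phi n (x, w) + n%:R * e.
      apply: sup_birkhoff_le_center => // y z yz; apply: phie; exact: lt_trans dbdu.
    have -> : - (gamma + 3 * e) * n%:R = - (gamma + e) * n%:R - n%:R * e - n%:R * e by ring.
    by rewrite /= mulNr; lra.
  rewrite -big_distrr/=.
  pose t := [seq (w, z) | w <- W, z <- Z].
  have ut : uniq t by apply: allpairs_uniq; rewrite ?undup_uniq// => -[? ?] [? ?].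
  rewrite (@big_classify _ _ _ s t (fun x => (x.2, iter n f x.1)))//; last first.
    move=> [x w] /sU[/= _ wW [z zZ [v [xz _ _ _]]]].
    by apply/allpairsP; exists (w, z); rewrite xz.
  have group p : p \in t ->
      \sum_(y <- [seq y <- s | (y.2, iter n f y.1) == p]) expR (birkhoff_sum f psi n y.1) <=
      expR (gamma * n%:R).
    case: p => w z _.
    rewrite -(big_map fst xpredT (fun y => expR (birkhoff_sum f psi n y))).
    apply: (no n z) => //.
      rewrite map_inj_in_uniq ?filter_uniq// => -[x1 w1] [x2 w2].
      rewrite !mem_filter /= => /andP[/eqP[-> _] _] /andP[/eqP[-> _] _] ->//.
    move=> _ /mapP[[x w'] + ->]; rewrite mem_filter => /= /andP[/eqP[_ <-]] /sU[/= _ _].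
    by move=> [z' _ xz']; have [v [-> _ _ _]] := xz'.
  apply: (@le_trans _ _ (expR (C - (gamma + e) * n%:R) * \sum_(p <- t) expR (gamma * n%:R))).
    by rewrite ler_wpM2l ?expR_ge0//; exact: ler_psum.
  rewrite big_const_seq count_predT iter_addr addr0 size_allpairs -[X in _ * X <= _]mulr_natl natrM.
  rewrite mulrCA -expRD /K -!mulrA -expRD.
  by rewrite [X in expR X](_ : _ = C + - e * n%:R)//; ring.
have esumU L : (n0 <= L)%N -> (\esum_(p in U L) (expR (- (gamma + 3 * e) * p.2%:R +
    sup_birkhoff F phi p.2 db p.1))%:E <= (C' * expR (- e * L%:R))%:E)%E.
  move=> n0L.
  apply: (@esum_le_levels _ _ _ _ (fun n => if (n0 <= n)%N then K * expR (- e * n%:R) else 0) L).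
  - by move=> p [].
  - by move=> n; case: ifP => // _; rewrite mulr_ge0 ?expR_ge0.
  - move=> n [_ _|x0 s0]; first by rewrite big_nil; case: ifP => // _; rewrite mulr_ge0 ?expR_ge0.
    set s := x0 :: s0 => us sU.
    have n0n : (n0 <= n)%N by have [/= Ln _ _] := sU x0 (mem_head _ _); exact: leq_trans Ln.
    exact: (level_le L n s n0n us sU).
  - move=> n; apply: le_trans (C'P L n).
    by apply: ler_sum => j _; case: ifP => // _; rewrite mulr_ge0 ?expR_ge0.
have [L [L0L n0L small]] : exists L, [/\ (L0 <= L)%N, (n0 <= L)%N & C' * expR (- e * L%:R) < eps].
  (* This yields [C' < eps * (e * L)], which suffices since [e * L <= expR (e * L)]. *)
  pose L1 := (Num.truncn (C' / (eps * e))).+1.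
  exists (maxn L1 (maxn L0 n0)); rewrite !leq_max !leqnn !orbT; split=> //.
  set L := maxn _ _; rewrite mulNr expRN -ltr_pdivlMr ?invr_gt0 ?expR_gt0// invrK.
  apply: (@lt_le_trans _ _ (eps * (e * L%:R))).
    rewrite mulrA mulrC -ltr_pdivrMr ?mulr_gt0//.
    apply: (@lt_le_trans _ _ L1%:R); first exact: truncnS_gt.
    by rewrite ler_nat leq_maxl.
  by rewrite ler_pM2l// (le_trans _ (expR_ge1Dx _))// lerDr.
have := le_trans (covP L _ L0L (Ucov L)) (esumU L n0L).
by rewrite lee_fin leNgt small.
Qed.

(** A large sum over preimages of one [z] moves to a point [w] near [z] in the backward orbit of
    [x], then to [x] itself. The number of these steps is bounded by [J], so that their cost is
    absorbed by a slightly larger exponent at a large time [n]. *)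
Lemma lt_pressure_growth (gamma : R) :
  open_map f -> (forall x, dense (\bigcup_(n in [set: nat]) (iter n f @^-1` [set x]))) ->
  (gamma%:E < rel_pressure F phi (S `*` [set: N]))%E ->
  exists2 n, (0 < n)%N & preim_sums_ge f psi n (expR (gamma * n%:R)).
Proof.
move=> of_ df /ereal_gap[e' e'0 gP].
have [e e0 e'E] : exists2 e, 0 < e & e' = 2 * e by exists (e' / 2); lra.
have [du du0 psie] := unif_continuous_compact cM cpsi e0.
have [B B0 psiB] := bounded_compact cM cpsi.
(* [liftable_sums] controls [psi] at the scale [2 * d] and needs injectivity at the scale
   [4 * d]. *)
have d10 : 0 < Num.min (du / 2) (d0 / 4) by rewrite lt_min !divr_gt0.
have [d [r [/andP[dpos]]]] := liftable_sums_large d10 gP.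
rewrite lt_min => /andP[ddu dd0] r0 large.
have r20 : 0 < r / 2 by lra.
have [J JP] := dense_preimages_uniform cM of_ r20 df.
(* The [J] additional steps lose at most [J * B], and the target exponent counts them for
   [gamma * J]; a gain of [e * n] covers both. *)
pose n0 := (Num.truncn (J%:R * (B + `|gamma|) / e)).+1.
have [n [z [s [n0n us sl sums]]]] := large n0.
have enJ : J%:R * (B + `|gamma|) <= e * n%:R.
  rewrite mulrC [leRHS]mulrC -ler_pdivrMr// [_ * J%:R]mulrC.
  by apply: le_trans (ltW (truncnS_gt _)) _; rewrite ler_nat.
exists (n + J)%N; first by rewrite (leq_trans _ (leq_addr _ _))// (leq_trans _ n0n).
move=> x; have [j [w [jJ zw wx]]] := JP z x.
have [||q nq sq] := liftable_sums (e := e) _ _ us sl zw.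
- by move=> y1 y2 y12; apply: fd0; lra.
- by move=> y y' yy'; apply: psie; lra.
have surj := dense_preimages_surj df.
(* The number [j] depends on [x]: [J - j] further backward steps, along arbitrary preimages, give
   the same total time [n + J] for all [x]. *)
have ge_ext := preim_sums_ge_surj (J - j) psiB surj.
have [r1 r1w qr1] := preim_sums_extend (expR_ge0 _) ge_ext nq.
have [r2 r2x r12] := preim_sums_shift psiB wx r1w.
exists r2; first by move: r2x; rewrite addnC addnA subnKC// addnC.
apply: le_trans r12; apply: le_trans (ler_wpM2l (expR_ge0 _) qr1).
have qge : expR ((gamma + e) * n%:R) <= q.
  have := le_trans sums sq.
  have -> : (gamma + e') * n%:R = n%:R * e + (gamma + e) * n%:R by rewrite e'E; ring.
  by rewrite expRD ler_pM2l// expR_gt0.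
rewrite mulrA -expRD; apply: le_trans (ler_wpM2l (expR_ge0 _) qge).
rewrite -expRD ler_expR natrB// natrD.
have gJ : J%:R * (B + gamma) <= e * n%:R.
  by apply: le_trans enJ; rewrite ler_wpM2l// lerD2l ler_norm.
rewrite [leLHS](_ : _ = gamma * n%:R + J%:R * (B + gamma) - J%:R * B); last by ring.
rewrite [leRHS](_ : _ = gamma * n%:R + e * n%:R - J%:R * B); last by ring.
by lra.
Qed.

End lower_growth.

End skew_dynamics.

(** * Matrices and the mean value inequality *)

Section matrix_norm.
Context {R : realType}.

Lemma mx_entry_le m n (X : 'M[R]_(m, n)) i j : `|X i j| <= `|X|.
Proof.
rewrite [leRHS]/Num.Def.normr/= mx_normrE.
exact: (le_bigmax _ (fun p => `|X p.1 p.2|) (i, j)).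
Qed.

Lemma mx_norm_le m n (X : 'M[R]_(m, n)) (c : R) : 0 <= c ->
  (forall i j, `|X i j| <= c) -> `|X| <= c.
Proof.
move=> c0 h; rewrite [leLHS]/Num.Def.normr/= mx_normrE.
by apply: bigmax_le => // -[i j] _; exact: h.
Qed.

Lemma mulmx_norm_le m n p (X : 'M[R]_(m, n)) (Y : 'M[R]_(n, p)) :
  `|X *m Y| <= n%:R * `|X| * `|Y|.
Proof.
apply: mx_norm_le => [|i j]; first by rewrite !mulr_ge0.
rewrite mxE; apply: le_trans (ler_norm_sum _ _ _) _.
have -> : n%:R * `|X| * `|Y| = \sum_(k < n) `|X| * `|Y|.
  by rewrite sumr_const card_ord -mulrA mulr_natl.
apply: ler_sum => k _; rewrite normrM.
by apply: ler_pM => //; exact: mx_entry_le.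
Qed.

Lemma row_norm_le m n (X : 'M[R]_(m, n)) (c : R) : 0 <= c ->
  (forall i, `|row i X| <= c) -> `|X| <= c.
Proof.
move=> c0 h; apply: mx_norm_le => // i j.
by have := mx_entry_le (row i X) 0 j; rewrite mxE => /le_trans; apply.
Qed.

Lemma unitmx_norm_ge m (X : 'M[R]_m) : X \in unitmx ->
  exists2 k : R, 0 < k & forall v : 'rV_m, `|v| <= k * `|v *m X|.
Proof.
move=> uX; exists (m%:R * `|invmx X| + 1); first by rewrite ltr_wpDl// mulr_ge0.
move=> v; rewrite -{1}[v](mulmxK uX); apply: le_trans (mulmx_norm_le _ _) _.
by rewrite mulrDl mul1r mulrAC lerDl.
Qed.

End matrix_norm.

Section mean_value.
Context {R : realType} {m n : nat}.

(** The scalar mean value theorem along the segment, one coordinate at a time: the intermediate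
    point depends on the coordinate, which is harmless for the maximum norm. Comparing with a fixed
    [J0] lets the bound serve a map close to the one that [J0] comes from. *)
Lemma mean_value_jacobian (h : 'rV[R]_m -> 'rV[R]_n) (J0 : 'M[R]_(m, n)) (u0 : 'rV[R]_m) (r eta : R) :
  (forall u : 'rV[R]_m, `|u - u0| < r -> differentiable h u /\ `|'J h u - J0| <= eta) ->
  forall u v : 'rV[R]_m, `|u - u0| < r -> `|v - u0| < r ->
    `|h v - h u - (v - u) *m J0| <= m%:R * eta * `|v - u|.
Proof.
move=> hJ u v ur vr; set w := v - u.
have eta0 : 0 <= eta by apply: le_trans (normr_ge0 _) (hJ u ur).2.
apply: mx_norm_le => [|i k]; first by rewrite !mulr_ge0.
rewrite (ord1 i) {i}.
pose p (t : R) := h (t *: w + u).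
have pr (t : R) : 0 <= t <= 1 -> `|t *: w + u - u0| < r.
  move=> /andP[t0 t1].
  have -> : t *: w + u - u0 = t *: (v - u0) + (1 - t) *: (u - u0).
    apply/rowP => l; rewrite !mxE; ring.
  apply: le_lt_trans (ler_normD _ _) _; rewrite !normrZ ger0_norm// ger0_norm ?subr_ge0//.
  have [t0'|t0'] := eqVneq t 0; first by rewrite t0'; lra.
  have : t * `|v - u0| < t * r by rewrite ltr_pM2l// lt_neqAle eq_sym t0'.
  have : (1 - t) * `|u - u0| <= (1 - t) * r by rewrite ler_wpM2l ?subr_ge0// ltW.
  by lra.
have pE (t : R) : (fun s : R => s^-1 *: ((p \o shift t) (s *: 1) - p t)) =
    (fun s : R => s^-1 *: ((h \o shift (t *: w + u)) (s *: w) - h (t *: w + u))).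
  apply/funext => s; rewrite /p /= /shift; congr (_ *: (h _ - _)).
  by rewrite scalerDl addrA scaler1.
have dp (t : R) : 0 <= t <= 1 -> derivable p t 1 /\ 'D_1 p t = w *m 'J h (t *: w + u).
  move=> /pr/hJ[dh _]; rewrite /derivable /derive pE; split.
    exact: (@diff_derivable _ _ _ _ _ w dh).
  by rewrite -deriveEjacobian.
have dk (t : R) : 0 <= t <= 1 -> is_derive t 1 (fun s => p s 0 k) ((w *m 'J h (t *: w + u)) 0 k).
  move=> /dp[dpt Dpt]; apply: DeriveDef; first by have /derivable_mxP := dpt; apply.
  by rewrite -Dpt derive_mx// mxE.
have [t t01] : exists2 t : R, t \in `]0, 1[%R & p 1 0 k - p 0 0 k =
    (w *m 'J h (t *: w + u)) 0 k * (1 - 0).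
  apply: (@MVT _ (fun s => p s 0 k) (fun t => (w *m 'J h (t *: w + u)) 0 k) 0 1) => //.
    by move=> t; rewrite in_itv/= => /andP[t0 t1]; apply: dk; rewrite !ltW.
  apply: continuous_in_subspaceT => t; rewrite inE/= in_itv/= => t01.
  apply: differentiable_continuous; apply/derivable1_diffP.
  by have [] := dk t t01.
rewrite subr0 mulr1 /p scale1r scale0r add0r subrK => E.
move: t01; rewrite in_itv/= => /andP[/ltW t0 /ltW t1].
have -> : (h v - h u - w *m J0) 0 k = (w *m ('J h (t *: w + u) - J0)) 0 k.
  by rewrite mulmxBr !mxE; move: E; rewrite !mxE => ->.
apply: le_trans (mx_entry_le _ _ _) _; apply: le_trans (mulmx_norm_le _ _) _.
rewrite -!mulrA ler_wpM2l// mulrC ler_wpM2r//.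
by apply: (hJ _ (pr t _)).2; rewrite t0.
Qed.

(** [Ck 1] speaks of directional derivatives; those along the basis vectors are the rows of the
    Jacobian matrix. *)
Lemma jacobian_continuous (h : 'rV[R]_m -> 'rV[R]_n) (U : set 'rV[R]_m) (u0 : 'rV[R]_m) :
  Ck 1 U h -> nbhs u0 U ->
  forall e : R, 0 < e -> \forall u \near u0, differentiable h u /\ `|'J h u - 'J h u0| < e.
Proof.
move=> [dU DU] nU e e0; have Uu0 := nbhs_singleton nU.
have rows : \forall u \near u0, forall i : 'I_m,
    `|'D_(delta_mx 0 i) h u0 - 'D_(delta_mx 0 i) h u| < e / 2.
  refine (@filter_forall _ _ (fun (i : 'I_m) u =>
    `|'D_(delta_mx 0 i) h u0 - 'D_(delta_mx 0 i) h u| < e / 2) (nbhs u0) _ _) => i.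
  by have /cvgrPdist_lt := DU (delta_mx 0 i) u0 Uu0; apply; lra.
near=> u; have Uu : U u by near: u.
split; first exact: dU.
have ru : forall i : 'I_m, `|'D_(delta_mx 0 i) h u0 - 'D_(delta_mx 0 i) h u| < e / 2.
  by near: u.
apply: (@le_lt_trans _ _ (e / 2)); last lra.
apply: row_norm_le => [|i]; first lra.
have Eu := deriveEjacobian (delta_mx 0 i) (dU _ Uu).
have Eu0 := deriveEjacobian (delta_mx 0 i) (dU _ Uu0).
have := ltW (ru i); rewrite distrC.
move: ('J h u) ('J h u0) ('D_(delta_mx 0 i) h u) ('D_(delta_mx 0 i) h u0) Eu Eu0.
by move=> Ju Ju0 _ _ -> ->; rewrite -mulmxBr -rowE.
Unshelve. all: by end_near. Qed.

End mean_value.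

(** * Charts *)

Lemma connected_ball {R : realType} {V : normedModType R} (u : V) (r : R) :
  0 < r -> connected (ball u r).
Proof.
move=> r0; have -> : ball u r = \bigcup_(v in ball u r)
    ((fun t : R => u + t *: (v - u)) @` `[0, 1]).
  apply/seteqP; split=> [v uv|w [v uv [t]]].
    exists v => //; exists 1; first by rewrite /= in_itv/= ler01 lexx.
    by rewrite scale1r addrC subrK.
  rewrite /= in_itv/= => /andP[t0 t1] <-.
  move: uv; rewrite -!ball_normE /= => uv.
  rewrite opprD addrA subrr add0r normrN normrZ ger0_norm//.
  by rewrite distrC; apply: le_lt_trans uv; rewrite ler_piMl.
apply: bigcup_connected.
  exists u => v _; exists 0; first by rewrite /= in_itv/= ler01 lexx.
  by rewrite scale0r addr0.
move=> v _; apply: connected_continuous_connected; first exact: segment_connected.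
apply: continuous_subspaceT => t.
by apply: cvgD; [exact: cvg_cst|apply: cvgZr_tmp; exact: cvg_id].
Qed.

Definition rep {R : realType} {m : nat} {M : metricType R} (A : riemannian m M)
  (i j : chart A) (f : M -> M) : 'rV[R]_m -> 'rV[R]_m := crd j \o f \o par i.

(* Locked: unification would otherwise unfold the derivatives. *)
HB.lock Definition Jac {R : realType} {m : nat} {M : metricType R} (A : riemannian m M)
  (i j : chart A) (f : M -> M) (x : M) : 'M[R]_m := 'J (rep i j f) (crd i x).
Arguments Jac {R m M A} i j f x.

Section charts.
Context {R : realType} {m : nat} {M : metricType R} (A : riemannian m M).
Implicit Types (i j k : chart A) (f g h : M -> M) (x y : M) (v w : 'rV[R]_m).

Lemma near_dom i x : dom i x -> \forall y \near x, dom i y.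
Proof. by move=> ix; apply: open_nbhs_nbhs; split=> //; exact: dom_open. Qed.

Lemma near_par i x (P : set M) : dom i x -> nbhs x P ->
  \forall u \near crd i x, P (par i u).
Proof.
move=> ix xP; have /(_ P) := @par_continuous _ _ _ A i (crd i x) (ex_intro2 _ _ x ix erefl).
by rewrite /= crdK//; apply.
Qed.

Lemma near_crd i x (P : set 'rV[R]_m) : dom i x -> nbhs (crd i x) P ->
  \forall y \near x, P (crd i y).
Proof. by move=> ix uP; exact: (@crd_continuous _ _ _ A i x ix P uP). Qed.

Lemma near_chart i x : dom i x ->
  \forall u \near crd i x, dom i (par i u) /\ crd i (par i u) = u.
Proof.
move=> ix; have : nbhs (crd i x) (crd i @` dom i).
  by apply: open_nbhs_nbhs; split; [exact: img_open|exists x].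
apply: filterS => _ [y iy <-]; rewrite crdK//.
Qed.

Lemma rep_at i j f x : dom i x -> rep i j f (crd i x) = crd j (f x).
Proof. by move=> ix; rewrite /rep /= crdK. Qed.

Lemma rep_nbhs i j f (V : set M) x : open V -> V x -> {for x, continuous f} ->
  dom i x -> dom j (f x) ->
  nbhs (crd i x) (crd i @` (dom i `&` V `&` f @^-1` dom j)).
Proof.
move=> oV Vx cf ix jfx; near=> u.
have [iu uE] : dom i (par i u) /\ crd i (par i u) = u by near: u; exact: near_chart.
exists (par i u) => //; split; first split=> //.
  near: u; apply: near_par => //; exact: open_nbhs_nbhs.
near: u; apply: (near_par (P := f @^-1` dom j)) => //.
by apply: cf; exact: near_dom.
Unshelve. all: by end_near. Qed.

Lemma rep_jacobian_continuous i j f (V : set M) x : open V -> V x -> C1_on A V f ->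
  dom i x -> dom j (f x) -> forall e : R, 0 < e ->
  \forall u \near crd i x, differentiable (rep i j f) u /\
    `|'J (rep i j f) u - Jac i j f x| < e.
Proof.
move=> oV Vx [cf df] ix jfx e; rewrite Jac.unlock; move: e; apply: (jacobian_continuous (df i j)).
by apply: rep_nbhs => //; exact: cf.
Qed.

Lemma rep_differentiable i j f (V : set M) x : open V -> V x -> C1_on A V f ->
  dom i x -> dom j (f x) -> differentiable (rep i j f) (crd i x).
Proof.
move=> oV Vx fV ix jfx.
exact: (nbhs_singleton (rep_jacobian_continuous oV Vx fV ix jfx ltr01)).1.
Qed.

(** The factors are in the order of application because matrices act on row vectors. Equality of [h]
    and [g \o f] near [x] only lets [g] be a local inverse of [f], and [h] the identity. *)
Lemma Jac_comp i j k f g h x : {for x, continuous f} -> dom i x -> dom j (f x) ->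
  differentiable (rep i j f) (crd i x) ->
  differentiable (rep j k g) (crd j (f x)) ->
  differentiable (rep i k h) (crd i x) ->
  (\forall y \near x, h y = g (f y)) ->
  Jac i k h x = Jac i j f x *m Jac j k g (f x).
Proof.
move=> cf ix jfx df dg dh hgf.
have E : \forall u \near crd i x, rep i k h u = (rep j k g \o rep i j f) u.
  near=> u; rewrite /rep /=.
  have -> : h (par i u) = g (f (par i u)).
    by near: u; exact: (near_par (P := fun y => h y = g (f y))).
  rewrite crdK//; near: u; apply: (near_par (P := f @^-1` dom j)) => //.
  by apply: cf; exact: near_dom.
have uE := rep_at j f ix.
have {}dg : differentiable (rep j k g) (rep i j f (crd i x)) by rewrite uE.
have dJ p q (H : 'rV[R]_p -> 'rV[R]_q) (u v : 'rV[R]_p) : differentiable H u -> 'd H u v = v *m 'J H u.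
  by move=> dH; exact: etrans (esym (deriveE v dH)) (deriveEjacobian v dH).
apply/row_matrixP => r; rewrite Jac.unlock !rowE mulmxA; set e := delta_mx 0 r.
apply: etrans (esym (dJ _ _ _ _ e dh)) _.
apply: etrans (esym (deriveE e dh)) _.
apply: etrans (near_eq_derive e E) _.
apply: etrans (deriveE e (differentiable_comp df dg)) _.
apply: etrans (congr1 (fun F => F e) (diff_comp df dg)) _.
apply: etrans (dJ _ _ _ _ _ dg) _.
apply: etrans (congr1 (fun p => 'd (rep i j f) (crd i x) e *m 'J (rep j k g) p) uE) _.
exact: (congr1 (fun v => v *m 'J (rep j k g) (crd j (f x))) (dJ _ _ _ _ e df)).
Unshelve. all: by end_near. Qed.

Lemma C1_on_id : C1_on A [set: M] id.
Proof.
split=> [x _|i j]; first exact: cvg_id.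
have := @transition_smooth _ _ _ A i j 1.
by rewrite setIT preimage_id.
Qed.

Lemma Jac_id i x : dom i x -> Jac i i id x = 1%:M.
Proof.
move=> ix; have E : \forall u \near crd i x, rep i i id u = id u.
  by have := near_chart ix; apply: filterS => u [].
have di := rep_differentiable openT I C1_on_id ix (ix : dom i (id x)).
apply/row_matrixP => r; rewrite Jac.unlock !rowE mulmx1; set e := delta_mx 0 r.
apply: etrans (esym (deriveEjacobian e di)) _.
apply: etrans (near_eq_derive e E) _.
exact: derive_id.
Qed.

Lemma Jac_transl i j k f x : C1_on A [set: M] f -> dom i x -> dom j x -> dom k (f x) ->
  Jac i k f x = Jac i j id x *m Jac j k f x.
Proof.
move=> C1f ix jx kfx; apply: (@Jac_comp i j k id f f x) => //.
- exact: (rep_differentiable openT I C1_on_id).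
- exact: (rep_differentiable openT I C1f).
- exact: (rep_differentiable openT I C1f).
- by near=> y.
Unshelve. all: by end_near. Qed.

Lemma Jac_transr i j k f x : C1_on A [set: M] f -> dom i x -> dom j (f x) -> dom k (f x) ->
  Jac i k f x = Jac i j f x *m Jac j k id (f x).
Proof.
move=> C1f ix jfx kfx; apply: (@Jac_comp i j k f id f x) => //.
- exact: C1f.1.
- exact: (rep_differentiable openT I C1f).
- exact: (rep_differentiable openT I C1_on_id).
- exact: (rep_differentiable openT I C1f).
- by near=> y.
Unshelve. all: by end_near. Qed.

Lemma Jac_unit i j f x : local_diffeo A f -> dom i x -> dom j (f x) ->
  Jac i j f x \in unitmx.
Proof.
move=> /(_ x)[U [g [[oU Ux] ofU fU gf gfU]]] ix jfx.
have gfx : g (f x) = x by exact: gf.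
have fxU : (f @` U) (f x) by exists x.
have igfx : dom i (g (f x)) by rewrite gfx.
have H : Jac i i id x = Jac i j f x *m Jac j i g (f x).
  apply: (@Jac_comp i j i f g id x) => //.
  - exact: fU.1.
  - exact: (rep_differentiable oU Ux fU).
  - exact: (rep_differentiable ofU fxU gfU).
  - exact: (rep_differentiable openT I C1_on_id).
  - have : nbhs x U by exact: open_nbhs_nbhs.
    by apply: filterS => y /gf ->.
by move: H; rewrite Jac_id// => /esym/mulmx1_unit[].
Qed.

Lemma local_diffeo_open_map f : local_diffeo A f -> open_map f.
Proof.
move=> lf V oV; rewrite openE => _ [x Vx <-].
have [U [g [[oU Ux] ofU fU gf gfU]]] := lf x.
have nfx : nbhs (f x) (f @` U) by apply: open_nbhs_nbhs; split=> //; exists x.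
have fxU : (f @` U) (f x) by exists x.
have nV : nbhs (g (f x)) V by rewrite gf//; exact: open_nbhs_nbhs.
have := gfU.1 (f x) fxU V nV; rewrite /= => gV.
have : nbhs (f x) ((f @` U) `&` g @^-1` V) by exact: filterI.
apply: filterS => _ [[z Uz <-] /=]; rewrite gf// => Vz.
by exists z.
Qed.

Lemma local_diffeo_locally_injective f x : local_diffeo A f ->
  exists2 U, nbhs x U & forall y1 y2, U y1 -> U y2 -> f y1 = f y2 -> y1 = y2.
Proof.
move=> /(_ x)[U [g [[oU Ux] _ _ gf _]]]; exists U; first exact: open_nbhs_nbhs.
by move=> y1 y2 U1 U2 f12; rewrite -(gf _ U1) -(gf _ U2) f12.
Qed.

Lemma local_diffeo_continuous f : local_diffeo A f -> continuous f.
Proof. by move=> lf x; have [U [g [[_ Ux] _ fU _ _]]] := lf x; exact: fU.1. Qed.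

Lemma manifold_loc_connected : @loc_connected R M.
Proof.
move=> x V xV; have ix := dom_chart_at A x; set i := chart_at A x in ix.
have nV : nbhs (crd i x) [set u | V (par i u)].
  exact: (near_par (P := V)).
have /nbhs_ballP[r /= r0 rV] := nV.
have /nbhs_ballP[r' /= r'0 r'i] := near_chart ix.
pose s := Num.min r r'.
have s0 : 0 < s by rewrite lt_min r0.
have sr : ball (crd i x) s `<=` ball (crd i x) r by apply: le_ball; rewrite ge_min lexx.
have sr' : ball (crd i x) s `<=` ball (crd i x) r' by apply: le_ball; rewrite ge_min lexx orbT.
exists (par i @` ball (crd i x) s); split.
- have : nbhs x [set y | ball (crd i x) s (crd i y) /\ dom i y].
    near=> y; split; last by near: y; exact: near_dom.
    by near: y; apply: (near_crd (P := ball (crd i x) s)) => //; exact: nbhsx_ballx.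
  by apply: filterS => y [sy iy]; exists (crd i y) => //; rewrite crdK.
- apply: connected_continuous_connected; last first.
    apply: continuous_in_subspaceT => u; rewrite inE => /sr'/r'i[iu uE].
    by apply: par_continuous; exists (par i u).
  exact: connected_ball.
- by move=> _ [u /sr/rV uV <-].
Unshelve. all: by end_near. Qed.

End charts.

(** * Tangent norms *)

Section quadratic_forms.
Context {R : realType} {m : nat}.
Implicit Types (G : 'M[R]_m) (v w : 'rV[R]_m).

Definition bform G v w : R := (v *m G *m w^T) 0 0.

Lemma bformC G v w : G^T = G -> bform G v w = bform G w v.
Proof.
move=> GT; rewrite /bform.
have <- : (w *m G *m v^T)^T = v *m G *m w^T by rewrite !trmx_mul GT trmxK mulmxA.
by rewrite mxE.
Qed.

Lemma bformDl G v1 v2 w : bform G (v1 + v2) w = bform G v1 w + bform G v2 w.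
Proof. by rewrite /bform !mulmxDl mxE. Qed.

Lemma bformDm G1 G2 v w : bform (G1 + G2) v w = bform G1 v w + bform G2 v w.
Proof. by rewrite /bform mulmxDr mulmxDl mxE. Qed.

Lemma bformZl G a v w : bform G (a *: v) w = a * bform G v w.
Proof. by rewrite /bform -!scalemxAl mxE. Qed.

Lemma bform_comb G a b v w : G^T = G ->
  bform G (a *: v + b *: w) (a *: v + b *: w) =
  a ^+ 2 * bform G v v + 2 * a * b * bform G v w + b ^+ 2 * bform G w w.
Proof.
move=> GT; rewrite bformDl !bformZl.
rewrite (bformC v _ GT) (bformC w _ GT) !bformDl !bformZl (bformC w v GT); ring.
Qed.

Lemma bform_norm_le G v : `|bform G v v| <= m%:R * (m%:R * `|v| * `|G|) * `|v|.
Proof.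
apply: le_trans (mx_entry_le _ _ _) _; apply: le_trans (mulmx_norm_le _ _) _.
apply: ler_pM; rewrite ?mulr_ge0//.
  by rewrite ler_wpM2l//; exact: mulmx_norm_le.
by apply: mx_norm_le => // i j; rewrite mxE; exact: mx_entry_le.
Qed.

Section positive_definite.
Variable G : 'M[R]_m.
Hypothesis GT : G^T = G.
Hypothesis Gpos : forall v, v != 0 -> 0 < bform G v v.

Lemma bform_ge0 v : 0 <= bform G v v.
Proof.
have [->|/Gpos/ltW//] := eqVneq v 0.
by rewrite /bform !mul0mx mxE.
Qed.

(** Positivity at [e *: v + w]. Unlike the bound with factors 2, it loses arbitrarily little on [v],
    which is the main term in the estimate of the expansion. *)
Lemma bform_quasi_le (e : R) v w : 0 < e ->
  bform G (v - w) (v - w) <= (1 + e) * bform G v v + (1 + e^-1) * bform G w w.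
Proof.
move=> e0; have -> : v - w = 1 *: v + (- 1) *: w by rewrite scale1r scaleN1r.
have := bform_ge0 (e *: v + 1 *: w); rewrite !bform_comb//.
set x := bform G v v; set y := bform G v w; set z := bform G w w => h.
have : 0 <= e^-1 * (e ^+ 2 * x + 2 * e * 1 * y + 1 ^+ 2 * z).
  by rewrite mulr_ge0// invr_ge0 ltW.
have -> : e^-1 * (e ^+ 2 * x + 2 * e * 1 * y + 1 ^+ 2 * z) = e * x + 2 * y + e^-1 * z.
  by field; rewrite gt_eqF.
by lra.
Qed.

Lemma bform_cauchy_schwarz v w : bform G v w ^+ 2 <= bform G v v * bform G w w.
Proof.
have [->|w0] := eqVneq w 0.
  by rewrite /bform trmx0 !mulmx0 mxE expr0n mulr0.
have := bform_ge0 (bform G w w *: v + (- bform G v w) *: w); rewrite bform_comb//.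
have := Gpos w0.
set x := bform G v v; set y := bform G v w; set z := bform G w w => z0.
have -> : z ^+ 2 * x + 2 * z * - y * y + (- y) ^+ 2 * z = z * (x * z - y ^+ 2) by ring.
by rewrite pmulr_rge0// subr_ge0.
Qed.

(** The matrix [G] is invertible since [v *m G = 0] makes the form vanish at [v], so that [v] is
    controlled by [v *m G]. The coordinates of the latter are products with basis vectors, which
    Cauchy-Schwarz bounds by the form at [v]. *)
Lemma bform_coercive : exists2 k : R, 0 < k & forall v, k * `|v| ^+ 2 <= bform G v v.
Proof.
have uG : G \in unitmx.
  rewrite -row_free_unit; apply: inj_row_free => v vG.
  apply/eqP/negPn/negP => /Gpos; rewrite /bform vG mul0mx mxE ltxx//.
have [k k0 kP] := unitmx_norm_ge uG.
pose C := m%:R * (m%:R * 1 * `|G|) * 1 + 1.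
have C0 : 0 < C by rewrite ltr_wpDl// !mulr_ge0.
exists (k ^+ 2 * C)^-1; first by rewrite invr_gt0 mulr_gt0// exprn_gt0.
move=> v; rewrite mulrC ler_pdivrMr ?mulr_gt0 ?exprn_gt0//.
have vG : `|v *m G| ^+ 2 <= bform G v v * C.
  have h j : (v *m G) 0 j ^+ 2 <= bform G v v * C.
    have -> : (v *m G) 0 j = bform G v (delta_mx 0 j).
      by rewrite /bform trmx_delta -colE [RHS]mxE.
    apply: le_trans (bform_cauchy_schwarz _ _) _.
    rewrite ler_wpM2l ?bform_ge0//.
    have d1 : `|delta_mx 0 j : 'rV[R]_m| <= 1.
      apply: mx_norm_le => // a b; rewrite mxE.
      by case: (_ && _); rewrite /= ?normr1 ?normr0.
    apply: le_trans (ler_norm _) _; apply: le_trans (bform_norm_le _ _) _.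
    rewrite /C; apply: ler_wpDr => //; apply: ler_pM; rewrite ?mulr_ge0//.
    by rewrite ler_wpM2l// ler_wpM2r// ler_wpM2l.
  have qC0 : 0 <= bform G v v * C by rewrite mulr_ge0 ?bform_ge0// ltW.
  rewrite -[leRHS]sqr_sqrtr// ler_sqr ?nnegrE ?sqrtr_ge0//.
  apply: mx_norm_le => [|a j]; first exact: sqrtr_ge0.
  by rewrite (ord1 a) -sqrtr_sqr ler_sqrt.
apply: (@le_trans _ _ (k ^+ 2 * `|v *m G| ^+ 2)).
  rewrite -exprMn; apply: lerXn2r; rewrite ?nnegrE//.
  by rewrite mulr_ge0// ltW.
rewrite [leRHS]mulrCA; apply: ler_wpM2l; first by rewrite exprn_ge0// ltW.
exact: vG.
Qed.

End positive_definite.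
End quadratic_forms.

Section tangent_norms.
Context {R : realType} {m : nat} {M : metricType R} (A : riemannian m M).
Implicit Types (i j k : chart A) (f g h : M -> M) (x y : M) (v w : 'rV[R]_m).

Definition qform i x v : R := bform (gram i x) v v.

Lemma qform_transition i j x v : dom i x -> dom j x ->
  qform i x v = qform j x (v *m Jac i j id x).
Proof.
move=> ix jx; rewrite /qform /bform (gram_transition ix jx) Jac.unlock.
rewrite (_ : rep i j id = crd j \o par i)//; move: ('J _ _) => J.
by rewrite trmx_mul !mulmxA.
Qed.

Lemma qform_ge0 i x v : dom i x -> 0 <= qform i x v.
Proof. by move=> ix; apply: bform_ge0 => w w0; exact: gram_posdef. Qed.

Lemma qformZ i x a v : qform i x (a *: v) = a ^+ 2 * qform i x v.
Proof.
rewrite /qform bformZl /bform linearZ/= -scalemxAr mxE; ring.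
Qed.

Lemma gram_near i x0 (e : R) : dom i x0 -> 0 < e ->
  \forall x \near x0, `|gram i x - gram i x0| < e.
Proof.
move=> ix0 e0.
have := @gram_smooth _ _ _ A i 0 (crd i x0) (ex_intro2 _ _ x0 ix0 erefl).
move=> /cvgrPdist_lt/(_ e e0)/(near_crd ix0) nu; near=> x.
have ix : dom i x by near: x; exact: near_dom.
have : `|(gram i \o par i) (crd i x0) - (gram i \o par i) (crd i x)| < e.
  by near: x.
by rewrite /= !crdK// distrC.
Unshelve. all: by end_near. Qed.

Lemma qform_bounds i x0 : dom i x0 -> exists k K : R, [/\ 0 < k, 0 < K &
  \forall x \near x0, forall v, k * `|v| ^+ 2 <= qform i x v <= K * `|v| ^+ 2].
Proof.
move=> ix0.
have gpos v : v != 0 -> 0 < bform (gram i x0) v v by exact: gram_posdef.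
have [k k0 kP] := bform_coercive (gram_sym ix0) gpos.
pose D := m%:R * m%:R + 1 : R.
have D0 : 0 < D by rewrite ltr_wpDl// mulr_ge0.
(* A change of the Gram matrix by less than [e] changes the form by at most [k / 2] times the
   squared norm, so that half of the coercivity at [x0] survives. *)
pose e := k / 2 / D.
have e0 : 0 < e by rewrite !divr_gt0.
exists (k / 2), (m%:R * m%:R * (`|gram i x0| + e) + 1); split.
- by rewrite divr_gt0.
- by rewrite ltr_wpDl// !mulr_ge0// addr_ge0// ltW.
near=> x => v.
have ex : `|gram i x - gram i x0| < e by near: x; exact: gram_near.
have v2 : 0 <= `|v| ^+ 2 by rewrite exprn_ge0.
apply/andP; split.
  have -> : qform i x v = qform i x0 v + bform (gram i x - gram i x0) v v.
    rewrite /qform -bformDm; congr bform; by rewrite addrC subrK.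
  have : `|bform (gram i x - gram i x0) v v| <= k / 2 * `|v| ^+ 2.
    apply: le_trans (bform_norm_le _ _) _.
    have -> : m%:R * (m%:R * `|v| * `|gram i x - gram i x0|) * `|v| =
      m%:R * m%:R * `|gram i x - gram i x0| * `|v| ^+ 2 by ring.
    rewrite ler_wpM2r//; apply: (@le_trans _ _ (D * e)); last first.
      by rewrite /e mulrC divfK// gt_eqF.
    apply: ler_pM; rewrite ?mulr_ge0//; last exact: ltW.
    by rewrite lerDl.
  by rewrite ler_norml => /andP[h _]; have := kP v; rewrite /qform; lra.
apply: le_trans (ler_norm _) _; apply: le_trans (bform_norm_le _ _) _.
have -> : m%:R * (m%:R * `|v| * `|gram i x|) * `|v| =
  m%:R * m%:R * `|gram i x| * `|v| ^+ 2 by ring.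
rewrite ler_wpM2r//; apply: ler_wpDr => //; rewrite ler_wpM2l ?mulr_ge0//.
have -> : gram i x = gram i x0 + (gram i x - gram i x0) by rewrite addrC subrK.
by apply: le_trans (ler_normD _ _) _; rewrite lerD2l ltW.
Unshelve. all: by end_near. Qed.

Lemma Jac_near i j f x0 (e : R) : C1_on A [set: M] f -> dom i x0 -> dom j (f x0) ->
  0 < e -> \forall x \near x0, `|Jac i j f x - Jac i j f x0| < e.
Proof.
move=> C1f ix0 jfx0 e0.
have := near_crd ix0 (rep_jacobian_continuous openT I C1f ix0 jfx0 e0).
apply: filterS => x [_]; by rewrite [in Jac i j f x]Jac.unlock.
Qed.

Lemma Jac_lower i j f x0 : local_diffeo A f -> C1_on A [set: M] f ->
  dom i x0 -> dom j (f x0) ->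
  exists2 k : R, 0 < k & \forall x \near x0, forall v, `|v| <= k * `|v *m Jac i j f x|.
Proof.
move=> lf C1f ix0 jfx0.
have [k k0 kP] := unitmx_norm_ge (Jac_unit lf ix0 jfx0).
(* The perturbation then costs at most half of the norm of [v], so that [k] becomes [2 * k]. *)
pose e := (2 * k * (m%:R + 1))^-1.
have e0 : 0 < e by rewrite invr_gt0 !mulr_gt0// ltr_wpDl.
exists (2 * k); first by rewrite mulr_gt0.
near=> x => v.
have ex : `|Jac i j f x - Jac i j f x0| < e by near: x; exact: Jac_near.
have h1 := kP v.
have h2 : `|v *m Jac i j f x0| <= `|v *m Jac i j f x| + m%:R * `|v| * e.
  have -> : v *m Jac i j f x0 = v *m Jac i j f x - v *m (Jac i j f x - Jac i j f x0).
    by rewrite mulmxBr opprB addrC subrK.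
  apply: le_trans (ler_normB _ _) _; rewrite lerD2l.
  apply: le_trans (mulmx_norm_le _ _) _; rewrite ler_wpM2l ?mulr_ge0//; exact: ltW.
have h3 : k * (m%:R * `|v| * e) <= `|v| / 2.
  have -> : k * (m%:R * `|v| * e) = (m%:R / (m%:R + 1)) * (`|v| / 2).
    by rewrite /e; field; rewrite !gt_eqF//= ltr_wpDl.
  by rewrite ler_piMl ?divr_ge0// ler_pdivrMr ?ltr_wpDl// mul1r lerDl.
have h4 : k * `|v *m Jac i j f x0| <= k * `|v *m Jac i j f x| + k * (m%:R * `|v| * e).
  by rewrite -mulrDr ler_pM2l.
by rewrite -mulrA; lra.
Unshelve. all: by end_near. Qed.

Lemma tangent_mapE f x : tangent_map A f x = Jac (chart_at A x) (chart_at A (f x)) f x.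
Proof. by rewrite Jac.unlock. Qed.

Lemma tangent_norm_sq x v : tangent_norm A x v ^+ 2 = qform (chart_at A x) x v.
Proof. by rewrite sqr_sqrtr//; apply: qform_ge0; exact: dom_chart_at. Qed.

Lemma tangent_norm_ge0 x v : 0 <= tangent_norm A x v.
Proof. exact: sqrtr_ge0. Qed.

Let inv_norms f x : set R := [set tangent_norm A x (w *m invmx (tangent_map A f x))
  | w in [set w | tangent_norm A (f x) w <= 1]].

Let inv_norms0 f x : inv_norms f x 0.
Proof.
exists 0; rewrite ?mul0mx /= /tangent_norm /= !mul0mx mxE sqrtr0//; exact: ler01.
Qed.

Section bounded_inverse.
Variables (f : M -> M) (x : M) (C : R).
Hypothesis C0 : 0 <= C.
Hypothesis qC : forall w, qform (chart_at A x) x (w *m invmx (tangent_map A f x)) <=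
  C * qform (chart_at A (f x)) (f x) w.

(** The operator norm is a supremum in [R], meaningful once the set is known to be bounded;
    [inverse_bound_near] provides the hypothesis [qC]. *)
Let inv_norms_ub : ubound (inv_norms f x) (Num.sqrt C).
Proof.
move=> _ [w /= w1 <-]; rewrite -(@ler_sqr _) ?nnegrE ?sqrtr_ge0 ?tangent_norm_ge0//.
rewrite (sqr_sqrtr C0) tangent_norm_sq; apply: le_trans (qC w) _.
rewrite -[leRHS]mulr1 ler_wpM2l// -tangent_norm_sq -(expr1n _ 2).
by rewrite ler_sqr ?nnegrE ?tangent_norm_ge0.
Qed.

Lemma tangent_inv_norm_ge0 : 0 <= tangent_inv_norm A f x.
Proof. by apply: ub_le_sup; [exists (Num.sqrt C)|exact: inv_norms0]. Qed.

Lemma tangent_inv_norm_le : tangent_inv_norm A f x ^+ 2 <= C.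
Proof.
rewrite -[leRHS]sqr_sqrtr// ler_sqr ?nnegrE ?sqrtr_ge0 ?tangent_inv_norm_ge0//.
by apply: ge_sup; [exists 0; exact: inv_norms0|].
Qed.

Lemma qform_le_tangent_inv_norm v : tangent_map A f x \in unitmx ->
  qform (chart_at A x) x v <=
  tangent_inv_norm A f x ^+ 2 * qform (chart_at A (f x)) (f x) (v *m tangent_map A f x).
Proof.
move=> uJ; set J := tangent_map A f x in uJ *; set w := v *m J.
have vE : v = w *m invmx J by rewrite mulmxK.
have [w0|w0] := eqVneq w 0.
  by rewrite {1}vE w0 mul0mx /qform /bform !mul0mx !mxE mulr0.
have q0 : 0 < qform (chart_at A (f x)) (f x) w by apply: gram_posdef => //; exact: dom_chart_at.
set s := tangent_norm A (f x) w.
have s0 : 0 < s by rewrite sqrtr_gt0.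
have sE : qform (chart_at A (f x)) (f x) w = s ^+ 2 by rewrite tangent_norm_sq.
rewrite sE -ler_pdivrMr ?exprn_gt0// mulrC -exprVn -qformZ -tangent_norm_sq.
rewrite ler_sqr ?nnegrE ?tangent_norm_ge0 ?tangent_inv_norm_ge0//.
apply: ub_le_sup; first by exists (Num.sqrt C).
exists (s^-1 *: w); last by rewrite -scalemxAl -vE.
rewrite /= -(@ler_sqr _) ?nnegrE ?tangent_norm_ge0// tangent_norm_sq qformZ sE.
by rewrite exprVn mulVf ?expr1n// gt_eqF// exprn_gt0.
Qed.

Lemma tangent_inv_norm_gt0 : (0 < m)%N -> tangent_map A f x \in unitmx ->
  0 < tangent_inv_norm A f x.
Proof.
move=> m0 uJ; rewrite lt_neqAle tangent_inv_norm_ge0 andbT eq_sym; apply/eqP => a0.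
pose v : 'rV[R]_m := delta_mx 0 (Ordinal m0).
have v0 : v != 0.
  apply/eqP => /matrixP/(_ 0 (Ordinal m0)); rewrite !mxE !eqxx /= => /eqP.
  by rewrite oner_eq0.
have := qform_le_tangent_inv_norm v uJ; rewrite a0 expr0n mul0r leNgt.
by rewrite (gram_posdef (dom_chart_at A x) v0).
Qed.

End bounded_inverse.

Lemma tangent_inv_norm_dim0 f x : m = 0%N -> tangent_inv_norm A f x = 0.
Proof.
move=> m0; rewrite /tangent_inv_norm (_ : [set _ | _ in _] = [set 0]) ?sup1//.
have z v : v = 0 by apply/rowP => -[k km]; exfalso; move: km; rewrite m0.
have t0 y : tangent_norm A y 0 = 0 by rewrite /tangent_norm !mul0mx mxE sqrtr0.
apply/seteqP; split=> [_ [w _ <-]|_ ->]; first by rewrite (z (_ *m _)) /= t0.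
by exists 0; rewrite /= ?(z (_ *m _)) t0.
Qed.

Section expansion.
Variable f : M -> M.
Hypothesis lf : local_diffeo A f.
Hypothesis C1f : C1_on A [set: M] f.

Lemma tangent_map_unit x : tangent_map A f x \in unitmx.
Proof. by rewrite tangent_mapE; apply: Jac_unit => //; exact: dom_chart_at. Qed.

(** The charts [chart_at A x] may jump with [x], so that the bound is proved in the fixed charts [i]
    and [j], where everything is continuous, and carried over by the invariance of the quadratic
    forms. *)
Lemma inverse_bound_near i j x0 : dom i x0 -> dom j (f x0) ->
  exists2 C, 0 <= C & \forall x \near x0, forall w,
    qform (chart_at A x) x (w *m invmx (tangent_map A f x)) <=
    C * qform (chart_at A (f x)) (f x) w.
Proof.
move=> ix0 jfx0.
have [k1 [K1 [k10 K10 b1]]] := qform_bounds ix0.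
have [k2 [K2 [k20 K20 b2]]] := qform_bounds jfx0.
have [k k0 kP] := Jac_lower lf C1f ix0 jfx0.
have cf := C1f.1 x0 Logic.I.
exists (K1 * k ^+ 2 / k2); first by rewrite !mulr_ge0 ?exprn_ge0 ?invr_ge0 ?ltW.
near=> x => w.
have ix : dom i x by near: x; exact: near_dom.
have jfx : dom j (f x) by near: x; apply: cf; exact: near_dom.
have b1x : forall v, k1 * `|v| ^+ 2 <= qform i x v <= K1 * `|v| ^+ 2 by near: x.
have b2x : forall v, k2 * `|v| ^+ 2 <= qform j (f x) v <= K2 * `|v| ^+ 2.
  by near: x; exact: (cf _ b2).
have kPx : forall v, `|v| <= k * `|v *m Jac i j f x| by near: x.
set i0 := chart_at A x; set j0 := chart_at A (f x).
have i0x : dom i0 x by exact: dom_chart_at.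
have j0x : dom j0 (f x) by exact: dom_chart_at.
have uJ := tangent_map_unit x; move: uJ; rewrite tangent_mapE -/i0 -/j0 => uJ.
set v0 := w *m _; set v := v0 *m Jac i0 i id x.
have vJ : v *m Jac i j f x = w *m Jac j0 j id (f x).
  by rewrite -mulmxA -(Jac_transl C1f i0x ix jfx) (Jac_transr C1f i0x j0x jfx) mulmxA mulmxKV.
rewrite (qform_transition _ i0x ix) -/v (qform_transition w j0x jfx) -vJ.
have /andP[_ h1] := b1x v; apply: le_trans h1 _.
have /andP[h2 _] := b2x (v *m Jac i j f x).
rewrite -!mulrA; apply: ler_wpM2l; first exact: ltW.
apply: (@le_trans _ _ (k ^+ 2 * `|v *m Jac i j f x| ^+ 2)).
  rewrite -exprMn; apply: lerXn2r; rewrite ?nnegrE//.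
  by rewrite mulr_ge0// ltW.
rewrite expr2 -mulrA; do 2 (apply: ler_wpM2l; first exact: ltW).
by rewrite mulrC ler_pdivlMr// mulrC.
Unshelve. all: by end_near. Qed.

Lemma tangent_inv_norm_pos x : (0 < m)%N -> 0 < tangent_inv_norm A f x.
Proof.
have [C C0 /nbhs_singleton h] := inverse_bound_near (dom_chart_at A x) (dom_chart_at A (f x)).
by move=> m0; apply: (tangent_inv_norm_gt0 C0 h m0); exact: tangent_map_unit.
Qed.

Lemma qform_tangent_inv_norm i j x v : dom i x -> dom j (f x) ->
  qform i x v <= tangent_inv_norm A f x ^+ 2 * qform j (f x) (v *m Jac i j f x).
Proof.
move=> ix jfx.
have [C C0 /nbhs_singleton h] := inverse_bound_near (dom_chart_at A x) (dom_chart_at A (f x)).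
set i0 := chart_at A x; set j0 := chart_at A (f x).
have i0x : dom i0 x by exact: dom_chart_at.
have j0x : dom j0 (f x) by exact: dom_chart_at.
rewrite (qform_transition v ix i0x) (qform_transition _ jfx j0x).
have := qform_le_tangent_inv_norm C0 h (v *m Jac i i0 id x) (tangent_map_unit x).
rewrite tangent_mapE -/i0 -/j0.
by rewrite -!mulmxA -(Jac_transl C1f ix i0x j0x) (Jac_transr C1f ix jfx j0x).
Qed.

End expansion.
End tangent_norms.

(** * Expansion in charts *)

Section hyperbolicity.
Context {R : realType} {m : nat} {M : metricType R} (A : riemannian m M).
Implicit Types (i j k : chart A) (x y p : M) (v w : 'rV[R]_m).

Section expansion.
Variable f : M -> M.
Hypothesis lf : local_diffeo A f.
Hypothesis C1f : C1_on A [set: M] f.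

Let ainv := tangent_inv_norm A f.

(** The increment [w] of [f] is [v *m Jac i j f x + o] with a small [o]. Since [f] is linearized at
    [x] itself, the norms [ainv] at two points are never compared; near [x0] they only have to be
    bounded. *)
Lemma expansion_near i j x0 (E : R) : 1 < E -> dom i x0 -> dom j (f x0) ->
  exists2 U, nbhs x0 U & forall x p, U x -> U p ->
    qform i x (crd i p - crd i x) <=
    E * ainv x ^+ 2 * qform j (f x) (crd j (f p) - crd j (f x)).
Proof.
move=> E1 ix0 jfx0.
have [k1 [K1 [k10 K10 b1]]] := qform_bounds ix0.
have [k2 [K2 [k20 K20 b2]]] := qform_bounds jfx0.
have [C C0 CP] := inverse_bound_near lf C1f ix0 jfx0.
have cf := C1f.1 x0 Logic.I.
(* These values satisfy [(1 + e) / (1 - s) = E]: [e] is the loss in [bform_quasi_le], and [s] the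
   share of the left-hand side taken by the remainder [o]. *)
pose e := (E - 1) / 2; pose s := (E - 1) / (2 * E).
have e0 : 0 < e by rewrite /e; lra.
have E0 : 0 < E by lra.
have s0 : 0 < s by rewrite divr_gt0 ?mulr_gt0// subr_gt0.
(* The remainder contributes at most [D * eta ^+ 2] times the form at [v]. The 4 is the square of 2,
   as [o] collects the mean value error and the difference between the Jacobians at [x] and [x0]. *)
pose D := C * (1 + e^-1) * K2 * (4 * m%:R * m%:R) / k1.
have D0 : 0 <= D.
  have e'0 : 0 <= 1 + e^-1 by rewrite addr_ge0// invr_ge0 ltW.
  by rewrite !mulr_ge0 ?invr_ge0//; exact: ltW.
pose eta := Num.min 1 (s / (D + 1)).
have D10 : 0 < D + 1 by rewrite ltr_wpDl.
have eta0 : 0 < eta by rewrite lt_min ltr01 divr_gt0.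
have etas : D * eta ^+ 2 <= s.
  have eta1 : eta <= 1 by rewrite ge_min lexx.
  have h1 : eta ^+ 2 <= eta by rewrite expr2 ler_piMl// ltW.
  have h2 : eta <= s / (D + 1) by rewrite ge_min lexx orbT.
  apply: (@le_trans _ _ (D * (s / (D + 1)))).
    by rewrite ler_wpM2l//; exact: le_trans h1 h2.
  rewrite mulrA ler_pdivrMr// mulrC ler_wpM2l ?lerDl//; exact: ltW.
have /nbhs_ballP[r /= r0 rJ] := rep_jacobian_continuous openT Logic.I C1f ix0 jfx0 eta0.
exists [set x | [/\ dom i x /\ dom j (f x), ball (crd i x0) r (crd i x),
    forall v, k1 * `|v| ^+ 2 <= qform i x v <= K1 * `|v| ^+ 2,
    forall v, k2 * `|v| ^+ 2 <= qform j (f x) v <= K2 * `|v| ^+ 2 &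
    forall w, qform (chart_at A x) x (w *m invmx (tangent_map A f x)) <=
      C * qform (chart_at A (f x)) (f x) w]].
  near=> x; split.
  - by split; near: x; [exact: near_dom|apply: cf; exact: near_dom].
  - by near: x; apply: near_crd => //; exact: nbhsx_ballx.
  - by near: x.
  - by near: x; exact: (cf _ b2).
  - by near: x.
move=> x p [[ix jfx] xr b1x b2x Cx] [[ip jfp] pr _ _ _].
set v := crd i p - crd i x; set w := crd j (f p) - crd j (f x).
have ub u : `|u - crd i x0| < r -> differentiable (rep i j f) u /\
    `|'J (rep i j f) u - Jac i j f x0| <= eta.
  move=> ur; have [] := rJ u; first by rewrite -ball_normE /= distrC.
  by move=> du /ltW.
have xr' : `|crd i x - crd i x0| < r by move: xr; rewrite -ball_normE /= distrC.
have pr' : `|crd i p - crd i x0| < r by move: pr; rewrite -ball_normE /= distrC.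
have mv := mean_value_jacobian ub xr' pr'.
have Jx : `|Jac i j f x - Jac i j f x0| <= eta.
  by have := (ub _ xr').2; rewrite [in Jac i j f x]Jac.unlock.
set o := w - v *m Jac i j f x.
have o_le : `|o| <= 2 * m%:R * eta * `|v|.
  have -> : o = (w - v *m Jac i j f x0) - v *m (Jac i j f x - Jac i j f x0).
    by rewrite /o mulmxBr opprB addrA subrK.
  apply: le_trans (ler_normB _ _) _.
  have h1 : `|w - v *m Jac i j f x0| <= m%:R * eta * `|v|.
    by move: mv; rewrite !rep_at.
  have h2 : `|v *m (Jac i j f x - Jac i j f x0)| <= m%:R * eta * `|v|.
    apply: le_trans (mulmx_norm_le _ _) _.
    by rewrite mulrAC ler_wpM2r// ler_wpM2l.
  have -> : 2 * m%:R * eta * `|v| = m%:R * eta * `|v| + m%:R * eta * `|v| by ring.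
  exact: lerD.
have a2C : ainv x ^+ 2 <= C := tangent_inv_norm_le C0 Cx.
have a20 : 0 <= ainv x ^+ 2 by rewrite sqr_ge0.
have q1 := qform_tangent_inv_norm lf C1f v ix jfx.
have vJ : v *m Jac i j f x = w - o by rewrite /o opprB addrC subrK.
have qpos u : u != 0 -> 0 < bform (gram j (f x)) u u by exact: gram_posdef.
have q2 := bform_quasi_le (gram_sym jfx) qpos w o e0.
have q3 : qform j (f x) o <= K2 * (2 * m%:R * eta * `|v|) ^+ 2.
  have /andP[_ h] := b2x o; apply: le_trans h _; apply: ler_wpM2l; first exact: ltW.
  by apply: lerXn2r; rewrite ?nnegrE//; exact: le_trans o_le.
have q4 : `|v| ^+ 2 <= qform i x v / k1.
  by have /andP[h _] := b1x v; rewrite ler_pdivlMr// mulrC.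
have qv0 : 0 <= qform i x v by exact: qform_ge0.
have qw0 : 0 <= qform j (f x) w by exact: qform_ge0.
have q5 : ainv x ^+ 2 * ((1 + e^-1) * qform j (f x) o) <= s * qform i x v.
  have e'0 : 0 <= 1 + e^-1 by rewrite addr_ge0// invr_ge0 ltW.
  apply: (@le_trans _ _ (C * ((1 + e^-1) * (K2 * (2 * m%:R * eta) ^+ 2 * (qform i x v / k1))))).
    apply: ler_pM => //; first by rewrite mulr_ge0// qform_ge0.
    rewrite ler_wpM2l//; apply: le_trans q3 _; rewrite exprMn [leLHS]mulrA.
    by apply: ler_wpM2l => //; rewrite mulr_ge0 ?sqr_ge0// ltW.
  have -> : C * ((1 + e^-1) * (K2 * (2 * m%:R * eta) ^+ 2 * (qform i x v / k1))) =
    D * eta ^+ 2 * qform i x v by rewrite /D; ring.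
  by rewrite ler_wpM2r.
have q6 : qform i x v <= ainv x ^+ 2 * ((1 + e) * qform j (f x) w) + s * qform i x v.
  apply: le_trans q1 _; rewrite vJ; apply: le_trans (ler_wpM2l a20 q2) _.
  by rewrite mulrDr lerD2l.
have {}q6 : (1 - s) * qform i x v <= ainv x ^+ 2 * ((1 + e) * qform j (f x) w).
  by rewrite mulrBl mul1r; lra.
have s1 : 1 - s = (1 + E) / (2 * E) by rewrite /s; field; rewrite gt_eqF.
have s1pos : 0 < 1 - s by rewrite s1 divr_gt0// ?mulr_gt0//; lra.
rewrite -(ler_pM2l s1pos); apply: le_trans q6 _.
rewrite s1 le_eqVlt; apply/orP; left; apply/eqP; rewrite /e; field; rewrite gt_eqF//.
Unshelve. all: by end_near. Qed.

End expansion.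

End hyperbolicity.

(** * Uniform estimates through finitely many charts *)

Section uniform_charts.
Context {R : realType} {m : nat} {M : metricType R} (A : riemannian m M).
Hypothesis cM : compact [set: M].
Implicit Types (x y p : M).

Lemma near_seq_all (T : Type) (I : eqType) (s : seq I) (F : set_system T) (P : I -> set T) :
  Filter F -> (forall i, i \in s -> F (P i)) -> F [set x | forall i, i \in s -> P i x].
Proof.
move=> FF; elim: s => [_|i s IH h]; first by apply: filterE => x.
have Fi : F (P i) by apply: h; rewrite mem_head.
have Fs : F [set x | forall i, i \in s -> P i x].
  by apply: IH => k ks; apply: h; rewrite inE ks orbT.
apply: filterS2 Fi Fs => x Pi Ps k; rewrite inE => /orP[/eqP ->//|]; exact: Ps.
Qed.

(** [d] is a Lebesgue number of the cover by the neighborhoods [V]. *)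
Lemma lebesgue_pairs (S : M -> M -> Prop) :
  (forall x0, exists2 V, nbhs x0 V & forall x p, V x -> V p -> S x p) ->
  exists2 d : R, 0 < d & forall x p, mdist x p < d -> S x p.
Proof.
move=> loc.
have := proj1 (compact_near_coveringP _) cM R (0 : R)^'+
  (fun d x => forall p, mdist x p < d -> S x p) _.
case; last first.
  move=> r /= r0 rP; exists (r / 2); first lra.
  move=> x p xp; apply: (rP (r / 2)) xp => //=; last lra.
  by rewrite sub0r normrN gtr0_norm; lra.
move=> x0 _; have [V /nbhs_mdistP[r r0 rV] VS] := loc x0.
near=> x d => /= p xp.
have dr : d < r / 2 by near: d; apply: nbhs_right_lt; lra.
have xr : mdist x0 x < r / 2 by near: x; apply: near_mdist_lt; lra.
by apply: VS; apply: rV; have := metric_triangle x0 x p; lra.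
Unshelve. all: by end_near. Qed.

(** [chart_at] may use infinitely many charts, and local constants would then have no uniform
    version. The map [z] selects one of finitely many charts, containing a ball of fixed radius
    around the point. *)
Lemma finite_charts : exists (s : seq M) (z : M -> M) (rho : R),
  [/\ 0 < rho, forall x, z x \in s &
    forall x y, mdist x y < rho -> dom (chart_at A (z x)) y].
Proof.
have /choice[r rP] : forall x, exists r : R, 0 < r /\
    forall y, mdist x y < r + r -> dom (chart_at A x) y.
  move=> x; have /nbhs_mdistP[r r0 rP] := near_dom (dom_chart_at A x).
  exists (r / 2); split; first lra.
  by move=> y xy; apply: rP; lra.
have [s sP] := compact_finite_net cM (fun x => near_mdist_lt x (rP x).1).
have /choice[z zP] : forall x, exists c, c \in s /\ mdist c x < r c.
  by move=> x; have [c cs cx] := sP x; exists c.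
have [rho rho0 rhos] : exists2 rho : R, 0 < rho & forall c, c \in s -> rho <= r c.
  elim: s {sP z zP} => [|c s [rho rho0 rhos]]; first by exists 1.
  exists (Num.min rho (r c)); first by rewrite lt_min rho0 (rP c).1.
  move=> c'; rewrite inE => /orP[/eqP ->|/rhos]; rewrite ge_min ?lexx ?orbT//.
  by move=> ->.
exists s, z, rho; split=> // [x|x y xy]; first exact: (zP x).1.
apply: (rP (z x)).2; have [zs zx] := zP x.
by have := rhos _ zs; have := metric_triangle (z x) x y; lra.
Qed.

Section quasi_distance.
Variables (s : seq M) (z : M -> M) (rho : R).
Hypothesis rho0 : 0 < rho.
Hypothesis zs : forall x, z x \in s.
Hypothesis zdom : forall x y, mdist x y < rho -> dom (chart_at A (z x)) y.

(* A substitute for the squared Riemannian distance: for [p] close to [x], the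
   squared length of [p - x] in a chart around [x], for the scalar product at [x]. *)
Definition qdist x p : R :=
  let i := chart_at A (z x) in qform i x (crd i p - crd i x).

Let dom_z x : dom (chart_at A (z x)) x.
Proof. by apply: zdom; rewrite mdistxx. Qed.

Lemma qdist_ge0 x p : 0 <= qdist x p.
Proof. exact: qform_ge0. Qed.

Let near_zdom x0 : \forall x \near x0, dom (chart_at A (z x)) x0.
Proof.
have := near_mdist_lt x0 rho0; apply: filterS => x xx0.
by apply: zdom; rewrite metric_sym.
Qed.

Lemma qdist_expansion (f : M -> M) (E : R) : local_diffeo A f -> C1_on A [set: M] f ->
  1 < E -> exists2 d : R, 0 < d & forall x p, mdist x p < d ->
    qdist x p <= E * tangent_inv_norm A f x ^+ 2 * qdist (f x) (f p).
Proof.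
move=> lf C1f E1; apply: lebesgue_pairs => x0.
have cf := C1f.1 x0 Logic.I.
have /choice[U UP] : forall c : M * M, exists U, nbhs x0 U /\
    (dom (chart_at A c.1) x0 -> dom (chart_at A c.2) (f x0) -> forall x p, U x -> U p ->
      qform (chart_at A c.1) x (crd (chart_at A c.1) p - crd (chart_at A c.1) x) <=
      E * tangent_inv_norm A f x ^+ 2 * qform (chart_at A c.2) (f x)
        (crd (chart_at A c.2) (f p) - crd (chart_at A c.2) (f x))).
  move=> c; have [[d1 d2]|nd] := pselect (dom (chart_at A c.1) x0 /\
    dom (chart_at A c.2) (f x0)); last first.
    by exists setT; split; [exact: filterT|move=> d1 d2; exfalso; exact: nd].
  by have [U nU UP] := expansion_near lf C1f E1 d1 d2; exists U; split.
(* The charts selected at [x] and [f x] may change with [x] near [x0], but only within this finite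
   list, over which the neighborhoods are intersected. *)
pose cs := [seq (c1, c2) | c1 <- s, c2 <- s].
exists [set x | [/\ forall c, c \in cs -> U c x, dom (chart_at A (z x)) x0 &
    dom (chart_at A (z (f x))) (f x0)]].
  near=> x; split; near: x.
  - by apply: near_seq_all => c _; exact: (UP c).1.
  - exact: near_zdom.
  - exact: (cf _ (near_zdom (f x0))).
move=> x p [Ux d1 d2] [Up _ _].
have inc : (z x, z (f x)) \in cs by apply/allpairsP; exists (z x, z (f x)); split=> //=; exact: zs.
exact: ((UP (z x, z (f x))).2 d1 d2 x p (Ux _ inc) (Up _ inc)).
Unshelve. all: by end_near. Qed.

Lemma qdist_small (theta : R) : 0 < theta ->
  exists2 r : R, 0 < r & forall x p, mdist x p < r -> qdist x p < theta.
Proof.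
move=> theta0; apply: lebesgue_pairs => x0.
have /choice[U UP] : forall c, exists U, nbhs x0 U /\
    (dom (chart_at A c) x0 -> forall x p, U x -> U p ->
      qform (chart_at A c) x (crd (chart_at A c) p - crd (chart_at A c) x) < theta).
  move=> c; set i := chart_at A c.
  have [ix0|nd] := pselect (dom i x0); last first.
    by exists setT; split; first exact: filterT.
  have [k [K [k0 K0 b]]] := qform_bounds ix0.
  (* Two points of the ball differ by at most [2 * e] in the chart, and
     [K * (2 * e) ^+ 2 <= theta / 2] because [e ^+ 2 <= e]. *)
  pose e := Num.min 1 (theta / (8 * K)).
  have e0 : 0 < e by rewrite lt_min ltr01 divr_gt0// mulr_gt0.
  exists [set x | ball (crd i x0) e (crd i x) /\
    forall v, k * `|v| ^+ 2 <= qform i x v <= K * `|v| ^+ 2]; split.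
    near=> x; split; near: x => //.
    by apply: (near_crd ix0); exact: nbhsx_ballx.
  move=> _ x p [xe bx] [pe _]; have /andP[_ h] := bx (crd i p - crd i x).
  apply: le_lt_trans h _; set v := crd i p - crd i x.
  have v2e : `|v| <= 2 * e.
    have -> : v = (crd i x0 - crd i x) - (crd i x0 - crd i p).
      by rewrite /v opprB [RHS]addrC addrA subrK.
    apply: le_trans (ler_normB _ _) _.
    by move: xe pe; rewrite -!ball_normE /=; lra.
  have e1 : e <= 1 by rewrite ge_min lexx.
  have e2 : e <= theta / (8 * K) by rewrite ge_min lexx orbT.
  apply: (@le_lt_trans _ _ (K * (2 * e) ^+ 2)).
    rewrite ler_pM2l//; apply: lerXn2r; rewrite ?nnegrE// mulr_ge0//; exact: ltW.
  have ee : e ^+ 2 <= theta / (8 * K).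
    by apply: le_trans e2; rewrite expr2 ler_piMl// ltW.
  have : K * (4 * e ^+ 2) <= K * (4 * (theta / (8 * K))).
    by rewrite ler_pM2l// ler_pM2l.
  have -> : K * (4 * (theta / (8 * K))) = theta / 2 by field; rewrite gt_eqF.
  by rewrite exprMn -[2 ^+ 2]/(2 * 2); lra.
exists [set x | (forall c, c \in s -> U c x) /\ dom (chart_at A (z x)) x0].
  near=> x; split; near: x; last exact: near_zdom.
  by apply: near_seq_all => c _; exact: (UP c).1.
move=> x p [Ux d1] [Up _].
exact: ((UP (z x)).2 d1 x p (Ux _ (zs x)) (Up _ (zs x))).
Unshelve. all: by end_near. Qed.

(** Compactness of the set of pairs, with three cases for [(x0, p0)]: closer than [d1], where
    nothing is left to prove; at least [rho] apart, which nearby pairs within [rho / 2] exclude;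
    otherwise a common chart in which the coordinates differ, so that [qdist] is bounded below
    nearby. *)
Lemma qdist_separates (d1 : R) : 0 < d1 -> exists2 theta : R, 0 < theta &
  forall x p, mdist x p < rho / 2 -> qdist x p < theta -> mdist x p < d1.
Proof.
move=> d10.
have := proj1 (compact_near_coveringP _) (compact_setX cM cM) R (0 : R)^'+
  (fun theta xp => mdist xp.1 xp.2 < rho / 2 -> qdist xp.1 xp.2 < theta ->
    mdist xp.1 xp.2 < d1) _.
rewrite setXTT; case; last first.
  move=> r /= r0 rP; exists (r / 2); first lra.
  move=> x p; apply: (rP (r / 2) _ _ (x, p)) => //=; last lra.
  by rewrite sub0r normrN gtr0_norm; lra.
move=> [x0 p0] _.
suff [U [W [theta [nU nW theta0 UW]]]] : exists U W (theta : R), [/\ nbhs x0 U, nbhs p0 W,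
    0 < theta & forall x p, U x -> W p -> mdist x p < rho / 2 -> qdist x p < theta ->
    mdist x p < d1].
  exists (U `*` W, [set t : R | t < theta]).
    by split; [exists (U, W)|exact: nbhs_right_lt].
  move=> [[x p] t] /= [[Ux Wp] tt] xp qt; apply: UW => //; exact: lt_trans tt.
have [small|big] := ltP (mdist x0 p0) d1.
  pose e := (d1 - mdist x0 p0) / 2.
  have e0 : 0 < e by rewrite /e; lra.
  exists [set x | mdist x0 x < e], [set p | mdist p0 p < e], 1; split=> //.
  - exact: near_mdist_lt.
  - exact: near_mdist_lt.
  move=> x p /= xe pe _ _; have := metric_triangle x x0 p; have := metric_triangle x0 p0 p.
  by rewrite (metric_sym x x0) /e in xe pe *; lra.
have [far|near_] := leP rho (mdist x0 p0).
  exists [set x | mdist x0 x < rho / 4], [set p | mdist p0 p < rho / 4], 1; split=> //.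
  - by apply: near_mdist_lt; rewrite divr_gt0.
  - by apply: near_mdist_lt; rewrite divr_gt0.
  move=> x p /= xe pe xp _; exfalso.
  have := metric_triangle x0 x p0; have := metric_triangle x p p0.
  by rewrite (metric_sym p p0); lra.
have /choice[B BP] : forall c, exists B : set M * set M * R,
    [/\ nbhs x0 B.1.1, nbhs p0 B.1.2, 0 < B.2 & dom (chart_at A c) x0 ->
    dom (chart_at A c) p0 -> forall x p, B.1.1 x -> B.1.2 p ->
      B.2 <= qform (chart_at A c) x (crd (chart_at A c) p - crd (chart_at A c) x)].
  move=> c; set i := chart_at A c.
  have [[ix0 ip0]|nd] := pselect (dom i x0 /\ dom i p0); last first.
    exists (setT, setT, 1) => /=; split=> //; try exact: filterT.
    by move=> d1' d2; exfalso; exact: nd.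
  have [k [K [k0 K0 b]]] := qform_bounds ix0.
  pose e := `|crd i p0 - crd i x0|.
  have e0 : 0 < e.
    rewrite normr_gt0 subr_eq0; apply/eqP => E; move: big.
    by rewrite -(crdK ix0) -E crdK// mdistxx leNgt d10.
  exists ([set x | ball (crd i x0) (e / 4) (crd i x) /\
    forall v, k * `|v| ^+ 2 <= qform i x v <= K * `|v| ^+ 2],
    [set p | ball (crd i p0) (e / 4) (crd i p)], k * (e / 2) ^+ 2) => /=; split.
  - near=> x; split; near: x => //.
    by apply: (near_crd ix0); apply: nbhsx_ballx; rewrite divr_gt0.
  - by apply: (near_crd ip0); apply: nbhsx_ballx; rewrite divr_gt0.
  - by rewrite mulr_gt0// exprn_gt0// divr_gt0.
  move=> _ _ x p [xe bx] pe; have /andP[h _] := bx (crd i p - crd i x).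
  have e20 : 0 <= e / 2 by rewrite divr_ge0// ltW.
  apply: le_trans h; rewrite ler_pM2l//; apply: lerXn2r; rewrite ?nnegrE//.
  have : e <= `|crd i p0 - crd i p| + `|crd i p - crd i x| + `|crd i x0 - crd i x|.
    have -> : e = `|(crd i p0 - crd i p) + (crd i p - crd i x) - (crd i x0 - crd i x)|.
      by rewrite /e addrA subrK opprB addrA subrK.
    apply: le_trans (ler_normB _ _) _; rewrite lerD2r; exact: ler_normD.
  by move: xe pe; rewrite -!ball_normE /=; lra.
(* For [x] within [gap] of [x0], both [x0] and [p0] lie within [rho] of [x], hence in the chart
   selected at [x]. *)
pose gap := rho - mdist x0 p0.
have [theta theta0 thetas] : exists2 t : R, 0 < t & forall c, c \in s -> t <= (B c).2.
  elim: s => [|c r [t t0 ts]]; first by exists 1.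
  have [_ _ Bc _] := BP c.
  exists (Num.min t (B c).2); first by rewrite lt_min t0.
  move=> c'; rewrite inE => /orP[/eqP ->|/ts]; rewrite ge_min ?lexx ?orbT//.
  by move=> ->.
exists [set x | (forall c, c \in s -> (B c).1.1 x) /\ mdist x0 x < gap],
  [set p | forall c, c \in s -> (B c).1.2 p], theta; split=> //.
- near=> x; split; near: x.
    by apply: near_seq_all => c _; have [] := BP c.
  by apply: near_mdist_lt; rewrite /gap subr_gt0.
- by apply: near_seq_all => c _; have [] := BP c.
move=> x p [Bx xe] Bp _; rewrite ltNge => /negP[].
have [_ _ _ h] := BP (z x); apply: le_trans (thetas _ (zs x)) _; apply: h.
- by apply: zdom; rewrite metric_sym; move: xe (mdist_ge0 x0 p0); rewrite /gap; lra.
- apply: zdom; have := metric_triangle x x0 p0; rewrite (metric_sym x x0).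
  by move: xe; rewrite /gap; lra.
- exact: Bx.
- exact: Bp.
Unshelve. all: by end_near. Qed.

End quasi_distance.
End uniform_charts.

(** * Hyperbolic times *)

Lemma local_diffeo_inj_scale {R : realType} {m : nat} {M : metricType R}
    (A : riemannian m M) (f : M -> M) : compact [set: M] -> local_diffeo A f ->
  exists2 d : R, 0 < d & inj_scale d f.
Proof.
move=> cM lf.
have [x|d d0 dP] := @near_inj_scale _ _ cM unit (principal_filter tt) (fun=> f) _.
  have [U nU UP] := local_diffeo_locally_injective x lf.
  by exists U => // _ _; exact: UP.
by exists d => //; exact: (dP tt).
Qed.

Section Sigma_hyperbolic.
Context {R : realType} {m : nat} {M : metricType R} (A : riemannian m M).
Hypothesis cM : compact [set: M].
Variable f : M -> M.
Hypothesis lf : local_diffeo A f.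
Hypothesis C1f : C1_on A [set: M] f.
Variable c : R.
Hypothesis c0 : 0 < c.

Let ainv := tangent_inv_norm A f.

(** The factor [expR c] is the loss [E] of [qdist_expansion]. The square doubles the exponential
    rate, so that a decay of the norms at a rate above [c / 2] compensates it. *)
Lemma Sigma_expansion x : Sigma A c f x -> forall e : R, 0 < e ->
  exists n, \prod_(0 <= j < n) (expR c * ainv (iter j f x) ^+ 2) < e.
Proof.
move=> Sx e e0; case: (posnP m) => [m0|m0].
  exists 1%N; rewrite big_nat1 /ainv tangent_inv_norm_dim0// expr0n mulr0//.
have a0 y : 0 < ainv y by exact: tangent_inv_norm_pos.
(* With the rate [3/4 c] the product up to time [n] is below
   [exp (c n - 3/2 c n) = exp (- c n / 2)]. *)
have lt34 : ((- c)%:E < (- (c * (3 / 4)))%:E)%E by rewrite lte_fin; have := c0; lra.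
have /ereal_inf_ltP[_ [V [N _ NV] <-]] := le_lt_trans Sx lt34.
move=> supV.
pose n := maxn N.+1 (Num.truncn (2 / (c * e))).+1.
have n0 : (0 : R) < n%:R by rewrite ltr0n leq_max.
have Vn : V n by apply: NV => /=; rewrite leq_max leqnSn.
have un := le_lt_trans (ereal_sup_ubound (ex_intro2 _ _ n Vn erefl)) supV.
have sum_ln : \sum_(j < n) ln (ainv (iter j f x)) < - (c * (3 / 4)) * n%:R.
  move: un; rewrite (eq_bigr (fun j : 'I_n => (ln (ainv (iter j f x)))%:E)); last first.
    by move=> j _; rewrite lne_EFin.
  by rewrite sumEFin -EFinM lte_fin mulrC ltr_pdivrMr.
exists n; rewrite big_mkord.
have -> : \prod_(j < n) (expR c * ainv (iter j f x) ^+ 2) =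
    expR (\sum_(j < n) (c + 2 * ln (ainv (iter j f x)))).
  rewrite expR_sum; apply: eq_bigr => j _; rewrite expRD; congr (_ * _).
  by rewrite mulr2n mulrDl !mul1r expRD lnK ?posrE// expr2.
rewrite big_split/= -mulr_sumr sumr_const card_ord.
rewrite -[e]invrK -[e^-1]lnK ?posrE ?invr_gt0// -expRN ltr_expR.
have h : ln e^-1 <= c / 2 * n%:R.
  rewrite -ler_expR lnK ?posrE ?invr_gt0//; apply: le_trans (expR_ge1Dx _).
  apply: (@le_trans _ _ (c / 2 * n%:R)); last by rewrite lerDr.
  have : 2 / (c * e) <= n%:R.
    apply: le_trans (ltW (truncnS_gt _)) _; by rewrite ler_nat leq_maxr.
  rewrite ler_pdivrMr ?mulr_gt0// => h.
  by rewrite -[e^-1]mul1r ler_pdivrMr//; lra.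
have cn : 0 < c * n%:R by rewrite mulr_gt0.
by rewrite -[c *+ _]mulr_natl; lra.
Qed.

(** [expanding_lift] applied to [qdist] at the record times of the products of [expR c * ainv ^+ 2].
    The scales are fixed before the point [x], so that the radius is uniform. *)
Lemma Sigma_liftable_often : liftable_often f (Sigma A c f).
Proof.
move=> d d0.
have [s [z [rho [rho0 zs zdom]]]] := finite_charts A cM.
have cf := local_diffeo_continuous lf.
have [dE dE0 expand] : exists2 d : R, 0 < d & forall x p, mdist x p < d ->
    qdist A z x p <= expR c * ainv x ^+ 2 * qdist A z (f x) (f p).
  by apply: (qdist_expansion cM rho0 zs zdom lf C1f); rewrite expR_gt1.
pose dl := Num.min d (Num.min dE (rho / 2)).
have dl0 : 0 < dl by rewrite !lt_min d0 dE0 divr_gt0.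
have dld : dl <= d by rewrite ge_min lexx.
have dldE : dl <= dE by rewrite !ge_min lexx orbT.
have dlrho : dl <= rho / 2 by rewrite !ge_min lexx !orbT.
have injf := local_diffeo_inj_scale cM lf.
have [e e0 lift] := preimage_lift cM (manifold_loc_connected A) cf injf dl0.
have {}lift x p : mdist (f x) p < e -> exists2 p', mdist x p' < dl & f p' = p.
  by apply: lift => //; [exact: local_diffeo_open_map|move=> y; rewrite mdistxx].
pose d1 := Num.min dl e.
have d10 : 0 < d1 by rewrite lt_min dl0.
have d1dl : d1 <= dl by rewrite ge_min lexx.
have d1e : d1 <= e by rewrite ge_min lexx orbT.
have [theta theta0 sep] := qdist_separates cM rho0 zs zdom d10.
have [r r0 small] := qdist_small cM rho0 zs zdom theta0.
exists (Num.min r d1); first by rewrite lt_min r0.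
move=> x Sx L.
pose t y := expR c * ainv y ^+ 2.
have t0 y : 0 <= t y by rewrite mulr_ge0 ?expR_ge0 ?sqr_ge0.
have [||n Ln prod1] := @record_minima R (fun j => t (iter j f x)) _ _ L.
- case: (posnP m) => [m0|m0]; [right|left] => j.
    by rewrite /t /ainv tangent_inv_norm_dim0// expr0n mulr0.
  by rewrite mulr_gt0 ?expR_gt0// exprn_gt0//; exact: tangent_inv_norm_pos.
- exact: Sigma_expansion.
exists n => // p; rewrite lt_min => /andP[pr pd1].
have Q0 y q : 0 <= qdist A z y q by exact: (qdist_ge0 rho0 zdom).
have lift1 y q : mdist (f y) q < d1 -> exists2 q', mdist y q' < dl & f q' = q.
  by move=> yq; apply: lift; exact: lt_le_trans d1e.
have exp1 y q : mdist y q < dl -> qdist A z y q <= t y * qdist A z (f y) (f q).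
  by move=> yq; apply: expand; exact: lt_le_trans dldE.
have sep1 y q : mdist y q < dl -> qdist A z y q < theta -> mdist y q < d1.
  by move=> yq; apply: sep; exact: lt_le_trans dlrho.
have [p' p'E xp'] := expanding_lift d1dl Q0 t0 lift1 exp1 sep1 prod1 pd1 (small _ _ pr).
exists p' => // j jn; exact: lt_le_trans (xp' j jn) dld.
Qed.

End Sigma_hyperbolic.

(** * Consequences of closeness in the C^1 topology *)

Section C1_neighbors.
Context {R : realType} {m : nat} {M : metricType R} (A : riemannian m M).
Hypothesis cM : compact [set: M].
Implicit Types (f g : C1map A).

Lemma C1_nbhd_nbhs f (i j : chart A) (K : set M) (e : R) : compact K -> K `<=` dom i ->
  f @` K `<=` dom j -> 0 < e -> nbhs f (C1_nbhd f i j K e).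
Proof.
move=> cK Ki fK e0; apply: open_nbhs_nbhs; split.
  exists [set C1_nbhd f i j K e]; last by rewrite bigcup_set1.
  move=> _ ->; apply: finI_from1; exists f, i, j, K, e; split=> //.
by split=> // x Kx u; rewrite !subrr !normr0.
Qed.

Let compact_mdist_le (x : M) (r : R) : compact [set y | mdist x y <= r].
Proof. by apply: subclosed_compact cM _ => //; exact: closed_mdist_le. Qed.

Lemma C1_near_uniform f (eta : R) : 0 < eta ->
  \forall g \near f, forall x, mdist (f x) (C1fun g x) < eta.
Proof.
move=> eta0.
suff : \forall g \near f, [set: M] `<=` (fun x => mdist (f x) (C1fun g x) < eta).
  by apply: filterS => g gP x; exact: gP.
have := proj1 (compact_near_coveringP _) cM (C1map A) (nbhs f)
  (fun (g : C1map A) x => mdist (f x) (g x) < eta) _; apply.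
move=> x0 _; set i := chart_at A x0; set j := chart_at A (f x0).
have ix0 : dom i x0 by exact: dom_chart_at.
have jfx0 : dom j (f x0) by exact: dom_chart_at.
have cf : {for x0, continuous f} by apply: (C1funP f).1.
have eta20 : 0 < eta / 2 by rewrite divr_gt0.
have /nbhs_ballP[e /= e0 eP] := near_par jfx0 (near_mdist_lt (f x0) eta20).
have e20 : 0 < e / 2 by rewrite divr_gt0.
have /nbhs_mdistP[r r0 rP] : \forall x \near x0, [/\ dom i x, dom j (f x),
    ball (crd j (f x0)) (e / 2) (crd j (f x)) & mdist (f x0) (f x) < eta / 2].
  near=> x; split; near: x.
  - exact: near_dom.
  - exact: (cf _ (near_dom jfx0)).
  - exact: (cf _ (near_crd jfx0 (nbhsx_ballx _ _ e20))).
  - exact: (cf _ (near_mdist_lt _ eta20)).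
have r20 : 0 < r / 2 by rewrite divr_gt0.
have KP x : mdist x0 x <= r / 2 -> mdist x0 x < r by move=> h; lra.
exists ([set x | mdist x0 x < r / 2],
    C1_nbhd f i j [set x | mdist x0 x <= r / 2] (e / 2)) => /=.
  split; first exact: near_mdist_lt.
  apply: C1_nbhd_nbhs => //.
    by move=> x /= /KP/rP[].
  by move=> _ [x /= /KP/rP[_ jfx _ _] <-].
move=> [x g] /= [xr [gK gP]].
have /= [gx _] := gP x (ltW xr).
have jgx : dom j (g x) by apply: gK; exists x => //=; exact: ltW.
have [_ _ fxe fx] := rP x (KP _ (ltW xr)).
have : mdist (f x0) (g x) < eta / 2.
  rewrite -(crdK jgx); apply: eP.
  move: fxe; rewrite -!ball_normE /= => fxe.
  have -> : crd j (f x0) - crd j (g x) =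
    (crd j (f x0) - crd j (f x)) - (crd j (g x) - crd j (f x)).
    by rewrite opprB addrA subrK.
  by apply: le_lt_trans (ler_normB _ _) _; lra.
by have := metric_triangle (f x) (f x0) (g x); rewrite (metric_sym (f x) (f x0)); lra.
Unshelve. all: by end_near. Qed.

(** In a chart ball, the derivatives of a nearby [g] stay close to one invertible matrix, so that by
    the mean value inequality [g] is injective there. The ball depends on [f] only. *)
Lemma C1_near_inj_scale f : local_diffeo A f ->
  exists2 d : R, 0 < d & \forall g \near f, inj_scale d (C1fun g).
Proof.
move=> lf; refine (@near_inj_scale R M cM (C1map A) (nbhs f) (fun g => C1fun g) _ _) => y0.
set i := chart_at A y0; set j := chart_at A (f y0).
have iy0 : dom i y0 by exact: dom_chart_at.
have jfy0 : dom j (f y0) by exact: dom_chart_at.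
have C1f := C1funP f.
have cf : {for y0, continuous f} by apply: C1f.1.
have [k k0 kP] := unitmx_norm_ge (Jac_unit lf iy0 jfy0).
set J0 := Jac i j f y0 in kP.
(* The Jacobians of [g] are within [e + e] of [J0]: one [e] for [g] against [f], one for the
   variation of [f]. Equal images then force the norm of [v] to be at most half of itself. *)
pose e := (4 * k * (m%:R + 1))^-1.
have m1 : 0 < m%:R + 1 :> R by rewrite ltr_wpDl.
have e0 : 0 < e by rewrite invr_gt0 !mulr_gt0.
have /nbhs_mdistP[r r0 rP] : \forall y \near y0, dom i y /\ dom j (f y).
  by near=> y; split; near: y; [exact: near_dom|exact: (cf _ (near_dom jfy0))].
have r20 : 0 < r / 2 by rewrite divr_gt0.
have KP x : mdist y0 x <= r / 2 -> mdist y0 x < r by move=> h; lra.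
have /nbhs_ballP[s /= s0 sP] : \forall u \near crd i y0,
    [/\ mdist y0 (par i u) <= r / 2, dom i (par i u), crd i (par i u) = u &
    `|'J (rep i j f) u - J0| < e].
  near=> u.
  have [iu uE] : dom i (par i u) /\ crd i (par i u) = u by near: u; exact: near_chart.
  split=> //.
    apply: ltW; near: u; apply: (near_par (P := fun y => mdist y0 y < r / 2)) => //.
    exact: near_mdist_lt.
  have : differentiable (rep i j f) u /\ `|'J (rep i j f) u - J0| < e.
    by near: u; exact: (rep_jacobian_continuous openT Logic.I C1f).
  by case.
exists [set y | dom i y /\ ball (crd i y0) s (crd i y)].
  near=> y; split; near: y; first exact: near_dom.
  by apply: (near_crd iy0); exact: nbhsx_ballx.
have := @C1_nbhd_nbhs f i j [set x | mdist y0 x <= r / 2] e (@compact_mdist_le y0 (r / 2)) _ _ e0.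
have h1 : [set x | mdist y0 x <= r / 2] `<=` dom i by move=> x /= /KP/rP[].
have h2 : [set f x | x in [set x | mdist y0 x <= r / 2]] `<=` dom j.
  by move=> _ [x /= /KP/rP[_ +] <-].
move=> /(_ h1 h2); apply: filterS => g [gK gP] y1 y2 [iy1 y1s] [iy2 y2s] g12.
have bound u : `|u - crd i y0| < s ->
    differentiable (rep i j g) u /\ `|'J (rep i j g) u - J0| <= e + e.
  move=> us; have [Ku iu uE Ju] : [/\ mdist y0 (par i u) <= r / 2, dom i (par i u),
      crd i (par i u) = u & `|'J (rep i j f) u - J0| < e].
    by apply: sP; rewrite -ball_normE /= distrC.
  have jgu : dom j (g (par i u)) by apply: gK; exists (par i u).
  split.
    have := rep_differentiable openT Logic.I (C1funP g) iu jgu.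
    by rewrite uE.
  have /= [_] := gP (par i u) Ku; rewrite uE => gu.
  have -> : 'J (rep i j g) u - J0 =
    ('J (rep i j g) u - 'J (rep i j f) u) + ('J (rep i j f) u - J0).
    by rewrite addrA subrK.
  apply: le_trans (ler_normD _ _) _; apply: lerD; exact: ltW.
have ball1 : `|crd i y1 - crd i y0| < s by move: y1s; rewrite -ball_normE /= distrC.
have ball2 : `|crd i y2 - crd i y0| < s by move: y2s; rewrite -ball_normE /= distrC.
have := mean_value_jacobian bound ball1 ball2.
rewrite !rep_at// g12 subrr sub0r normrN => mv.
set v := crd i y2 - crd i y1 in mv.
have v0 : v = 0.
  apply/eqP; rewrite -normr_le0.
  have h3 : k * `|v *m J0| <= k * (m%:R * (e + e) * `|v|) by rewrite ler_pM2l.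
  have h4 : k * (m%:R * (e + e) * `|v|) <= `|v| / 2.
    have -> : k * (m%:R * (e + e) * `|v|) = (m%:R / (m%:R + 1)) * (`|v| / 2).
      by rewrite /e; field; rewrite !gt_eqF.
    by rewrite ler_piMl ?divr_ge0// ler_pdivrMr// mul1r lerDl.
  by have := kP v; lra.
by rewrite -(crdK iy1) -(crdK iy2); congr par; apply/esym/eqP; rewrite -subr_eq0; apply/eqP.
Unshelve. all: by end_near. Qed.

End C1_neighbors.

(** * Perturbations *)

Section growth_rates.
Context {R : realType} {M : metricType R}.
Implicit Types (f : M -> M) (psi : M -> R).

Lemma growth_rate_le f psi (beta gamma : R) n k (x : M) : (0 < n)%N -> (0 < k)%N ->
  preim_sums_ge f psi n (expR (beta * n%:R)) ->
  preim_sums_le f psi k (expR (gamma * k%:R)) -> beta <= gamma.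
Proof.
move=> n0 k0 ge1 le1.
have ge_ := @preim_sums_geX _ _ _ _ n _ k (expR_ge0 _) ge1.
have := @preim_sums_leX _ _ _ _ k _ n (expR_ge0 _) le1; rewrite mulnC => le_.
 have := preim_sums_ge_le x ge_ le_.
rewrite -!expRM_natr ler_expR -!mulrA [_%:R * _%:R]mulrC ler_pM2r// mulr_gt0// ltr0n//.
Qed.

(** The lower bound is raised to a power [k] so large that the factor [D] is beaten by the
    difference of the rates. *)
Lemma growth_rate_le_mul f psi (beta gamma D : R) n (x : M) : (0 < n)%N ->
  preim_sums_ge f psi n (expR (beta * n%:R)) ->
  (forall k, preim_sums_le f psi k (D * expR (gamma * k%:R))) -> beta <= gamma.
Proof.
move=> n0 ge_ le_; rewrite leNgt; apply/negP => gb.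
pose k := (Num.truncn (D / (beta - gamma))).+1.
have bg : 0 < beta - gamma by rewrite subr_gt0.
have kD : D < (beta - gamma) * k%:R.
  by rewrite mulrC -ltr_pdivrMr//; exact: truncnS_gt.
have := preim_sums_ge_le x (@preim_sums_geX _ _ _ _ n _ k (expR_ge0 _) ge_) (le_ (k * n)%N).
rewrite -expRM_natr -ler_pdivrMr ?expR_gt0// -expRN -expRD leNgt.
apply/negP/negPn; apply: lt_le_trans (expR_ge1Dx _).
have -> : beta * n%:R * k%:R - gamma * (k * n)%:R = (beta - gamma) * k%:R * n%:R.
  by rewrite natrM; ring.
apply: (lt_le_trans kD); rewrite ler_wpDl// ler_peMr ?mulr_ge0 ?(ltW bg)// ler1n//.
Qed.

End growth_rates.

Section Gc_growth.
Context {R : realType} {m : nat} {M N : metricType R} (A : riemannian m M).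
Hypothesis cM : compact [set: M].
Hypothesis cN : compact [set: N].
Variables (Fam : set (C1map A)) (a c : R).
Hypothesis Fam_diffeo : forall f : C1map A, Fam f -> local_diffeo A f.
Hypothesis c0 : 0 < c.
Implicit Types (F : skew_data A N) (Fphi : skew_data A N * holder (M * N)%type a).

Definition fiber F : M * N -> N := F.2.

Definition slice (y0 : N) (phi : M * N -> R) (x : M) : R := phi (x, y0).

(** On an empty base the two relative pressures would be those of the same set, against the strict
    inequality. *)
Lemma Gc_nonempty Fphi : Gc Fam c Fphi -> [set: M] !=set0.
Proof.
move=> [_ [_ lt_ _] _]; apply: contrapT => noM.
move: lt_; rewrite (_ : _ `*` _ = Sigma A c (base Fphi.1) `*` [set: N]) ?ltxx//.
by apply/seteqP; split=> -[x y]; exfalso; apply: noM; exists x.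
Qed.

Lemma Gc_pressure_lt Fphi y0 (gamma : R) : Gc Fam c Fphi ->
  (forall x, fiber Fphi.1 (x, y0) = y0) ->
  (pressure (skew_map Fphi.1) Fphi.2 < gamma%:E)%E ->
  exists2 D, 0 <= D & forall n,
    preim_sums_le (base Fphi.1) (slice y0 Fphi.2) n (D * expR (gamma * n%:R)).
Proof.
move=> [[/Fam_diffeo lf cg [lam [lam01 glam]] _] [cphi _ _] _] gy0 Pg.
have [d d0 /nbhs_singleton inj] := C1_near_inj_scale cM lf.
by apply: (@pressure_lt_growth _ _ _ (base Fphi.1) (fiber Fphi.1) y0 Fphi.2 cM cN
  (local_diffeo_continuous lf) cg gy0 cphi d gamma d0 inj Pg).
Qed.

Lemma Gc_lt_pressure Fphi y0 (gamma : R) : Gc Fam c Fphi ->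
  (forall x, fiber Fphi.1 (x, y0) = y0) ->
  (gamma%:E < pressure (skew_map Fphi.1) Fphi.2)%E ->
  exists2 n, (0 < n)%N &
    preim_sums_ge (base Fphi.1) (slice y0 Fphi.2) n (expR (gamma * n%:R)).
Proof.
move=> [[/Fam_diffeo lf cg [lam [lam01 glam]] _] [cphi _ PS] df] gy0 gP.
have [d d0 /nbhs_singleton inj] := C1_near_inj_scale cM lf.
(* Hyperbolicity of the potential enters here: the full pressure is that of [Sigma_c x N]. *)
rewrite -PS in gP.
have Slift := Sigma_liftable_often cM lf (C1funP (base Fphi.1)) c0.
by apply: (@lt_pressure_growth _ _ _ (base Fphi.1) (fiber Fphi.1) y0 lam Fphi.2 cM cN
  (local_diffeo_continuous lf) cg lam01 glam gy0 cphi _ d d0 inj Slift gamma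
  (local_diffeo_open_map lf) df gP).
Qed.

Lemma Gc_fixed Fphi : Gc Fam c Fphi -> exists y0, forall x, fiber Fphi.1 (x, y0) = y0.
Proof. by move=> [[]]. Qed.

(** An infinite pressure would make the growth of the preimage sums exceed the bound [K] for one
    step, or fall below the weight of a single preimage, which exists by surjectivity. *)
Lemma Gc_pressure_fin_num Fphi : Gc Fam c Fphi ->
  pressure (skew_map Fphi.1) Fphi.2 \is a fin_num.
Proof.
move=> GF; have [x _] := Gc_nonempty GF; have [y0 gy0] := Gc_fixed GF.
have [[/Fam_diffeo lf _ _ _] [cphi _ _] df] := GF.
have cpsi : continuous (slice y0 Fphi.2) := continuous_slice cphi.
have [B B0 psiB] := bounded_compact cM cpsi.
have [d d0 /nbhs_singleton inj] := C1_near_inj_scale cM lf.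
have [K K0 K1] := preim_sums1_bounded cM cpsi d0 inj.
have lt_ := @Gc_lt_pressure _ y0 _ GF gy0; have gt_ := @Gc_pressure_lt _ y0 _ GF gy0.
case: pressure lt_ gt_ => // lt_ gt_; exfalso.
  have [n n0 ge_] := lt_ (ln (K + 1) + 1) (ltry _).
  have K10 : 0 < K + 1 by rewrite ltr_wpDl.
  have le_ : preim_sums_le (base Fphi.1) (slice y0 Fphi.2) 1 (expR (ln (K + 1) * 1%:R)).
    by move=> z r /K1 /le_trans; apply; rewrite mulr1 lnK ?posrE// lerDl.
  by have := growth_rate_le x n0 (ltn0Sn 0) ge_ le_; lra.
have [D _ le_] := gt_ (- B - 1) (ltNyr _).
have := preim_sums_ge_surj 1 psiB (dense_preimages_surj df).
rewrite mul1r -[- B]mulr1 => ge_.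
by have := growth_rate_le_mul x (ltn0Sn 0) ge_ le_; lra.
Qed.

End Gc_growth.

Section nearby_data.
Context {R : realType}.

Lemma holder_near {X : metricType R} (a : R) (phi : holder X a) (e : R) : 0 < e ->
  \forall psi \near phi, forall p, `|holder_fun psi p - holder_fun phi p| < e.
Proof.
move=> e0.
have : nbhs phi [set psi : holder X a | holder_norm a (psi \- phi) < e].
  apply: open_nbhs_nbhs; split.
    exists [set [set psi : holder X a | holder_norm a (psi \- phi) < e]];
      last by rewrite bigcup_set1.
    by move=> _ ->; apply: finI_from1; exists phi, e.
  rewrite /= (_ : holder_norm a _ = 0)// /holder_norm /sup_norm /holder_seminorm.
  have supz (S : set R) : (forall r, S r -> r = 0) -> sup S = 0.
    move=> S0; have [->|/set0P[r Sr]] := eqVneq S set0; first by rewrite sup0.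
    rewrite (_ : S = [set 0]) ?sup1//.
    by apply/seteqP; split=> [q /S0 ->//|_ ->]; rewrite -(S0 r Sr).
  rewrite !supz ?addr0// => [_ [p [q [_ ->]]]|_ [p ->]] /=.
    by rewrite !subrr normr0 mul0r.
  by rewrite subrr normr0.
apply: filterS => psi /= small p; apply: le_lt_trans small.
have [B1 b1] := holder_bounded psi; have [B2 b2] := holder_bounded phi.
apply: (@le_trans _ _ (sup_norm (psi \- phi))).
  apply: ub_le_sup; last by exists p.
  exists (B1 + B2) => _ [q ->] /=; apply: le_trans (ler_normB _ _) _.
  by apply: lerD; [apply: b1|apply: b2]; exists q.
rewrite lerDl /holder_seminorm.
have [->|/set0P[r Sr]] := eqVneq (holder_quotients a (psi \- phi)) set0; first by rewrite sup0.
(* The seminorm is nonnegative in all cases, since the supremum of an unbounded set is 0 by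
   convention; so the norm dominates the sup norm. *)
have [[B bB]|nub] := pselect (has_ubound (holder_quotients a (psi \- phi))); last first.
  by rewrite sup_out// => -[].
apply: le_trans (ub_le_sup _ Sr); last by exists B.
by case: Sr => p' [q [_ ->]]; rewrite divr_ge0// powR_ge0.
Qed.

Lemma uniform_near {X : topologicalType} {Y : metricType R} (g : {uniform X -> Y}) (e : R) :
  0 < e -> \forall h \near g, forall p, mdist ((g : X -> Y) p) ((h : X -> Y) p) < e.
Proof.
move=> e0; apply/uniform_nbhs; exists [set xy | mdist xy.1 xy.2 < e]; split.
  have := @entourage_ball _ Y (PosNum e0).
  by apply: filterS => -[x y] /=; rewrite ballEmdist.
by move=> h /= gh p; exact: gh.
Qed.

End nearby_data.

(** * Transfer of growth bounds to nearby elements *)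

Section continuity.
Context {R : realType} {m : nat} {M N : metricType R} (A : riemannian m M).
Hypothesis cM : compact [set: M].
Hypothesis cN : compact [set: N].
Variables (Fam : set (C1map A)) (a c : R).
Hypothesis Fam_diffeo : forall f : C1map A, Fam f -> local_diffeo A f.
Hypothesis c0 : 0 < c.
Implicit Types (F : skew_data A N) (Fphi : skew_data A N * holder (M * N)%type a).

Let cMN : compact [set: M * N].
Proof. by rewrite -setXTT; exact: compact_setX. Qed.

(** The invariant section moves continuously: since [y1] is fixed by a fiber map within
    [(1 - lam) * d] of a [lam]-contraction fixing [y0], it is within [d] of [y0]. Only the
    contraction rate of the unperturbed map enters. *)
Lemma slice_near Fphi y0 (e : R) : Gc Fam c Fphi ->
  (forall x, fiber Fphi.1 (x, y0) = y0) -> 0 < e ->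
  exists2 d : R, 0 < d & \forall Gpsi \near Fphi, forall y1,
    (forall x, @fiber R m M N A Gpsi.1 (x, y1) = y1) -> forall x x', mdist x x' < d ->
    `|slice y0 Fphi.2 x - slice y1 (holder_fun Gpsi.2) x'| < e.
Proof.
case: Fphi => -[f g] phi GF gy0 e0; have [x0 _] := Gc_nonempty GF.
have [[_ _ [lam [/andP[lam0 lam1] glam]] _] [cphi _ _] _] := GF.
have e20 : 0 < e / 2 by rewrite divr_gt0.
have [d d0 dP] := unif_continuous_compact cMN cphi e20.
have ld0 : 0 < (1 - lam) * d by rewrite mulr_gt0// subr_gt0.
exists d => //.
exists ([set fg : skew_data A N | forall p, mdist (fiber (f, g) p) (fiber fg p) < (1 - lam) * d],
  [set psi : holder (M * N)%type a | forall p, `|holder_fun psi p - holder_fun phi p| < e / 2]).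
  split; last exact: holder_near.
  exists ([set: C1map A], [set h : {uniform (M * N)%type -> N} | forall p, mdist ((g : M * N -> N) p) ((h : M * N -> N) p) < (1 - lam) * d]).
    by split; [exact: filterT|exact: uniform_near].
  by move=> [f' g'] /= [_].
move=> [fg psi] /= [near_g near_psi] y1 hy1 x x' xx'.
have y01 : mdist y0 y1 < d.
  have := near_g (x0, y1); rewrite hy1 => h1.
  have h2 := glam x0 y0 y1.
  have := metric_triangle (fiber (f, g) (x0, y0)) (fiber (f, g) (x0, y1)) y1.
  rewrite {1}gy0 => tri.
  have l1 : 0 < 1 - lam by rewrite subr_gt0.
  rewrite -(ltr_pM2l l1) mulrBl mul1r ltrBlDl; apply: le_lt_trans tri _.
  by rewrite ler_ltD.
have : `|holder_fun phi (x, y0) - holder_fun phi (x', y1)| < e / 2.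
  by apply: dP; rewrite mdist_prod_lt xx' y01.
have := near_psi (x', y1).
rewrite /slice /= => h1 h2.
have -> : holder_fun phi (x, y0) - holder_fun psi (x', y1) =
  (holder_fun phi (x, y0) - holder_fun phi (x', y1)) -
  (holder_fun psi (x', y1) - holder_fun phi (x', y1)).
  by rewrite opprB addrA subrK.
by apply: le_lt_trans (ler_normB _ _) _; lra.
Qed.

(** Matching in both directions is needed: an upper bound passes to the nearby map by shadowing its
    orbits with orbits of [f], a lower bound by shadowing orbits of [f]. *)
Lemma preim_sums_near Fphi y0 n (e : R) : Gc Fam c Fphi ->
  (forall x, fiber Fphi.1 (x, y0) = y0) -> 0 < e ->
  \forall Gpsi \near Fphi, Gc Fam c Gpsi ->
    forall y1, (forall x, fiber Gpsi.1 (x, y1) = y1) ->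
    (forall B, preim_sums_le (base Fphi.1) (slice y0 Fphi.2) n B ->
      preim_sums_le (base Gpsi.1) (slice y1 (holder_fun Gpsi.2)) n (expR (n%:R * e) * B)) /\
    (forall B, preim_sums_ge (base Fphi.1) (slice y0 Fphi.2) n B ->
      preim_sums_ge (base Gpsi.1) (slice y1 (holder_fun Gpsi.2)) n (expR (- (n%:R * e)) * B)).
Proof.
move=> GF gy0 e0; set f := base Fphi.1.
have [[/Fam_diffeo lf _ _ _] _ _] := GF.
have of_ := local_diffeo_open_map lf; have cf := local_diffeo_continuous lf.
have [dinj dinj0 near_inj] := C1_near_inj_scale cM lf.
have injf := nbhs_singleton near_inj.
have [dpsi dpsi0 near_psi] := slice_near GF gy0 e0.
(* The last clause admits [f] on either side, so that one use of [lift_iter] gives both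
   directions. *)
pose C (r : R) (g h : M -> M) := [/\ forall x, mdist (g x) (h x) < r, open_map h,
  continuous h & g = f \/ h = f].
have Cle r r' g h : r <= r' -> C r g h -> C r' g h.
  by move=> rr' [gh oh ch ghf]; split=> // x; exact: lt_le_trans rr'.
have Clift d : 0 < d -> exists2 r : R, 0 < r & forall g h, C r g h ->
    forall y x', mdist (g y) x' < r -> exists2 y', mdist y y' < d & h y' = x'.
  move=> d0; have [r r0 rP] := preimage_lift cM (manifold_loc_connected A) cf
    (ex_intro2 _ _ dinj dinj0 injf) d0.
  (* Half, because when [h = f] the target is close to [g y], and must be within [r] of [f y]. *)
  exists (r / 2); first by rewrite divr_gt0.
  move=> g h [gh oh ch [gf|hf]] y x' yx'.
    apply: rP => //; last by rewrite -gf; lra.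
    by move=> x; rewrite -gf; apply: lt_trans (gh x) _; lra.
  have : mdist (f y) x' < r.
    have := metric_triangle (f y) (g y) x'; have := gh y; rewrite hf (metric_sym (g y) (f y)); lra.
  by rewrite hf; apply: rP => // x; rewrite mdistxx.
pose d := Num.min (dinj / 2) dpsi.
have d0 : 0 < d by rewrite lt_min dpsi0 divr_gt0.
have ddinj : d + d <= dinj.
  have : d <= dinj / 2 by rewrite ge_min lexx.
  by lra.
have ddpsi : d <= dpsi by rewrite ge_min lexx orbT.
have [r r0 rP] := lift_iter Cle Clift n d0.
have near_f : \forall Gpsi \near Fphi, forall x, mdist (f x) (base Gpsi.1 x) < r.
  have nf := C1_near_uniform cM f r0.
  exists ([set F | forall x, mdist (f x) (base F x) < r], setT); last by move=> [F psi] [].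
  split; last exact: filterT.
  exists ([set g : C1map A | forall x, mdist (f x) (g x) < r], setT); last by move=> [g h] [].
  by split; [exact: nf|exact: filterT].
have near_i : \forall Gpsi \near Fphi, inj_scale dinj (base Gpsi.1).
  exists ([set F | inj_scale dinj (base F)], setT); last by move=> [F psi] [].
  split; last exact: filterT.
  exists ([set g : C1map A | inj_scale dinj g], setT); last by move=> [g h] [].
  by split; [exact: near_inj|exact: filterT].
near=> Gpsi => GG y1 hy1.
have fh : forall x, mdist (f x) (base Gpsi.1 x) < r by near: Gpsi.
have injh : inj_scale dinj (base Gpsi.1) by near: Gpsi.
have psis : forall x x', mdist x x' < dpsi ->
    `|slice y0 Fphi.2 x - slice y1 (holder_fun Gpsi.2) x'| < e.
  suff : forall y1, (forall x, fiber Gpsi.1 (x, y1) = y1) -> forall x x', mdist x x' < dpsi ->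
      `|slice y0 Fphi.2 x - slice y1 (holder_fun Gpsi.2) x'| < e by apply.
  by near: Gpsi.
have [[/Fam_diffeo lh _ _ _] _ _] := GG; set h : M -> M := base Gpsi.1 in fh injh *.
have Cfh : C r f h.
  split=> //; [exact: local_diffeo_open_map|exact: local_diffeo_continuous|by left].
have Chf : C r h f by split=> //; [by move=> x; rewrite metric_sym|right].
have injh2 : inj_scale (d + d) h.
  by move=> u v uv; apply: injh; exact: lt_le_trans ddinj.
have injf2 : inj_scale (d + d) f.
  by move=> u v uv; apply: injf; exact: lt_le_trans ddinj.
split=> [B le_ x _ [s [us sx] ->]|B ge_ x].
  have [||q fq sq] := @shadow_sums _ _ h f (slice y1 (holder_fun Gpsi.2)) (slice y0 Fphi.2) d e n x x s
      injh2 _ us sx.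
  - move=> u v uv; have := psis v u; rewrite metric_sym => /(_ (lt_le_trans uv ddpsi)).
    by rewrite ltr_norml => /andP[]; lra.
  - by move=> u /sx ux; apply: (rP h f Chf); rewrite ux mdistxx.
  apply: le_trans sq _; rewrite ler_wpM2l ?expR_ge0//; exact: le_ fq.
have [_ [s [us sx] ->] Bs] := ge_ x.
have [||q hq sq] := @shadow_sums _ _ f h (slice y0 Fphi.2) (slice y1 (holder_fun Gpsi.2)) d e n x x s
    injf2 _ us sx.
- move=> u v uv; have := psis u v (lt_le_trans uv ddpsi).
  by rewrite ltr_norml => /andP[]; lra.
- by move=> u /sx ux; apply: (rP f h Cfh); rewrite ux mdistxx.
exists q => //; rewrite expRN mulrC ler_pdivrMr ?expR_gt0// mulrC.
exact: le_trans Bs sq.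
Unshelve. all: by end_near. Qed.

(** One upper bound at a time [k] and one lower bound at a time [n] pass to a neighborhood. There
    they are confronted with the growth bounds that a pressure outside [[p - 3e, p + 3e]] would
    give. *)
Lemma pressure_near Fphi (p e : R) : Gc Fam c Fphi ->
  pressure (skew_map Fphi.1) Fphi.2 = p%:E -> 0 < e ->
  \forall Gpsi \near Fphi, Gc Fam c Gpsi -> forall q : R,
    pressure (skew_map Gpsi.1) (holder_fun Gpsi.2) = q%:E -> `|p - q| <= 3 * e.
Proof.
move=> GF PE e0; have [x _] := Gc_nonempty GF; have [y0 gy0] := Gc_fixed GF.
have [D D0 le_] : exists2 D, 0 <= D & forall n,
    preim_sums_le (base Fphi.1) (slice y0 Fphi.2) n (D * expR ((p + e) * n%:R)).
  by apply: (Gc_pressure_lt cM cN Fam_diffeo GF gy0); rewrite PE lte_fin; lra.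
have [n n0 ge_] : exists2 n, (0 < n)%N &
    preim_sums_ge (base Fphi.1) (slice y0 Fphi.2) n (expR ((p - e) * n%:R)).
  by apply: (Gc_lt_pressure cM cN Fam_diffeo c0 GF gy0); rewrite PE lte_fin; lra.
(* At this time the factor [D] costs at most one more [e] in the rate. The rate [p + e] thus becomes
   [p + 2e], then [p + 3e] after perturbation. *)
pose k := (Num.truncn (D / e)).+1.
have Dk : D <= expR (e * k%:R).
  apply: le_trans (expR_ge1Dx _); apply: (@le_trans _ _ (e * k%:R)); last by rewrite lerDr.
  by rewrite mulrC -ler_pdivrMr//; apply: ltW; exact: truncnS_gt.
have near_k := preim_sums_near k GF gy0 e0.
have near_n := preim_sums_near n GF gy0 e0.
apply: filterS2 near_k near_n => Gpsi near_k near_n GG q QE.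
have [y1 hy1] := Gc_fixed GG.
have le_k : preim_sums_le (base Gpsi.1) (slice y1 (holder_fun Gpsi.2)) k (expR ((p + 3 * e) * k%:R)).
  have [h _] := near_k GG y1 hy1.
  move=> z r /(h _ (le_ k)) /le_trans; apply.
  rewrite (_ : (p + 3 * e) * k%:R = k%:R * e + (e * k%:R + (p + e) * k%:R)); last by ring.
  by rewrite !expRD ler_wpM2l ?expR_ge0// ler_wpM2r ?expR_ge0.
have ge_n : preim_sums_ge (base Gpsi.1) (slice y1 (holder_fun Gpsi.2)) n (expR ((p - 2 * e) * n%:R)).
  have [_ h] := near_n GG y1 hy1.
  move=> z; have [r zr sr] := h _ ge_ z; exists r => //; apply: le_trans sr.
  by rewrite -expRD ler_expR; lra.
rewrite ler_distlC; apply/andP; split; rewrite leNgt; apply/negP => pq.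
  have [|D' _ le_'] := Gc_pressure_lt cM cN Fam_diffeo (gamma := p - 3 * e) GG hy1.
    by rewrite QE lte_fin.
  by have := growth_rate_le_mul x n0 ge_n le_'; lra.
(* A rate strictly between [p + 3e] and [q]: below the pressure, yet above the upper bound
   [le_k]. *)
have [|n' n'0 ge_'] := Gc_lt_pressure cM cN Fam_diffeo c0 (gamma := (p + 3 * e + q) / 2) GG hy1.
  by rewrite QE lte_fin; lra.
by have := growth_rate_le x n'0 (ltn0Sn _) ge_' le_k; lra.
Qed.

End continuity.

Theorem corollary5p5 (R : realType) (m : nat) (M N : metricType R)
    (A : riemannian m M)
    (dM : riemannian_mdist A)
    (cM : compact [set: M])
    (cN : compact [set: N])
    (Fam : set (C1map A))
    (Fam_diffeo : forall f : C1map A, Fam f -> local_diffeo A f)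
    (a c : R) (a_gt0 : 0 < a) (c_gt0 : 0 < c) :
  let G : set (skew_data A N * holder (M * N)%type a) := Gc Fam c in
  let P := fun Fphi : skew_data A N * holder (M * N)%type a =>
    pressure (skew_map Fphi.1) Fphi.2 in
  (forall Fphi, G Fphi -> P Fphi \is a fin_num) /\
  {within G, continuous (fun Fphi => fine (P Fphi))}.
Proof.
move=> G P; split=> [Fphi|]; first exact: Gc_pressure_fin_num.
apply/subspace_continuousP => Fphi GF; apply/cvgrPdist_le => e e0.
have e30 : 0 < e / 3 by rewrite divr_gt0.
have fin := @Gc_pressure_fin_num _ _ _ _ _ cM cN _ a _ Fam_diffeo c_gt0.
have := pressure_near cM cN Fam_diffeo c_gt0 GF (esym (fineK (fin Fphi GF))) e30.
rewrite /within /=; apply: filterS => Gpsi h GG.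
by have := h GG _ (esym (fineK (fin Gpsi GG))); rewrite mulrC divfK.
Qed.
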